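(* Let $w_0\in\mathbb R$. Assume $\mathscr S^{*}\neq\varnothing$, that $U$ satisfies the utility assumption, and that we are in the whole-line setting. If $U(+\infty):=\lim_{x\to+\infty}U(x)<+\infty$, then there exists $\hat\phi\in\mathscr L$ such that $$u(w_0)=\inf_{S\in\mathscr S}\mathbb E_{\mathbb P}\big[U(W_T^S(w_0,\hat\phi))\big]<+\infty.$$
   Context: Fix $d,T\in\mathbb N$ and a filtered probability space $(\Omega,\mathcal F,\mathbb F=(\mathcal F_t)_{t=0}^T,\mathbb P)$ whose $\sigma$-algebras all contain the $\mathbb P$-null sets; random variables equal a.s. are identified. For $\mathcal G\subseteq\mathcal F$, $L^0(\mathcal G;\mathbb R^n)$ is the space of $\mathcal G$-measurable $\mathbb R^n$-valued random variables with the topology of convergence in probability. Let $\mathscr S$ be a nonempty family of $\mathbb F$-adapted $\mathbb R^d$-valued processes $S=(S_t)_{t=0}^T$, and write $\Delta S_t=S_t-S_{t-1}$. Let $\mathscr L=\prod_{t=1}^T L^0(\mathcal F_{t-1};\mathbb R^d)$. For $w\in\mathbb R$, $\phi\in\mathscr L$, $S\in\mathscr S$, set $W_t^S(w,\phi)=w+\sum_{s=1}^t\langle\phi_s,\Delta S_s\rangle$. For $S\in\mathscr S$ and $t\ge1$, $D_t^S(\omega)$ is the smallest affine subspace of $\mathbb R^d$ containing the support of the regular conditional distribution of $\Delta S_t$ given $\mathcal F_{t-1}$ at $\omega$. NA($S$) means: for every $\phi\in\mathscr L$, $W_T^S(0,\phi)\ge0$ a.s. implies $W_T^S(0,\phi)=0$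 a.s. $\mathscr S^{*}$ denotes the set of $S^*\in\mathscr S$ such that NA($S^*$) holds and, for every $S\in\mathscr S$ and $t$, $D_t^S\subseteq D_t^{S^*}$ a.s. Utility assumption: $U:\mathbb R\to\mathbb R\cup\{-\infty\}$ is non-decreasing, concave and upper semicontinuous. Whole-line setting: $U(x)>-\infty$ for all $x\in\mathbb R$, and every $\phi\in\mathscr L$ is admissible (i.e. $\mathscr L(w_0,S)=\mathscr L$ for all $S$). Value $u(w_0)=\sup_{\varphi\in\mathscr L}\inf_{S\in\mathscr S}\mathbb E_{\mathbb P}[U(W_T^S(w_0,\varphi))]$, with the convention that the expectation of a random variable whose positive and negative parts both have infinite expectation is $-\infty$. *)

(* Defs.v *)
From HB Require Import structures.
From mathcomp Require Import all_boot all_order all_algebra.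
From mathcomp Require Import all_classical all_reals all_analysis measurable_realfun.

Set Implicit Arguments.
Unset Strict Implicit.
Unset Printing Implicit Defensive.

Import Order.TTheory GRing.Theory Num.Theory.
Import numFieldNormedType.Exports.

Local Open Scope classical_set_scope.
Local Open Scope ring_scope.

Section defs.
Context {R : realType} {dO : measure_display} {Omega : measurableType dO}.
Variable (P : probability Omega R).
Variable (d : nat).

(* R^d is represented by d.-tuple R, equipped with the product (= Borel)
   sigma-algebra generated by the coordinate projections. *)
Notation Rd := (d.-tuple R).

Definition sub_measurable (G : set (set Omega)) {dV} {V : measurableType dV}
  (f : Omega -> V) : Prop :=
  forall B : set V, measurable B -> G (f @^-1` B).

Definition filtration (F : nat -> set (set Omega)) (T : nat) : Prop :=
  [/\ (forall t, (t <= T)%N -> sigma_algebra setT (F t)),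
      (forall t, (t <= T)%N -> F t `<=` measurable),
      (forall s t, (s <= t)%N -> (t <= T)%N -> F s `<=` F t) &
      (forall t, (t <= T)%N -> forall A, measurable A -> P A = 0%E -> F t A)].

Definition process := nat -> Omega -> Rd.

Definition adapted (F : nat -> set (set Omega)) (T : nat) (S : process) :=
  forall t, (t <= T)%N -> sub_measurable (F t) (S t).

Definition strategies (F : nat -> set (set Omega)) (T : nat) : set process :=
  [set phi | forall t, (1 <= t <= T)%N -> sub_measurable (F t.-1) (phi t)].

Definition dotp (x y : Rd) : R := \sum_(i < d) tnth x i * tnth y i.

Definition tsub (x y : Rd) : Rd := [tuple tnth x i - tnth y i | i < d].

Definition DeltaS (S : process) (t : nat) : Omega -> Rd :=
  fun w => tsub (S t w) (S t.-1 w).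

Definition wealth (S : process) (w : R) (phi : process) (t : nat) : Omega -> R :=
  fun om => w + \sum_(1 <= s < t.+1) dotp (phi s om) (DeltaS S s om).

Definition NA (F : nat -> set (set Omega)) (T : nat) (S : process) : Prop :=
  forall phi, strategies F T phi ->
    {ae P, forall om, 0 <= wealth S 0 phi T om} ->
    {ae P, forall om, wealth S 0 phi T om = 0}.

Definition rcd (G : set (set Omega)) (X : Omega -> Rd)
  (kappa : Omega -> probability Rd R) : Prop :=
  (forall B : set Rd, measurable B -> sub_measurable G (fun om => kappa om B : \bar R)) /\
  (forall B : set Rd, measurable B -> forall A, G A ->
     P (A `&` X @^-1` B) = (\int[P]_(om in A) kappa om B)%E).

Definition boxball (x : Rd) (e : R) : set Rd :=
  [set y | forall i : 'I_d, `|tnth y i - tnth x i| < e].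

Definition support (mu : set Rd -> \bar R) : set Rd :=
  [set x | forall e : R, 0 < e -> (0 < mu (boxball x e))%E].

Definition affine_comb (l : R) (x y : Rd) : Rd :=
  [tuple l * tnth x i + (1 - l) * tnth y i | i < d].

Definition affine_set (A : set Rd) : Prop :=
  forall x y, A x -> A y -> forall l : R, A (affine_comb l x y).

Definition affine_hull (A : set Rd) : set Rd :=
  [set x | forall B, affine_set B -> A `<=` B -> B x].

(* D_t^S(om) = affine hull of the support of the r.c.d. of Delta S_t
   given F_{t-1}, evaluated at om *)
Definition D_incl (F : nat -> set (set Omega)) (T : nat) (S S' : process) : Prop :=
  forall t, (1 <= t <= T)%N ->
  forall kappa kappa',
    rcd (F t.-1) (DeltaS S t) kappa -> rcd (F t.-1) (DeltaS S' t) kappa' ->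
    {ae P, forall om, affine_hull (support (kappa om)) `<=`
                      affine_hull (support (kappa' om))}.

Definition Sstar (F : nat -> set (set Omega)) (T : nat) (Sfam : set process) :
  set process :=
  [set S' | [/\ Sfam S', NA F T S' & forall S, Sfam S -> D_incl F T S S']].

(* expectation with the convention (+oo) - (+oo) = -oo *)
Definition Econv (X : Omega -> \bar R) : \bar R :=
  if ((\int[P]_om (X^\+ om))%E == +oo%E) && ((\int[P]_om (X^\- om))%E == +oo%E)
  then (-oo)%E
  else (\int[P]_om (X^\+ om) - \int[P]_om (X^\- om))%E.

Definition utility (U : R -> \bar R) : Prop :=
  [/\ (forall x, U x != +oo%E),
      (forall x y : R, x <= y -> (U x <= U y)%E),
      (forall (x y l : R), (0 <= l <= 1)%R ->
         (l%:E * U x + (1 - l)%R%:E * U y <= U (l * x + (1 - l) * y)%R)%E) &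
      (forall (x : R) (c : \bar R), (U x < c)%E -> \forall y \near x, (U y < c)%E)].

Definition robust_value (F : nat -> set (set Omega)) (T : nat)
  (Sfam : set process) (U : R -> \bar R) (phi : process) (w0 : R) : \bar R :=
  ereal_inf [set Econv (fun om => U (wealth S w0 phi T om)) | S in Sfam].

Definition value (F : nat -> set (set Omega)) (T : nat)
  (Sfam : set process) (U : R -> \bar R) (w0 : R) : \bar R :=
  ereal_sup [set robust_value F T Sfam U phi w0 | phi in strategies F T].

End defs.

(* Main.v *)
Require Import Defs.
From HB Require Import structures.
From mathcomp Require Import all_boot all_order all_algebra.
From mathcomp Require Import all_classical all_reals all_analysis measurable_realfun.
From mathcomp Require Import ring lra.

Set Implicit Arguments.
Unset Strict Implicit.
Unset Printing Implicit Defensive.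

Import Order.TTheory GRing.Theory Num.Theory.
Import numFieldNormedType.Exports.

Local Open Scope classical_set_scope.
Local Open Scope ring_scope.

(* Write V = sup U - U >= 0, a convex nonincreasing loss, so that an optimal
   strategy minimises the supremum over S of the expected loss E[V(W_T^S)].

   If h_t is predictable and <h_t, Delta S*_t> = 0 almost surely, then the
   conditional support of Delta S*_t, hence its affine hull, lies in the
   orthogonal complement of h_t; by the inclusion of the affine hulls
   <h_t, Delta S_t> = 0 for every S.  Subtracting from a strategy its pointwise
   projection onto these null directions therefore leaves all wealths unchanged.

   For reduced strategies, the no-arbitrage condition for S* yields, one period at
   a time, a predictable weight alpha > 0 with
   alpha (w^- + |h|) <= E[gamma (w + <h, Delta S*>)^- | F_{t-1}] whenever w <= 0.
   Since V dominates a multiple of x^- up to a constant (unless it is constant),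
   iterating backward and then forward in time bounds near-optimal reduced
   strategies in L^1 of an equivalent measure.

   Finally, from a decreasing sequence of convex sets bounded in such an L^1 one
   can extract an almost surely convergent sequence, by nearly minimising
   E[exp(-.)] over positive and negative parts; Fatou's lemma for V shows that the
   limit of near-optimal reduced strategies is optimal. *)

(** The bound mentioned in the overview concerns [S0], the chosen element of $\mathscr S^{*}$, and
    its weight depends on no strategy; this gives one fixed equivalent measure for the whole
    near-optimal family. Other price processes enter only through the reduction, which preserves
    each wealth almost surely, and through a separate use of Fatou's lemma, so $\mathscr S$ may be
    uncountable. No random set is selected from measurably. Pointwise minimisation is replaced by
    minimising an expectation over predictable functions, by the same compactness argument as for
    the final limit. Local statements are recovered by modifying the minimiser: a pointwise rescaled
    variation for the projection, a pasting on an event for the no-arbitrage bound. Wealth need not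
    be integrable, so conditional inequalities are written as inequalities between integrals of
    nonnegative functions carrying predictable multipliers. Finally, [D_incl] quantifies over
    regular conditional distributions, so it yields something only once their existence is
    proved. *)

Section expectation_ge0.
Context {R : realType} {dO : measure_display} {Omega : measurableType dO}.
Variable P : probability Omega R.
Implicit Types f g : Omega -> R.

(** Meant for nonnegative functions, for which the extended value is additive without any
    integrability condition. *)
Definition Ex f : \bar R := (\int[P]_x (f x)%:E)%E.

Lemma Ex_ge0 f : (forall x, 0 <= f x) -> (0 <= Ex f)%E.
Proof. by move=> f0; apply: integral_ge0 => x _; rewrite lee_fin. Qed.

Lemma ae_le_Ex f g : measurable_fun setT f -> measurable_fun setT g ->
  (forall x, 0 <= f x) -> (forall x, 0 <= g x) ->
  {ae P, forall x, f x <= g x} -> (Ex f <= Ex g)%E.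
Proof.
move=> mf mg f0 g0 fg; apply: ae_ge0_le_integral => //.
- by move=> x _; rewrite lee_fin.
- exact/measurable_EFinP.
- by move=> x _; rewrite lee_fin.
- exact/measurable_EFinP.
- by apply: filterS fg => x fgx _; rewrite lee_fin.
Qed.

Lemma le_Ex f g : measurable_fun setT f -> measurable_fun setT g ->
  (forall x, 0 <= f x) -> (forall x, f x <= g x) -> (Ex f <= Ex g)%E.
Proof.
move=> mf mg f0 fg; apply: ae_le_Ex => //; last exact: nearW.
by move=> x; apply: le_trans (fg x).
Qed.

Lemma ae_eq_Ex f g : measurable_fun setT f -> measurable_fun setT g ->
  (forall x, 0 <= f x) -> (forall x, 0 <= g x) ->
  {ae P, forall x, f x = g x} -> Ex f = Ex g.
Proof.
move=> mf mg f0 g0 fg; apply/eqP; rewrite eq_le.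
by rewrite !ae_le_Ex//; apply: filterS fg => x ->.
Qed.

Lemma eq_Ex f g : (forall x, f x = g x) -> Ex f = Ex g.
Proof. by move=> fg; apply: eq_integral => x _; rewrite fg. Qed.

Lemma ExD f g : measurable_fun setT f -> measurable_fun setT g ->
  (forall x, 0 <= f x) -> (forall x, 0 <= g x) ->
  Ex (fun x => f x + g x) = (Ex f + Ex g)%E.
Proof.
move=> mf mg f0 g0; rewrite /Ex -ge0_integralD//.
- by move=> x _; rewrite lee_fin.
- exact/measurable_EFinP.
- by move=> x _; rewrite lee_fin.
- exact/measurable_EFinP.
Qed.

Lemma ExZ k f : measurable_fun setT f -> (forall x, 0 <= f x) -> 0 <= k ->
  Ex (fun x => k * f x) = (k%:E * Ex f)%E.
Proof.
move=> mf f0 k0; rewrite /Ex -ge0_integralZl_EFin//.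
- by move=> x _; rewrite lee_fin.
- exact/measurable_EFinP.
Qed.

Lemma Ex_sum (I : Type) (s : seq I) (f : I -> Omega -> R) :
  (forall i, measurable_fun setT (f i)) -> (forall i x, 0 <= f i x) ->
  Ex (fun x => \sum_(i <- s) f i x) = (\sum_(i <- s) Ex (f i))%E.
Proof.
move=> mf f0; rewrite /Ex -ge0_integral_sum//.
- by apply: eq_integral => x _; rewrite sumEFin.
- by move=> i; exact/measurable_EFinP.
- by move=> i x _; rewrite lee_fin.
Qed.

Lemma Ex_cst k : Ex (fun=> k) = k%:E.
Proof. by rewrite /Ex integral_cst// [X in (_ * X)%E]probability_setT mule1. Qed.

Lemma Ex_fin_num f K : measurable_fun setT f -> (forall x, 0 <= f x <= K) ->
  Ex f \is a fin_num.
Proof.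
move=> mf fK; rewrite ge0_fin_numE; last by apply: Ex_ge0 => x; case/andP: (fK x).
apply: (@le_lt_trans _ _ (Ex (fun=> K))); last by rewrite Ex_cst ltry.
by apply: le_Ex => // x; case/andP: (fK x).
Qed.

Lemma Ex_eq0 f : measurable_fun setT f -> (forall x, 0 <= f x) ->
  Ex f = 0%E -> {ae P, forall x, f x = 0}.
Proof.
move=> mf f0 Ef0.
have mf' : measurable_fun setT (EFin \o f) by exact/measurable_EFinP.
have /(ae_eq_integral_abs P measurableT mf') : (\int[P]_x `|(EFin \o f) x|)%E = 0%E.
  by rewrite -[RHS]Ef0; apply: eq_integral => x _; rewrite /= ger0_norm.
by apply: filterS => x /(_ Logic.I) [].
Qed.

Lemma Ex_lty_ae (f : nat -> Omega -> R) :
  (forall n, measurable_fun setT (f n)) -> (forall n x, 0 <= f n x) ->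
  (\sum_(0 <= n <oo) Ex (f n) < +oo)%E ->
  {ae P, forall x, (\sum_(0 <= n <oo) (f n x)%:E < +oo)%E}.
Proof.
move=> mf f0 fin.
have mf' n : measurable_fun setT (EFin \o f n) by exact/measurable_EFinP.
have s0 x : (0 <= \sum_(0 <= n <oo) (f n x)%:E)%E.
  by apply: nneseries_ge0 => n _ _; rewrite lee_fin.
have : P.-integrable setT (fun x => \sum_(0 <= n <oo) (f n x)%:E)%E.
  apply/integrableP; split.
    apply: (@ge0_emeasurable_sum _ _ _ _ (fun n x => (f n x)%:E) predT).
      by move=> n x _ _; rewrite lee_fin.
    by move=> n _; exact: mf'.
  rewrite (eq_integral (fun x => \sum_(0 <= n <oo) (f n x)%:E)%E); last first.
    by move=> x _; rewrite gee0_abs.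
  by rewrite integral_nneseries// => n x _; rewrite lee_fin.
move=> /(integrable_ae measurableT); apply: filterS => x /(_ Logic.I).
by rewrite ge0_fin_numE.
Qed.

(** The expected increments are summable, so by Tonelli the telescoping series converges absolutely
    almost surely. *)
Lemma ae_cvg_of_fast_Cauchy (u : nat -> Omega -> R) (C : R) :
  (forall n, measurable_fun setT (u n)) ->
  (forall n, (Ex (fun x => `|u n.+1 x - u n x|)%R <= (C * 2^-1 ^+ n)%:E)%E) ->
  {ae P, forall x, cvgn (fun n => u n x)}.
Proof.
move=> mu uC; pose f n x : R := `|u n.+1 x - u n x|.
have f0 n x : 0 <= f n x by exact: normr_ge0.
have mf n : measurable_fun setT (f n).
  by apply: measurableT_comp => //; apply: measurable_funB.
have C0 : 0 <= C.
  have := le_trans (Ex_ge0 _) (uC 0%N).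
  by rewrite lee_fin expr0 mulr1; apply => x.
have /(Ex_lty_ae mf f0) : (\sum_(0 <= n <oo) Ex (f n) < +oo)%E.
  apply: (@le_lt_trans _ _ (2 * C)%:E); last exact: ltry.
  apply: lime_le.
    by apply: is_cvg_nneseries => n _ _; apply: Ex_ge0 => x; rewrite /f.
  apply: nearW => n.
  apply: (@le_trans _ _ (\sum_(0 <= i < n) (C * 2^-1 ^+ i)%:E)%E).
    by apply: lee_sum => i _; exact: uC.
  rewrite sumEFin lee_fin.
  have := @geometric_le_lim R n C 2^-1 C0.
  rewrite /series /geometric /= => h.
  have := h _ _.
  rewrite invr_gt0 ltr0n ger0_norm ?invr_ge0 ?ler0n// invf_lt1 ?ltr1n//.
  move=> /(_ isT isT) /le_trans; apply.
  rewrite le_eqVlt; apply/orP; left; apply/eqP.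
  by field.
apply: filterS => x fin.
have h : cvgn (series (telescope (fun n => u n x))).
  apply: normed_cvg.
  rewrite /normed_series_of /=.
  apply: nondecreasing_is_cvgn.
    apply/nondecreasing_seqP => n; rewrite /series /= big_nat_recr//= lerDl.
    exact: normr_ge0.
  exists (fine (\sum_(0 <= n <oo) (f n x)%:E)) => _ [n _ <-] /=.
  rewrite -lee_fin fineK; last by rewrite ge0_fin_numE// nneseries_ge0// => *; rewrite
      lee_fin /f.
  rewrite /series /= -sumEFin; apply: nneseries_lim_ge => k _ _; by rewrite lee_fin.
rewrite (_ : (fun n => u n x) = (fun n => u 0%N x + series (telescope (fun n => u n x)) n)).
  by apply: is_cvgD => //; exact: is_cvg_cst.
by apply/funext => n; exact: eq_sum_telescope.
Qed.

Lemma ae_forall_fin (J : finType) (A : J -> Omega -> Prop) :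
  (forall j, {ae P, forall x, A j x}) -> {ae P, forall x, forall j, A j x}.
Proof.
move=> key.
have [s sP] : exists s : seq J, forall j, j \in s by exists (enum J) => j; rewrite mem_enum.
have : {ae P, forall x, forall j, j \in s -> A j x}.
  elim: s {sP} => [|j s IH]; first exact: nearW.
  apply: filterS2 IH (key j) => x h1 h2 i; rewrite inE => /orP[/eqP ->//|]; exact: h1.
by apply: filterS => x h j; apply: h; exact: sP.
Qed.

End expectation_ge0.

(** * Almost sure convergence in convex sets *)

Section convex_cvg.
Context {R : realType} {dO : measure_display} {Omega : measurableType dO}.
Variable P : probability Omega R.
Variable J : finType.
Implicit Types y z : J -> Omega -> R.

Let Esum z := Ex P (fun x => \sum_j expR (- z j x)).
Let val z : R := fine (Esum z).

(* Near-minimisers z_n of E[sum_j exp(-z_j)] over D n make exp(-z_n / 2) a Cauchy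
   sequence in L^2, since E(e^{-a/2} - e^{-b/2})^2 = E e^{-a} + E e^{-b} - 2 E
       e^{-(a+b)/2}. *)
Lemma midpoint_convex_ae_cvg_expR (D : nat -> set (J -> Omega -> R)) :
  (forall n, D n.+1 `<=` D n) -> (forall n, D n !=set0) ->
  (forall n y z, D n y -> D n z -> D n (fun j x => (y j x + z j x) / 2)) ->
  (forall n y, D n y -> forall j, measurable_fun setT (y j)) ->
  (forall n y, D n y -> forall j x, 0 <= y j x) ->
  exists z : nat -> J -> Omega -> R, (forall n, D n (z n)) /\
    {ae P, forall x, forall j, cvgn (fun n => expR (- (z n j x / 2)))}.
Proof.
move=> Ddec Dn0 Dmid Dm D0.
have mexp y j (k : R) : measurable_fun setT (y j) -> measurable_fun setT (fun x => expR
    (- (y j x / k))).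
  move=> my; apply: measurableT_comp => //; apply: measurableT_comp => //.
  by apply: measurable_funM.
have mexp1 y j : measurable_fun setT (y j) -> measurable_fun setT (fun x => expR (- (y
    j x))).
  by move=> my; apply: measurableT_comp => //; apply: measurableT_comp.
have msum y : (forall j, measurable_fun setT (y j)) ->
    measurable_fun setT (fun x => \sum_j expR (- y j x)).
  by move=> my; apply: measurable_sum => j; exact: mexp1.
have sum0 y x : 0 <= \sum_j expR (- y j x) by apply: sumr_ge0 => j _; exact: expR_ge0.
have valE n y : D n y -> Esum y = (val y)%:E.
  move=> Dy; rewrite /val fineK//; apply: (@Ex_fin_num _ _ _ _ _ #|J|%:R).
    by apply: msum => j; exact: Dm Dy j.
  move=> x; rewrite sum0/=.
  apply: (@le_trans _ _ (\sum_(j : J) 1)); last by rewrite sumr_const.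
  apply: ler_sum => j _; rewrite -expR0 ler_expR oppr_le0; exact: D0 Dy j x.
have val_ge0 y : 0 <= val y by apply: fine_ge0; exact: Ex_ge0.
have val_le n y : D n y -> val y <= #|J|%:R.
  move=> Dy; rewrite -lee_fin -(valE _ _ Dy) -(Ex_cst P #|J|%:R).
  apply: le_Ex => //; first by apply: msum => j; exact: Dm Dy j.
  move=> x; apply: (@le_trans _ _ (\sum_(j : J) 1)); last by rewrite sumr_const.
  apply: ler_sum => j _; rewrite -expR0 ler_expR oppr_le0; exact: D0 Dy j x.
have Dmono n m : (n <= m)%N -> D m `<=` D n.
  elim: m => [|m IH]; first by rewrite leqn0 => /eqP ->.
  rewrite leq_eqVlt => /orP[/eqP -> //|]; rewrite ltnS => /IH h.
  by apply: subset_trans h; exact: Ddec.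
pose V n := inf [set val y | y in D n].
have lbV n : has_inf [set val y | y in D n].
  split; first by have [y Dy] := Dn0 n; exists (val y), y.
  by exists 0 => _ [y _ <-].
have V_le n y : D n y -> V n <= val y.
  by move=> Dy; apply: ge_inf; [case: (lbV n)|exists y].
have supV : has_sup (range V).
  split; first by exists (V 0%N), 0%N.
  exists #|J|%:R => _ [n _ <-]; have [y Dy] := Dn0 n.
  by apply: le_trans (V_le _ _ Dy) _; exact: val_le Dy.
pose Vs := sup (range V).
(* Gaps of order 4^-n in value give L^2 distances of order 2^-n, which are summable. *)
pose e n : R := 4^-1 ^+ n.
have e0 n : 0 < e n by rewrite exprn_gt0// invr_gt0 ltr0n.
have eS n : e n.+1 <= e n.
  by rewrite /e exprS ger_pMl// invf_le1// ler1n.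
have VVs n : V n <= Vs by apply: ub_le_sup; [case: supV|exists n].
have Vmono n m : (n <= m)%N -> V n <= V m.
  move=> nm; apply: lb_le_inf; first by case: (lbV m).
  by move=> _ [y /(Dmono _ _ nm) Dy <-]; exact: V_le.
(* The level [p.2] is taken so far out that its infimum is within [e k] of the limit [Vs] of all
   infima; a near-minimiser at that level is then near [Vs] as well. *)
have ex k : exists p : (J -> Omega -> R) * nat,
    [/\ (k <= p.2)%N, D p.2 p.1, val p.1 <= Vs + e k & Vs - e k <= V p.2].
  have [_ [N _ <-] hN] := sup_adherent (e0 k) supV.
  pose M := maxn N k.
  have hM : Vs - e k <= V M.
    by apply: (le_trans (ltW hN)); apply: Vmono; exact: leq_maxl.
  have [_ [y Dy <-] hy] := inf_adherent (e0 k) (lbV M).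
  exists (y, M); split => //=; first exact: leq_maxr.
  by apply: (le_trans (ltW hy)); rewrite lerD2r; exact: VVs.
have [f fP] := choice ex.
pose z n := (f n).1.
have Dz n : D n (z n) by have [kn Df _ _] := fP n; exact: Dmono kn _ Df.
have mz n j : measurable_fun setT (z n j) by exact: Dm (Dz n) j.
exists z; split => //.
pose u j n x : R := expR (- (z n j x / 2)).
have mu j n : measurable_fun setT (u j n) by apply: mexp; exact: mz.
pose Q n := Ex P (fun x => \sum_j (u j n.+1 x - u j n x) ^+ 2).
have mQ j n : measurable_fun setT (fun x => (u j n.+1 x - u j n x) ^+ 2).
  by apply: measurable_funX; apply: measurable_funB; exact: mu.
have Qle n : (Q n <= (4 * e n)%:E)%E.
  pose m := fun j x => (z n j x + z n.+1 j x) / 2.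
  have [n1 D1 v1 V1] := fP n; have [n2 D2 v2 V2] := fP n.+1.
  rewrite -/(z n) in D1 v1; rewrite -/(z n.+1) in D2 v2.
  have V2' : Vs - e n <= V (f n.+1).2 by apply: le_trans V2; rewrite lerB.
  (* Both terms lie in the larger set, of index [N], hence so does their midpoint, whose value is
     therefore at least [Vs - e n]. *)
  pose N := minn (f n).2 (f n.+1).2.
  have DN : D N m.
    by apply: Dmid; [apply: Dmono D1; exact: geq_minl|apply: Dmono D2; exact: geq_minr].
  have VN : Vs - e n <= V N by rewrite /N /minn; case: ifP.
  have vm : Vs - e n <= val m by apply: (le_trans VN); exact: V_le.
  have mm j : measurable_fun setT (m j) by exact: Dm DN j.
  have id : (Q n + 2%:E * (val m)%:E = (val (z n))%:E + (val (z n.+1))%:E)%E.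
    rewrite -(valE _ _ DN) -(valE _ _ (Dz n)) -(valE _ _ (Dz n.+1)).
    have mzn k : measurable_fun setT (fun x => \sum_j expR (- z k j x)).
      by apply: msum => j; exact: mz.
    have mmn : measurable_fun setT (fun x => \sum_j expR (- m j x)) by exact: msum.
    have mm2 : measurable_fun setT (fun x => 2 * \sum_j expR (- m j x)).
      exact: measurable_funM.
    have mm20 x : 0 <= 2 * \sum_j expR (- m j x) by apply: mulr_ge0.
    have mQ' : measurable_fun setT (fun x => \sum_j (u j n.+1 x - u j n x) ^+ 2).
      by apply: measurable_sum => j.
    have Q0' x : 0 <= \sum_j (u j n.+1 x - u j n x) ^+ 2.
      by apply: sumr_ge0 => j _; exact: sqr_ge0.
    rewrite /Q /Esum -ExZ//.
    rewrite -!ExD//.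
    apply: eq_Ex => x; rewrite mulr_sumr -!big_split/=; apply: eq_bigr => j _.
    rewrite /u.
    have e1 a : expR (- a) = expR (- (a / 2)) ^+ 2 :> R.
      by rewrite -expRM_natl; congr expR; field.
    rewrite (e1 (z n j x)) (e1 (z n.+1 j x)).
    have -> : expR (- m j x) = expR (- (z n j x / 2)) * expR (- (z n.+1 j x / 2)) :> R.
      by rewrite -expRD; congr expR; rewrite /m; field.
    by ring.
  have Qfin : Q n \is a fin_num.
    move: id; case: (Q n) => //=.
  move: id; rewrite -(fineK Qfin) -EFinM -!EFinD => -[id].
  rewrite lee_fin; have := eS n; lra.
have key j : {ae P, forall x, cvgn (fun n => u j n x)}.
  apply: (@ae_cvg_of_fast_Cauchy _ _ _ _ _ 5) => // n.
  have Qj : (Ex P (fun x => (u j n.+1 x - u j n x) ^+ 2)%R <= (4 * e n)%:E)%E.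
    apply: le_trans (Qle n); apply: le_Ex => //.
    - by apply: measurable_sum => i.
    - by move=> x; exact: sqr_ge0.
    - move=> x; rewrite (bigD1 j)//= lerDl.
      by apply: sumr_ge0 => i _; exact: sqr_ge0.
  have p2 : 0 < 2 ^+ n :> R by rewrite exprn_gt0.
  (* From 2|t| <= 2^n t^2 + 2^-n: the second moment bound 4 * 4^-n becomes 5 * 2^-n, whence the
     constant 5. *)
  apply: (@le_trans _ _ (Ex P (fun x => 2 ^+ n * (u j n.+1 x - u j n x) ^+ 2 + 2^-1 ^+ n))).
    apply: le_Ex => //.
    - by apply: measurableT_comp => //; apply: measurable_funB; exact: mu.
    - by apply: measurable_funD => //; apply: measurable_funM.
    - move=> x; set t := u j n.+1 x - u j n x.
      have -> : t ^+ 2 = `|t| ^+ 2 by rewrite real_normK ?num_real.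
      have := sqr_ge0 (2 ^+ n * `|t| - 1); rewrite exprVn => h.
      have h2 : 0 <= (2 ^+ n)^-1 * (2 ^+ n * `|t| - 1) ^+ 2 by apply: mulr_ge0 => //;
          rewrite invr_ge0 ltW.
      have id : (2 ^+ n)^-1 * (2 ^+ n * `|t| - 1) ^+ 2 = 2 ^+ n * `|t| ^+ 2 + (2 ^+
          n)^-1 - 2 * `|t|.
        by field; rewrite gt_eqF.
      have := normr_ge0 t; rewrite id in h2; lra.
  rewrite ExD//; first last.
  - by move=> x; apply: mulr_ge0; [exact: ltW|exact: sqr_ge0].
  - by apply: measurable_funM.
  rewrite ExZ//; last by move=> x; exact: sqr_ge0.
  rewrite Ex_cst.
  apply: (@le_trans _ _ ((2 ^+ n)%:E * (4 * e n)%:E + (2^-1 ^+ n)%:E)%E).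
    by rewrite leeD2r// lee_pmul2l// lte_fin.
  rewrite -EFinM -EFinD lee_fin.
  rewrite le_eqVlt; apply/orP; left; apply/eqP.
  rewrite /e (_ : 4^-1 = 2^-1 * 2^-1); last by field.
  rewrite exprMn mulrCA mulrA -mulrA.
  by rewrite [2 ^+ n * _]mulrA -exprMn divff// expr1n mul1r; ring.
exact: ae_forall_fin.
Qed.

End convex_cvg.

(** * Fatou's lemma along near-optimal sequences *)

Section fatou.
Context {R : realType} {dO : measure_display} {Omega : measurableType dO}.
Variable P : probability Omega R.

Lemma limn_einf_ge (u : nat -> \bar R) c :
  (\forall n \near \oo, (c <= u n)%E) -> (c <= limn_einf u)%E.
Proof.
move=> [N _ h]; rewrite limn_einf_lim; apply: lime_ge; first exact: is_cvg_einfs.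
exists N => // n /= Nn; apply: le_ereal_inf_tmp => _ [k /= nk <-].
by apply: h => /=; exact: leq_trans nk.
Qed.

Lemma limn_einf_le (u : nat -> \bar R) (K : R) :
  (forall n, (u n <= (K + n.+1%:R^-1)%:E)%E) -> (limn_einf u <= K%:E)%E.
Proof.
move=> h; apply/lee_addgt0Pr => e e0; rewrite limn_einf_lim.
apply: lime_le; first exact: is_cvg_einfs.
have : \forall n \near \oo, n.+1%:R^-1 < e by exact: near_infty_natSinv_lt (PosNum e0).
apply: filterS => n ne.
apply: (@le_trans _ _ (u n)); first by apply: ereal_inf_lbound; exists n => /=.
by apply: (le_trans (h n)); rewrite -EFinD lee_fin lerD2l ltW.
Qed.

Lemma measurable_fun_limn_einf (f : nat -> Omega -> \bar R) :
  (forall n, measurable_fun setT (f n)) ->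
  measurable_fun setT (fun x => limn_einf (f^~ x)).
Proof.
move=> mf; rewrite (_ : (fun x => _) =
    (fun x => - limn_esup (fun n => - f n x))%E); last first.
  by apply/funext => x; rewrite -[LHS]oppeK -limn_esupN.
apply: measurableT_comp => //; apply: measurable_fun_limn_esup => n.
exact: measurableT_comp.
Qed.

(** The pointwise lower bound is phrased with reals c < h x, the form in which lower semicontinuity
    of the loss and convergence of indicators of half-lines are available. *)
Lemma Ex_fatou (f : nat -> Omega -> R) (h : Omega -> R) (K : R) :
  (forall n, measurable_fun setT (f n)) -> (forall n x, 0 <= f n x) ->
  measurable_fun setT h -> (forall x, 0 <= h x) ->
  {ae P, forall x, forall c, c < h x -> \forall n \near \oo, c <= f n x} ->
  (forall n, (Ex P (f n) <= (K + n.+1%:R^-1)%:E)%E) -> (Ex P h <= K%:E)%E.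
Proof.
move=> mf f0 mh h0 fh fK.
have mf' n : measurable_fun setT (EFin \o f n) by exact/measurable_EFinP.
have f0' n x : setT x -> (0 <= (f n x)%:E)%E by rewrite lee_fin.
apply: le_trans (limn_einf_le fK).
apply: le_trans (fatou P measurableT mf' f0').
apply: ae_ge0_le_integral => //.
- by move=> x _; rewrite lee_fin.
- exact/measurable_EFinP.
- by move=> x _; apply: limn_einf_ge; apply: nearW => n; rewrite lee_fin.
- exact: measurable_fun_limn_einf.
apply: filterS fh => x hx _; apply/lee_subgt0Pr => e e0.
rewrite -EFinB; apply: limn_einf_ge.
by apply: filterS (hx (h x - e) _) => [n /=|]; rewrite ?lee_fin// ltrBlDr ltrDl.
Qed.

Lemma Ex_fatou_cvg (f : nat -> Omega -> R) (h : Omega -> R) (K : R) :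
  (forall n, measurable_fun setT (f n)) -> (forall n x, 0 <= f n x) ->
  measurable_fun setT h -> (forall x, 0 <= h x) ->
  {ae P, forall x, f n x @[n --> \oo] --> h x} ->
  (forall n, (Ex P (f n) <= (K + n.+1%:R^-1)%:E)%E) -> (Ex P h <= K%:E)%E.
Proof.
move=> mf f0 mh h0 fh; apply: Ex_fatou => //.
apply: filterS fh => x fx c ch.
by apply: cvgr_ge fx _ _.
Qed.

(* If z_n tended to infinity on a non-negligible set, Fatou's lemma would make
   the integrals of g z_n unbounded. *)
Lemma ae_cvg_of_cvg_expR (z : nat -> Omega -> R) (g : Omega -> R) (K : R) :
  (forall n, measurable_fun setT (z n)) -> (forall n x, 0 <= z n x) ->
  measurable_fun setT g -> (forall x, 0 < g x) ->
  (forall n, (Ex P (fun x => g x * z n x)%R <= K%:E)%E) ->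
  {ae P, forall x, cvgn (fun n => expR (- (z n x / 2)))} ->
  {ae P, forall x, cvgn (fun n => z n x)}.
Proof.
move=> mz z0 mg g0 zK cz.
pose f n x := (g x * z n x)%:E.
have mf n : measurable_fun setT (f n) by apply/measurable_EFinP; exact: measurable_funM.
have f0 n x : setT x -> (0 <= f n x)%E by move=> _; rewrite lee_fin mulr_ge0// ltW.
have F := fatou P measurableT mf f0.
have le0 x : (0 <= limn_einf (f^~ x))%E by apply: limn_einf_ge; apply: nearW => n;
    exact: f0.
have : P.-integrable setT (fun x => limn_einf (f^~ x)).
  apply/integrableP; split; first exact: measurable_fun_limn_einf.
  rewrite (eq_integral (fun x => limn_einf (f^~ x))); last by move=> x _; rewrite gee0_abs.
  apply: (le_lt_trans F); apply: (@le_lt_trans _ _ K%:E); last exact: ltry.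
  apply: limn_einf_le => n; apply: (le_trans (zK n)).
  by rewrite lee_fin lerDl invr_ge0.
move=> /(integrable_ae measurableT); apply: filterS2 cz => x cx /(_ Logic.I) fin.
set l := limn (fun n => expR (- (z n x / 2))) in cx.
have l0 : 0 <= l by apply: limr_ge => //; apply: nearW => n; exact: expR_ge0.
have zE n : z n x = - 2 * ln (expR (- (z n x / 2))) by rewrite expRK; field.
have [l_eq|lpos] : l = 0 \/ 0 < l by move: l0; rewrite le_eqVlt => /orP[/eqP <-|];
    [left|right].
- exfalso; move: fin.
  suff -> : limn_einf (f^~ x) = +oo%E by [].
  apply/eqyP => A A0; apply: limn_einf_ge.
  have gx := g0 x.
  have : \forall n \near \oo, expR (- (z n x / 2)) <= expR (- (A / g x / 2)).
    have := cx; rewrite -/l l_eq => h; apply: cvgr_le h _ _; exact: expR_gt0.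
  apply: filterS => n; rewrite ler_expR lerN2 lee_fin => h.
  have h' : A / g x <= z n x by lra.
  by rewrite mulrC -ler_pdivrMr.
- rewrite (_ : (fun n => z n x) = (fun n => - 2 * ln (expR (- (z n x / 2))))); last by
    apply/funext => n; exact: zE.
  apply: is_cvgM; first exact: is_cvg_cst.
  apply/cvg_ex; exists (ln l).
  apply: continuous_cvg; first exact: continuous_ln.
  exact: cx.
Qed.

End fatou.

Section convex_ae_cvg.
Context {R : realType} {dO : measure_display} {Omega : measurableType dO}.
Variable P : probability Omega R.
Variable J : finType.

(** Signed functions are split into two nonnegative ones, indexed by [J * bool]. The weighted bound
    keeps these parts from escaping to infinity, so convergence of their exponentials gives
    convergence of the parts. *)
Lemma midpoint_convex_ae_cvg (C : nat -> set (J -> Omega -> R)) (g : Omega -> R) (K : R) :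
  (forall n, C n.+1 `<=` C n) -> (forall n, C n !=set0) ->
  (forall n y z, C n y -> C n z -> C n (fun j x => (y j x + z j x) / 2)) ->
  (forall n y, C n y -> forall j, measurable_fun setT (y j)) ->
  measurable_fun setT g -> (forall x, 0 < g x) ->
  (forall y, C 0%N y -> forall j, (Ex P (fun x => g x * `|y j x|)%R <= K%:E)%E) ->
  exists y : nat -> J -> Omega -> R, (forall n, C n (y n)) /\
    {ae P, forall x, forall j, cvgn (fun n => y n j x)}.
Proof.
move=> Cdec Cn0 Cmid Cm mg g0 CK.
have C0 n : C n `<=` C 0%N.
  by elim: n => // n IH; apply: subset_trans IH; exact: Cdec.
pose D n : set (J * bool -> Omega -> R) := [set z : J * bool -> Omega -> R |
  [/\ forall k, measurable_fun setT (z k), forall k x, 0 <= z k x,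
      forall k, (Ex P (fun x => g x * z k x)%R <= K%:E)%E &
      C n (fun j x => z (j, true) x - z (j, false) x)]].
have [||||| z [Dz cz]] := @midpoint_convex_ae_cvg_expR _ _ _ P (J * bool)%type D.
- by move=> n z [? ? ?]; split => //; exact: Cdec.
- move=> n; have [y Cy] := Cn0 n.
  pose sg (b : bool) : R := if b then 1 else -1.
  pose z (k : J * bool) x := (`|y k.1 x| + sg k.2 * y k.1 x) / 2.
  have my j : measurable_fun setT (y j) by exact: Cm Cy j.
  have may j : measurable_fun setT (fun x => `|y j x|) by exact: measurableT_comp.
  have mz k : measurable_fun setT (z k).
    apply: measurable_funM => //; apply: measurable_funD => //.
    exact: measurable_funM.
  have z0 k x : 0 <= z k x.
    rewrite /z /sg; have := ler_norm (y k.1 x); have := lerNnormlW (lexx `|y k.1 x|).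
    by case: k.2; lra.
  have zle k x : z k x <= `|y k.1 x|.
    rewrite /z /sg; have := ler_norm (y k.1 x); have := lerNnormlW (lexx `|y k.1 x|).
    by case: k.2; lra.
  exists z; split => //.
    move=> k; apply: le_trans (CK y (C0 n _ Cy) k.1); apply: le_Ex => //.
    - exact: measurable_funM.
    - exact: measurable_funM.
    - by move=> x; rewrite mulr_ge0// ltW.
    - by move=> x; rewrite ler_pM2l.
  rewrite (_ : (fun j x => _) = y)//; apply/funext => j; apply/funext => x.
  by rewrite /z/=; field.
- move=> n y z [my y0 yK Cy] [mz z0 zK Cz]; split => //.
  + by move=> k; apply: measurable_funM => //; exact: measurable_funD.
  + by move=> k x; rewrite divr_ge0// addr_ge0.
  + move=> k.
    rewrite (@eq_Ex _ _ _ _ _ (fun x => 2^-1 * (g x * y k x + g x * z k x))); last first.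
      by move=> x; field.
    have my' : measurable_fun setT (fun x => g x * y k x) by exact: measurable_funM.
    have mz' : measurable_fun setT (fun x => g x * z k x) by exact: measurable_funM.
    have y0' x : 0 <= g x * y k x by rewrite mulr_ge0// ltW.
    have z0' x : 0 <= g x * z k x by rewrite mulr_ge0// ltW.
    rewrite ExZ//; [|exact: measurable_funD|by move=> x; rewrite addr_ge0].
    rewrite ExD// (_ : K = 2^-1 * (K + K)); last by field.
    by rewrite EFinM lee_pmul2l ?lte_fin ?invr_gt0// EFinD leeD.
  + have := Cmid n _ _ Cy Cz; congr (C n _); apply/funext => j; apply/funext => x.
    by field.
- by move=> n z [].
- by move=> n z [].
have {}cz k : {ae P, forall x, cvgn (fun n => z n k x)}.
  apply: (@ae_cvg_of_cvg_expR _ _ _ P (fun n => z n k) g K) => //.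
  - by move=> n; have [] := Dz n.
  - by move=> n; have [] := Dz n.
  - by move=> n; have [] := Dz n.
  - by apply: filterS cz => x; exact.
exists (fun n j x => z n (j, true) x - z n (j, false) x); split.
  by move=> n; have [] := Dz n.
apply: ae_forall_fin => j; apply: filterS2 (cz (j, true)) (cz (j, false)) => x h1 h2.
exact: is_cvgB.
Qed.

End convex_ae_cvg.

(** * Conditional expectations *)

(** [G] is made the sigma-algebra of a copy of the type, so that the usual closure rules for
    measurable functions apply to it. *)
Notation gmeas G f := (measurable_fun [set: g_sigma_algebraType G] f).

Lemma measurable_inv (R : realType) : measurable_fun [set: R] (@GRing.inv R).
Proof.
rewrite -(setUv [set 0 : R]); apply/measurable_funU => //; first exact: measurableC.
split; first exact: measurable_fun_set1.
apply: open_continuous_measurable_fun; first by apply: closed_openC; exact: closed_eq.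
move=> x; rewrite inE => x0; apply: inv_continuous; exact/eqP.
Qed.

Lemma measurable_funV (R : realType) d (T : measurableType d) (f : T -> R) :
  measurable_fun setT f -> measurable_fun setT (fun x => (f x)^-1).
Proof. by move=> mf; apply: measurableT_comp => //; exact: measurable_inv. Qed.

Section gmeas.
Context {R : realType} {dO : measure_display} {Omega : measurableType dO}.
Variable P : probability Omega R.
Variable G : set (set Omega).
Hypothesis sG : sigma_algebra setT G.

Lemma sub_measurableP dV (V : measurableType dV) (f : Omega -> V) :
  sub_measurable G f <-> gmeas G f.
Proof.
split=> [mf _ B mB|mf B mB].
  by rewrite (measurable_g_measurableTypeE sG) setTI; exact: mf.
by have := mf measurableT B mB; rewrite (measurable_g_measurableTypeE sG) setTI.
Qed.

Hypothesis GM : G `<=` measurable.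

Lemma gmeas_measurable dV (V : measurableType dV) (f : Omega -> V) :
  gmeas G f -> measurable_fun [set: Omega] f.
Proof.
move=> mf _ B mB; apply: GM.
by rewrite -(measurable_g_measurableTypeE sG); exact: mf.
Qed.

(** Convergence will hold only almost surely, but the limit has to be [G]-measurable everywhere: the
    limit superior, made real by [fine], agrees with the limit wherever there is one. *)
Lemma gmeas_lim (y : nat -> Omega -> R) : (forall n, gmeas G (y n)) ->
  exists z : Omega -> R, gmeas G z /\ forall x, cvgn (fun n => y n x) -> y n x @[n -->
      \oo] --> z x.
Proof.
move=> my; exists (fun x => fine (limn_esup (fun n => (y n x)%:E))); split.
  apply: measurableT_comp => //; apply: measurable_fun_limn_esup => n.
  exact/measurable_EFinP.
move=> x cy; have h : (y n x)%:E @[n --> \oo] --> (limn (fun n => y n x))%:E.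
  by apply: cvg_EFin; [exact: nearW|exact: cy].
by rewrite (cvg_limn_einf_sup h).2.
Qed.

(** The sum is the minimum of [K] and the integer part of [a]. *)
Lemma count_le (a : R) (K : nat) : 0 <= a ->
  let s := \sum_(k < K) (if k.+1%:R <= a then 1 else 0 : R) in
  s <= a /\ s <= K%:R /\ (a - 1 <= s \/ K%:R <= s).
Proof.
move=> a0 /=; elim: K => [|K [IH1 [IH2 IH3]]]; first by rewrite big_ord0; split => //;
    split => //; right.
rewrite big_ord_recr/=; move: IH1 IH2 IH3; set s := \sum_(_ < _) _ => IH1 IH2 IH3.
rewrite -natr1; case: ifPn => h; first split; [lra|split; [lra|]|].
  by case: IH3 => ?; [left|right]; lra.
rewrite -ltNge in h.
by split; [lra|split; [lra|left; case: IH3 => ?; lra]].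
Qed.

(* m is approximated from below by its truncated integer parts at mesh 1/(n+1). *)
Lemma Ex_multiplier (f g m : Omega -> R) :
  measurable_fun setT f -> measurable_fun setT g ->
  (forall x, 0 <= f x) -> (forall x, 0 <= g x) ->
  (forall b : Omega -> bool, gmeas G b ->
    (Ex P (fun x => if b x then f x else 0%R) <=
     Ex P (fun x => if b x then g x else 0%R))%E) ->
  gmeas G m -> (forall x, 0 <= m x) ->
  (Ex P (fun x => m x * f x)%R <= Ex P (fun x => m x * g x)%R)%E.
Proof.
move=> mf mg f0 g0 fg mm m0.
have mm' := gmeas_measurable mm.
pose b n k x : bool := k.+1%:R <= m x * n.+1%:R.
have mb n k : gmeas G (b n k).
  by apply: measurable_fun_ler => //; apply: measurable_funM.
have mb' n k : measurable_fun setT (b n k) by exact: gmeas_measurable (mb n k).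
(* With (n+1)^2 levels of mesh 1/(n+1) the truncation occurs at height n+1, so it disappears at each
   point as the mesh shrinks. *)
pose mn n x : R := \sum_(k < n.+1 ^ 2) (if b n k x then n.+1%:R^-1 else 0).
have mnE n x : mn n x = n.+1%:R^-1 * \sum_(k < n.+1 ^ 2) (if b n k x then 1 else 0).
  by rewrite mulr_sumr; apply: eq_bigr => k _; case: ifP => _; rewrite ?mulr1 ?mulr0.
have mn0 n x : 0 <= mn n x by apply: sumr_ge0 => k _; case: ifP; rewrite ?invr_ge0.
have Np n : 0 < n.+1%:R :> R by rewrite ltr0n.
have mnle n x : mn n x <= m x.
  have [h _] := count_le (n.+1 ^ 2) (mulr_ge0 (m0 x) (ltW (Np n))).
  by rewrite mnE mulrC ler_pdivrMr.
have mm_n n : measurable_fun setT (mn n).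
  by apply: measurable_sum => k; apply: measurable_fun_ifT.
have mmf : measurable_fun setT (fun x => m x * f x) by exact: measurable_funM.
have mmg : measurable_fun setT (fun x => m x * g x) by exact: measurable_funM.
have mmnf n : measurable_fun setT (fun x => mn n x * f x) by exact: measurable_funM.
have mmng n : measurable_fun setT (fun x => mn n x * g x) by exact: measurable_funM.
have key n : (Ex P (fun x => mn n x * f x)%R <= Ex P (fun x => m x * g x)%R)%E.
  apply: (@le_trans _ _ (Ex P (fun x => mn n x * g x)%R)); last first.
    by apply: le_Ex => // x; [exact: mulr_ge0|exact: ler_wpM2r].
  have ifE (h : Omega -> R) : Ex P (fun x => mn n x * h x)%R =
      Ex P (fun x => \sum_(k < n.+1 ^ 2) n.+1%:R^-1 * (if b n k x then h x else 0))%R.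
    apply: eq_Ex => x; rewrite /mn mulr_suml; apply: eq_bigr => k _.
    by case: ifP => _; rewrite ?mul0r ?mulr0.
  have if0 k (h : Omega -> R) : (forall x, 0 <= h x) -> forall x, 0 <= (if b n k x then
      h x else 0).
    by move=> h0 x; case: ifP.
  have mif k (h : Omega -> R) : measurable_fun setT h -> measurable_fun setT (fun x =>
      if b n k x then h x else 0).
    by move=> mh; exact: measurable_fun_ifT.
  have if0' k (h : Omega -> R) : (forall x, 0 <= h x) -> forall x, 0 <= n.+1%:R^-1 *
      (if b n k x then h x else 0).
    by move=> h0 x; rewrite mulr_ge0 ?invr_ge0 ?if0.
  have mif' k (h : Omega -> R) : measurable_fun setT h -> measurable_fun setT (fun x =>
      n.+1%:R^-1 * (if b n k x then h x else 0)).
    by move=> mh; apply: measurable_funM => //; exact: mif.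
  rewrite !ifE !Ex_sum; [|by move=> k; auto..].
  apply: lee_sum => k _; rewrite !ExZ ?invr_ge0//; [|by auto..].
  by apply: lee_wpmul2l; [rewrite lee_fin invr_ge0|exact: fg].
case: (boolP (Ex P (fun x => m x * g x)%R \is a fin_num)) => [fin|]; last first.
  rewrite ge0_fin_numE; last by apply: Ex_ge0 => x; exact: mulr_ge0.
  by rewrite ltey negbK => /eqP ->; exact: leey.
rewrite -(fineK fin).
apply: (@Ex_fatou_cvg _ _ _ _ (fun n x => mn n x * f x)) => //.
- by move=> n x; exact: mulr_ge0.
- by move=> x; exact: mulr_ge0.
- apply: nearW => x; apply: cvgM; last exact: cvg_cst.
  apply: (@squeeze_cvgr _ _ _ _ (fun n => m x - n.+1%:R^-1) (fun=> m x)); first last.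
  + exact: cvg_cst.
  + rewrite -[X in _ --> X]subr0; apply: cvgB; first exact: cvg_cst.
    exact: cvg_harmonic.
  exists (Num.truncn (m x)).+1 => // n /= hn; rewrite mnle andbT.
  have [_ [_ h]] := count_le (n.+1 ^ 2) (mulr_ge0 (m0 x) (ltW (Np n))).
  have mxn : m x <= n.+1%:R.
    apply: (le_trans (ltW (truncnS_gt _))); rewrite ler_nat.
    by apply: (leq_trans hn).
  rewrite mnE; rewrite -(ler_pM2l (Np n)) mulrA divff ?gt_eqF// mul1r mulrBr divff
      ?gt_eqF//.
  rewrite mulrC; case: h => // h.
  apply: le_trans h; rewrite natrX expr2.
  have : m x * n.+1%:R <= n.+1%:R * n.+1%:R by rewrite ler_pM2r.
  lra.
- by move=> n; rewrite EFinD fineK//; apply: (le_trans (key n)); rewrite leeDl//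
    lee_fin invr_ge0.
Qed.

(** Tested on the event g < f: there f - g is nonnegative with zero integral, the finite integral of
    g having been cancelled. *)
Lemma ae_le_of_Ex (f g : Omega -> R) : gmeas G f -> gmeas G g ->
  (forall x, 0 <= f x) -> (forall x, 0 <= g x) -> (Ex P g < +oo)%E ->
  (forall b : Omega -> bool, gmeas G b ->
    (Ex P (fun x => if b x then f x else 0%R) <=
     Ex P (fun x => if b x then g x else 0%R))%E) ->
  {ae P, forall x, f x <= g x}.
Proof.
move=> mf mg f0 g0 gfin fg.
pose b x := g x < f x.
have mb : gmeas G b by exact: measurable_fun_ltr.
have mb' := gmeas_measurable mb.
have mf' := gmeas_measurable mf; have mg' := gmeas_measurable mg.
have mbg : measurable_fun setT (fun x => if b x then g x else 0) by exact:
    measurable_fun_ifT.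
have mbf : measurable_fun setT (fun x => if b x then f x - g x else 0).
  by apply: measurable_fun_ifT => //; exact: measurable_funB.
have bg0 x : 0 <= (if b x then g x else 0) by case: ifP.
have bf0 x : 0 <= (if b x then f x - g x else 0).
  by rewrite /b; case: ifPn => // h; rewrite subr_ge0 ltW.
have bgfin : Ex P (fun x => if b x then g x else 0%R) \is a fin_num.
  rewrite ge0_fin_numE ?Ex_ge0//; apply: le_lt_trans gfin; apply: le_Ex => // x.
  by case: ifP.
have : Ex P (fun x => if b x then f x - g x else 0%R)%R = 0%E.
  apply/eqP; rewrite eq_le Ex_ge0// andbT.
  have := fg b mb.
  rewrite (@eq_Ex _ _ _ P (fun x => if b x then f x else 0) (fun x =>
    (if b x then f x - g x else 0) + (if b x then g x else 0))); last first.
    by move=> x; case: ifP => _; rewrite ?subrK ?addr0.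
  by rewrite ExD// -[leRHS]add0e leeD2rE.
move/(Ex_eq0 mbf bf0); apply: filterS => x; rewrite /b; case: ifPn.
  by move=> h /eqP; rewrite subr_eq0 => /eqP ->.
by rewrite -leNgt.
Qed.

Lemma Ex_if (b : Omega -> bool) (f : Omega -> R) :
  Ex P (fun x => if b x then f x else 0) = (\int[P]_(x in [set x | b x]) (f x)%:E)%E.
Proof.
rewrite integral_mkcond; apply: eq_integral => x _; rewrite patchE.
case: ifPn => h; first by rewrite mem_set.
by rewrite memNset//=; exact/negP.
Qed.

(** A Radon-Nikodym derivative on [G] of the measure with density f. It is taken among charges, so
    its sign has to be corrected to be nonnegative everywhere. *)
Lemma cond_exp_ge0 (f : Omega -> R) : measurable_fun setT f ->
  (forall x, 0 <= f x <= 1) ->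
  exists e : Omega -> R, [/\ gmeas G e, forall x, 0 <= e x &
    forall b : Omega -> bool, gmeas G b ->
      Ex P (fun x => if b x then e x else 0) = Ex P (fun x => if b x then f x else 0)].
Proof.
move=> mf f01.
have f0 x : 0 <= f x by case/andP: (f01 x).
(* Pushing forward along the identity onto the coarser sigma-algebra is restriction to [G]. *)
have mid : measurable_fun [set: Omega] (id : Omega -> g_sigma_algebraType G).
  by apply: gmeas_measurable; exact: measurable_id.
pose X : {mfun Omega >-> g_sigma_algebraType G} := mfun_Sub (mem_set mid).
pose mu := distribution P X.
have intf : P.-integrable setT (EFin \o f).
  apply/integrableP; split; first exact/measurable_EFinP.
  rewrite (eq_integral (EFin \o f)); last by move=> x _; rewrite /= ger0_norm.
  apply: (@le_lt_trans _ _ (Ex P (fun=> 1))); last by rewrite Ex_cst ltry.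
  by apply: le_Ex => // x; case/andP: (f01 x).
pose nu0 : {charge set Omega -> \bar R} := induced_charge intf.
have nu0P : nu0 `<< P.
  apply/null_content_dominatesP => A mA PA; rewrite /nu0 /= /induced_charge.
  rewrite -[LHS]gee0_abs; last by apply: integral_ge0 => x _; rewrite lee_fin.
  rewrite (eq_integral (fun x => `|(EFin \o f) x|)%E); last first.
    by move=> x _; rewrite gee0_abs// lee_fin.
  rewrite integral_abs_eq0 ?abse0//.
  by apply: measurable_funTS; exact/measurable_EFinP.
pose nu : {charge set (g_sigma_algebraType G) -> \bar R} :=
  @measure_function_pushforward__canonical__charge_Charge _ _ _ (g_sigma_algebraType G)
      X R nu0 mid.
have numu : nu `<< mu by exact: (dominates_pushforward mid nu0P).
pose e0 := Radon_Nikodym nu mu.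
have e0fin x : e0 x \is a fin_num by exact: Radon_Nikodym_fin_num.
have e0int : mu.-integrable setT e0 by exact: Radon_Nikodym_integrable.
have me0 : measurable_fun [set: g_sigma_algebraType G] e0 by exact: measurable_int e0int.
pose r (x : Omega) : R := fine (e0 x).
have mr : gmeas G r by exact: measurableT_comp.
have mr' : measurable_fun setT r by exact: gmeas_measurable.
have e0intP : P.-integrable setT (e0 \o X).
  have /integrableP[_ h] := e0int; apply/integrableP; split.
    by apply: (@gmeas_measurable _ _ e0).
  by move: h; rewrite ge0_integral_pushforward//; exact: measurableT_comp.
have rE0 (b : Omega -> bool) : gmeas G b ->
    (\int[P]_(x in [set x | b x]) (r x)%:E = \int[P]_(x in [set x | b x]) (f x)%:E)%E.
  move=> mb.
  have mA : measurable ([set x | b x] : set (g_sigma_algebraType G)).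
    by rewrite -[X in measurable X]setTI; apply: (mb measurableT [set true]).
  transitivity (nu [set x | b x]); last by [].
  rewrite (Radon_Nikodym_integral numu mA) integral_pushforward//.
    by apply: eq_integral => x _; rewrite /r fineK.
  apply: integrableS e0intP => //.
  by rewrite -[X in measurable X]setTI; apply: (mid measurableT).
have rE (b : Omega -> bool) : gmeas G b ->
    Ex P (fun x => if b x then r x else 0) = Ex P (fun x => if b x then f x else 0).
  by move=> mb; rewrite !Ex_if; exact: rE0.
(* On a [G]-event where r <= 0 the integral of f equals that of r, so it is both nonnegative and
   nonpositive; replacing r by its positive part changes no integral. *)
have neg (b : Omega -> bool) : gmeas G b -> (forall x, b x -> r x <= 0) ->
    Ex P (fun x => if b x then f x else 0) = 0%E.
  move=> mb rle; have mb' := gmeas_measurable mb.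
  apply/eqP; rewrite eq_le Ex_ge0 ?andbT; last by move=> x; case: ifP.
  rewrite Ex_if// -rE0// (eq_integral (fun x => - (- r x)%:E)%E); last first.
    by move=> x _; rewrite EFinN oppeK.
  rewrite integral_ge0N ?oppe_le0; last first.
    by move=> x bx; rewrite lee_fin oppr_ge0; exact: rle.
  by apply: integral_ge0 => x bx; rewrite lee_fin oppr_ge0; exact: rle.
exists (fun x => Num.max (r x) 0); split.
- by apply: measurable_maxr.
- by move=> x; rewrite le_max lexx orbT.
move=> b mb.
have mb1 : gmeas G (fun x => b x && (0 <= r x)).
  by apply: measurable_and => //; exact: measurable_fun_ler.
have mb2 : gmeas G (fun x => b x && (r x < 0)).
  by apply: measurable_and => //; exact: measurable_fun_ltr.
transitivity (Ex P (fun x => if b x && (0 <= r x) then r x else 0)).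
  by apply: eq_Ex => x; case: (b x) => //=; case: leP.
rewrite rE//.
rewrite -[LHS]adde0 -(neg _ mb2); last by move=> x /andP[_ /ltW].
rewrite -ExD//.
- by apply: eq_Ex => x; case: (b x) => //=; rewrite ?addr0//; case: leP; rewrite ?addr0
    ?add0r.
- by apply: measurable_fun_ifT => //; exact: gmeas_measurable.
- by apply: measurable_fun_ifT => //; exact: gmeas_measurable.
- by move=> x; case: ifP.
- by move=> x; case: ifP.
Qed.

(** Comparison with the constant 1 gives the upper bound almost surely; truncation then makes it
    hold at every point. *)
Lemma cond_exp_exists (f : Omega -> R) : measurable_fun setT f ->
  (forall x, 0 <= f x <= 1) ->
  exists e : Omega -> R, [/\ gmeas G e, forall x, 0 <= e x <= 1 &
    forall b : Omega -> bool, gmeas G b ->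
      Ex P (fun x => if b x then e x else 0) = Ex P (fun x => if b x then f x else 0)].
Proof.
move=> mf f01; have [e [me e0 eE]] := cond_exp_ge0 mf f01.
have mif (b : Omega -> bool) (h : Omega -> R) : gmeas G b -> measurable_fun setT h ->
    measurable_fun setT (fun x => if b x then h x else 0).
  by move=> mb mh; apply: measurable_fun_ifT => //; exact: gmeas_measurable.
have e1 : {ae P, forall x, e x <= 1}.
  apply: ae_le_of_Ex => //; first by rewrite Ex_cst ltry.
  move=> b mb; rewrite eE//; apply: le_Ex; [exact: mif|exact: mif|..].
  - by move=> x; case: ifP => // _; case/andP: (f01 x).
  - by move=> x; case: ifP => // _; case/andP: (f01 x).
have me1 : gmeas G (fun x => Num.min (e x) 1) by exact: measurable_minr.
exists (fun x => Num.min (e x) 1); split => //.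
  by move=> x; rewrite le_min e0 ler01 ge_min lexx orbT.
move=> b mb; rewrite -eE//; apply: ae_eq_Ex.
- by apply: mif => //; exact: gmeas_measurable.
- by apply: mif => //; exact: gmeas_measurable.
- by move=> x; case: ifP => // _; rewrite le_min e0 ler01.
- by move=> x; case: ifP.
- by apply: filterS e1 => x ex; case: ifP => // _; rewrite min_l.
Qed.

End gmeas.

Lemma cvg_sum (R : realType) (I : Type) (s : seq I) (f : nat -> I -> R) (a : I -> R) :
  (forall i, f n i @[n --> \oo] --> a i) ->
  (\sum_(i <- s) f n i) @[n --> \oo] --> \sum_(i <- s) a i.
Proof.
move=> h; apply: (@cvg_big R I +%R 0 predT _ _ _ _ (fun i n => f n i)).
  exact: add_continuous.
by move=> i _; exact: h.
Qed.

(** * Projection onto null strategies *)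

Section argmin.
Context {R : realType} {dO : measure_display} {Omega : measurableType dO}.
Variable P : probability Omega R.
Variable G : set (set Omega).
Hypothesis sG : sigma_algebra setT G.
Hypothesis GM : G `<=` measurable.

(** The direct method for an integrand [phi] midpoint convex in its second argument: sublevel sets
    are midpoint convex and bounded in L^1, and Fatou gives lower semicontinuity. Closedness of [C]
    allows a modification on a null set, because constraints that hold at every point may fail for
    the limit where there is no convergence. *)
Lemma argmin_exists (J : finType) (C : set (J -> Omega -> R))
    (phi : Omega -> (J -> R) -> R) (K : R) :
  (forall y z, C y -> C z -> C (fun j x => (y j x + z j x) / 2)) ->
  (forall y, C y -> forall j, gmeas G (y j)) ->
  (forall (y : nat -> J -> Omega -> R) (z : J -> Omega -> R), (forall n, C (y n)) ->
     (forall j, gmeas G (z j)) ->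
     {ae P, forall x, forall j, y n j x @[n --> \oo] --> z j x} ->
     exists2 z', C z' & {ae P, forall x, forall j, z' j x = z j x}) ->
  (forall y, C y -> measurable_fun setT (fun x => phi x (y^~ x))) ->
  (forall x v, 0 <= phi x v) ->
  (forall x v w, phi x (fun j => (v j + w j) / 2) <= (phi x v + phi x w) / 2) ->
  (forall x (v : nat -> J -> R) w, (forall j, v n j @[n --> \oo] --> w j) ->
     phi x (v n) @[n --> \oo] --> phi x w) ->
  (forall y, C y -> forall j,
    (Ex P (fun x => `|y j x|)%R <= K%:E + Ex P (fun x => phi x (y^~ x)))%E) ->
  (exists2 y, C y & (Ex P (fun x => phi x (y^~ x)) < +oo)%E) ->
  exists2 z, C z & forall y, C y ->
    (Ex P (fun x => phi x (z^~ x)) <= Ex P (fun x => phi x (y^~ x)))%E.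
Proof.
move=> Cmid Cm Ccl mphi phi0 phimid phicts Cbd [y0 Cy0 y0fin].
pose c (y : J -> Omega -> R) := Ex P (fun x => phi x (y^~ x)).
have c0 y : (0 <= c y)%E by exact: Ex_ge0.
pose m := ereal_inf [set c y | y in C].
have m_le y : C y -> (m <= c y)%E by move=> Cy; apply: ereal_inf_lbound; exists y.
have m0 : (0 <= m)%E by apply: le_ereal_inf_tmp => _ [y _ <-].
have mfin : m \is a fin_num by rewrite ge0_fin_numE//; apply: le_lt_trans y0fin; exact:
    m_le.
pose D n : set (J -> Omega -> R) := [set y | C y /\ (c y <= (fine m + n.+1%:R^-1)%:E)%E].
have mg y : C y -> forall j, measurable_fun setT (y j).
  by move=> Cy j; apply: (gmeas_measurable sG GM); exact: Cm.
have [|||||||y [Dy cy]] := @midpoint_convex_ae_cvg _ _ _ P J D (fun=> 1) (K + (fine m + 1)).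
- move=> n y [Cy hy]; split => //; apply: (le_trans hy).
  by rewrite lee_fin lerD2l lef_pV2 ?posrE// ler_nat.
- move=> n; have e0 : 0 < n.+1%:R^-1 :> R by rewrite invr_gt0.
  have [_ [y Cy <-] hy] := lb_ereal_inf_adherent e0 mfin.
  by exists y; split => //; rewrite EFinD fineK// ltW.
- move=> n y z [Cy hy] [Cz hz]; split; first exact: Cmid.
  have my := mphi _ Cy; have mz := mphi _ Cz.
  apply: (@le_trans _ _ (Ex P (fun x => 2^-1 * (phi x (y^~ x) + phi x (z^~ x))))).
    apply: le_Ex => //; first exact: mphi _ (Cmid _ _ Cy Cz).
      by apply: measurable_funM => //; exact: measurable_funD.
    by move=> x; rewrite mulrC; exact: phimid.
  rewrite ExZ//; [|exact: measurable_funD|by move=> x; exact: addr_ge0].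
  rewrite ExD//.
  move: hy hz; rewrite /c; set a := fine m + _ => hy hz.
  apply: (@le_trans _ _ (2^-1%:E * (a%:E + a%:E))%E).
    by apply: lee_wpmul2l => //; apply: leeD.
  by rewrite -EFinD -EFinM lee_fin -[X in X <= _]mulr1; lra.
- by move=> n y [Cy _]; exact: mg.
- exact: measurable_cst.
- by move=> x.
- move=> y [Cy hy] j; under eq_Ex do rewrite mul1r.
  apply: (le_trans (Cbd _ Cy j)); rewrite EFinD leeD2l//.
  by apply: (le_trans hy); rewrite invr1.
have Cyn n : C (y n) by have [] := Dy n.
have /choice[z hz] j : exists z : Omega -> R, gmeas G z /\
    forall x, cvgn (fun n => y n j x) -> y n j x @[n --> \oo] --> z x.
  by apply: gmeas_lim => n; exact: Cm.
have [z' Cz' z'z] := Ccl y z Cyn (fun j => (hz j).1) (filterS (fun x h j => (hz j).2 x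
    (h j)) cy).
exists z' => // w Cw; apply: le_trans (m_le _ Cw).
rewrite -(fineK mfin).
apply: (@Ex_fatou_cvg _ _ _ _ (fun n x => phi x ((y n)^~ x))) => //.
- by move=> n; exact: mphi.
- exact: mphi.
- apply: filterS2 cy z'z => x cx zx; apply: phicts => j; rewrite zx.
  by apply: (hz j).2.
- by move=> n; have [] := Dy n.
Qed.

End argmin.

Section projection.
Context {R : realType} {dO : measure_display} {Omega : measurableType dO}.
Variable P : probability Omega R.
Variable G : set (set Omega).
Hypothesis sG : sigma_algebra setT G.
Hypothesis GM : G `<=` measurable.
Variables (I : finType) (X : I -> Omega -> R).

Definition null_strategy (h : I -> Omega -> R) :=
  (forall i, gmeas G (h i)) /\ {ae P, forall x, \sum_i h i x * X i x = 0}.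

Lemma null_strategyD h k (s : Omega -> R) : null_strategy h -> null_strategy k ->
  gmeas G s -> null_strategy (fun i x => h i x + s x * k i x).
Proof.
move=> [mh h0] [mk k0] ms; split.
  by move=> i; apply: measurable_funD => //; exact: measurable_funM.
apply: filterS2 h0 k0 => x hx kx.
transitivity (\sum_i h i x * X i x + s x * \sum_i k i x * X i x).
  by rewrite mulr_sumr -big_split/=; apply: eq_bigr => i _; ring.
by rewrite hx kx mulr0 addr0.
Qed.

Lemma null_strategy0 : null_strategy (fun _ _ => 0).
Proof. by split=> //; apply: nearW => x; apply: big1 => i _; rewrite mul0r. Qed.

(* Row k of the projection minimises E|e_k - eta|^2 over null strategies eta; the
   variation eta + s zeta with s = <e_k - eta, zeta> / |zeta|^2 chosen pointwise
   shows <e_k - eta, zeta> = 0 for every null strategy zeta. *)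
Lemma null_projection_row (k : I) : exists p, null_strategy p /\
  forall z, null_strategy z -> {ae P, forall x, z k x = \sum_i p i x * z i x}.
Proof.
pose del i : R := (i == k)%:R.
pose phi (x : Omega) (v : I -> R) := \sum_i (del i - v i) ^+ 2.
have mphi y : null_strategy y -> measurable_fun setT (fun x => phi x (y^~ x)).
  move=> [my _]; apply: measurable_sum => i; apply: measurable_funX.
  by apply: measurable_funB => //; exact: (gmeas_measurable sG GM).
have phi0 x v : 0 <= phi x v by apply: sumr_ge0 => i _; exact: sqr_ge0.
have [|||||||||p np pmin] := @argmin_exists _ _ _ P G sG GM I null_strategy phi 2.
- move=> y z [my y0] [mz z0]; split.
    by move=> i; apply: measurable_funM => //; exact: measurable_funD.
  apply: filterS2 y0 z0 => x yx zx.
  transitivity (2^-1 * (\sum_i y i x * X i x + \sum_i z i x * X i x)).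
    by rewrite -big_split mulr_sumr/=; apply: eq_bigr => i _; field.
  by rewrite yx zx addr0 mulr0.
- by move=> y [].
- move=> y z ny mz yz; exists z; last exact: nearW.
  split => //; have {}ny := ae_foralln (fun n => (ny n).2).
  apply: filterS2 ny yz => x nyx yzx.
  have h : (\sum_i y n i x * X i x) @[n --> \oo] --> \sum_i z i x * X i x.
    apply: cvg_sum => i; apply: cvgM; [exact: yzx|exact: cvg_cst].
  have h0 : (\sum_i y n i x * X i x) @[n --> \oo] --> 0.
    by under eq_fun do rewrite nyx; exact: cvg_cst.
  exact: (cvg_unique _ h h0).
- exact: mphi.
- exact: phi0.
- move=> x v w; rewrite /phi -big_split mulr_suml/=; apply: ler_sum => i _.
  by have := sqr_ge0 (v i - w i); rewrite !expr2; nra.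
- move=> x v w vw; apply: cvg_sum => i; rewrite expr2.
  by under eq_fun do rewrite expr2; apply: cvgM; apply: cvgB => //; exact: cvg_cst.
(* Here |y_j| <= |del_j| + |del_j - y_j| <= 1 + (1 + (del_j - y_j)^2), whence the constant 2. *)
- move=> y ny j; have my := mphi _ ny.
  rewrite -(Ex_cst P 2) -ExD//; apply: le_Ex => //.
  + by apply: measurableT_comp => //; apply: (gmeas_measurable sG GM); case: ny.
  + exact: measurable_funD.
  move=> x; rewrite /phi (bigD1 j)//=.
  have : 0 <= \sum_(i | i != j) (del i - y i x) ^+ 2 by apply: sumr_ge0 => i _; exact:
      sqr_ge0.
  have : `|y j x| <= `|del j| + `|del j - y j x|.
    by rewrite -[X in `|X| <= _](subKr (del j)) (le_trans (ler_normB _ _)).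
  have : `|del j| <= 1 by rewrite /del; case: (_ == _); rewrite ?normr1 ?normr0.
  rewrite -[(del j - _) ^+ 2]real_normK ?num_real//.
  by move: `|del j - _| => a; have := sqr_ge0 (a - 1); rewrite !expr2; nra.
- exists (fun _ _ => 0); first exact: null_strategy0.
  rewrite (@eq_Ex _ _ _ _ _ (fun=> \sum_i del i ^+ 2)); last first.
    by move=> x; apply: eq_bigr => i _; rewrite subr0.
  by rewrite Ex_cst ltry.
exists p; split => // z nz.
have mp := np.1; have mz := nz.1.
pose g x := \sum_i (del i - p i x) * z i x.
pose n2 x := \sum_i z i x ^+ 2.
have mg : gmeas G g.
  by apply: measurable_sum => i; apply: measurable_funM => //; exact: measurable_funB.
have mn2 : gmeas G n2 by apply: measurable_sum => i; exact: measurable_funX.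
have mn2V : gmeas G (fun x => (n2 x)^-1) by exact: measurable_funV.
(* Where z vanishes the inverse of 0 is 0, so s = 0 there and no case distinction is needed for
   measurability. *)
pose s x := g x * (n2 x)^-1.
have ms : gmeas G s by exact: measurable_funM.
have n20 x : 0 <= n2 x by apply: sumr_ge0 => i _; exact: sqr_ge0.
have n2_eq0 x : n2 x = 0 -> forall i, z i x = 0.
  move=> /eqP; rewrite psumr_eq0 => [/allP h i|i _]; last exact: sqr_ge0.
  have := h i (mem_index_enum i); rewrite sqrf_eq0 => /eqP//.
pose q x := g x ^+ 2 * (n2 x)^-1.
have mq : gmeas G q by apply: measurable_funM => //; exact: measurable_funX.
have q0 x : 0 <= q x by rewrite mulr_ge0 ?sqr_ge0 ?invr_ge0.
have nps := null_strategyD np nz ms.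
(* Completing the square: the optimal step lowers the squared distance by exactly q >= 0, so
   minimality of p forces E[q] = 0. *)
have id x : phi x (p^~ x) = phi x (fun i => p i x + s x * z i x) + q x.
  transitivity (phi x (p^~ x) - 2 * s x * g x + s x ^+ 2 * n2 x + q x); last first.
    congr (_ + _); rewrite /phi /g /n2 !mulr_sumr -sumrB -big_split/=.
    by apply: eq_bigr => i _; ring.
  rewrite /s /q; have [n0|n0] := eqVneq (n2 x) 0.
    have -> : g x = 0 by apply: big1 => i _; rewrite (n2_eq0 x n0) mulr0.
    by rewrite !(mul0r, mulr0, expr0n) subr0 !addr0.
  by field.
have q_eq0 : Ex P q = 0%E.
  have mps := mphi _ nps.
  have fin : Ex P (fun x => phi x (fun i => p i x + s x * z i x)) \is a fin_num.
    rewrite ge0_fin_numE ?Ex_ge0//.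
    apply: (@le_lt_trans _ _ (Ex P (fun x => phi x (p^~ x)))).
      apply: le_Ex => //; first exact: mphi.
      by move=> x; rewrite id lerDl.
    apply: (le_lt_trans (pmin _ null_strategy0)).
    rewrite (@eq_Ex _ _ _ _ _ (fun=> \sum_i del i ^+ 2)); last first.
      by move=> x; apply: eq_bigr => i _; rewrite subr0.
    by rewrite Ex_cst ltry.
  apply/eqP; rewrite eq_le Ex_ge0// andbT.
  have := pmin _ nps; rewrite (eq_Ex _ id) ExD//; last exact: (gmeas_measurable sG GM).
  by rewrite -[leRHS]adde0 leeD2lE.
have := Ex_eq0 (gmeas_measurable sG GM mq) q0 q_eq0; apply: filterS => x /eqP.
rewrite mulf_eq0 sqrf_eq0 invr_eq0 => h.
have gE : g x = z k x - \sum_i p i x * z i x.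
  rewrite /g (eq_bigr (fun i => del i * z i x - p i x * z i x)); last by move=> i _;
      rewrite mulrBl.
  rewrite sumrB (bigD1 k)//= /del eqxx mul1r big1 ?addr0// => i /negPf ->.
  by rewrite mul0r.
have g0 : g x = 0.
  by case/orP: h => /eqP // n0; apply: big1 => i _; rewrite (n2_eq0 x n0) mulr0.
by apply/eqP; rewrite -subr_eq0 -gE g0.
Qed.

(** Applying row k to the null strategy p_j gives p_jk = <p_k, p_j>, so the matrix is symmetric
    almost surely. By symmetry <p h, X> = sum_i h_i <p_i, X>, which vanishes because each row is
    null. *)
Lemma null_projection : exists p : I -> I -> Omega -> R,
  [/\ forall k i, gmeas G (p k i),
      forall h : I -> Omega -> R, (forall i, gmeas G (h i)) ->
        null_strategy (fun k x => \sum_i p k i x * h i x) &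
      forall z, null_strategy z ->
        {ae P, forall x, forall k, z k x = \sum_i p k i x * z i x}].
Proof.
have /choice[p hp] := null_projection_row.
have np k := (hp k).1.
have sym : {ae P, forall x, forall k j, p k j x = p j k x}.
  apply: ae_forall_fin => k; apply: ae_forall_fin => j.
  apply: filterS2 ((hp k).2 _ (np j)) ((hp j).2 _ (np k)) => x -> ->.
  by apply: eq_bigr => i _; rewrite mulrC.
exists p; split.
- by move=> k i; exact: (np k).1.
- move=> h mh; split.
    by move=> k; apply: measurable_sum => i; apply: measurable_funM => //; exact: (np k).1.
  have := ae_forall_fin (fun k => (np k).2).
  apply: filterS2 sym => x sx nx.
  transitivity (\sum_i h i x * \sum_k p i k x * X k x).
    rewrite (eq_bigr (fun k => \sum_i p k i x * h i x * X k x)); last by move=> k _;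
        rewrite mulr_suml.
    rewrite exchange_big/=; apply: eq_bigr => i _; rewrite mulr_sumr; apply: eq_bigr => k _.
    by rewrite (sx k i); ring.
  by apply: big1 => i _; rewrite nx mulr0.
- by move=> z nz; apply: ae_forall_fin => k; exact: (hp k).2.
Qed.

End projection.

(** * One-period consequence of absence of arbitrage *)

Section negp.
Context {R : realType}.
Implicit Types r s : R.

(** The negative part, written with the norm so that its convexity is the triangle inequality. *)
Definition negp r : R := (`|r| - r) / 2.

Lemma negp_ge0 r : 0 <= negp r.
Proof. by rewrite divr_ge0// subr_ge0 ler_norm. Qed.

Lemma negp_leN r : r <= 0 -> negp r = - r.
Proof. by move=> r0; rewrite /negp ler0_norm//; field. Qed.

Lemma negp_ge r : - r <= negp r.
Proof. by rewrite /negp; have := lerNnormlW (lexx `|r|); lra. Qed.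

Lemma negp_eq0 r : 0 <= r -> negp r = 0.
Proof. by move=> r0; rewrite /negp ger0_norm// subrr mul0r. Qed.

Lemma negp_eq0_ge0 r : negp r = 0 -> 0 <= r.
Proof. by move=> h; have := negp_ge r; rewrite h oppr_le0. Qed.

Lemma le_negp r s : r <= s -> negp s <= negp r.
Proof.
move=> rs; rewrite /negp.
by case: (ger0P r) => ?; case: (ger0P s) => ?; lra.
Qed.

Lemma negpM r s : 0 <= r -> negp (r * s) = r * negp s.
Proof. by move=> r0; rewrite /negp normrM ger0_norm//; ring. Qed.

Lemma negp_mid r s : negp ((r + s) / 2) <= (negp r + negp s) / 2.
Proof.
rewrite /negp normrM (ger0_norm (_ : 0 <= 2^-1 :> R)) ?invr_ge0//.
by have := ler_normD r s; lra.
Qed.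

Lemma negpB r s : 0 <= s -> negp (r - s) <= negp r + s.
Proof.
by move=> s0; rewrite /negp; have := ler_normB r s; rewrite (ger0_norm s0); lra.
Qed.

Lemma negp_le_norm r : negp r <= `|r|.
Proof. by rewrite /negp; have := lerNnormlW (lexx `|r|); lra. Qed.

Lemma cvg_negp (u : nat -> R) l : u n @[n --> \oo] --> l -> negp (u n) @[n --> \oo] -->
    negp l.
Proof.
move=> ul; apply: cvgM; last exact: cvg_cst.
by apply: cvgB => //; exact: cvg_norm.
Qed.

Lemma measurable_negp d (T : measurableType d) (f : T -> R) :
  measurable_fun setT f -> measurable_fun setT (fun x => negp (f x)).
Proof.
move=> mf; apply: measurable_funM => //; apply: measurable_funB => //.
exact: measurableT_comp.
Qed.

End negp.

Section one_step.
Context {R : realType} {dO : measure_display} {Omega : measurableType dO}.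
Variable P : probability Omega R.
Variable G : set (set Omega).
Hypothesis sG : sigma_algebra setT G.
Hypothesis GM : G `<=` measurable.
Variables (I : finType) (X : I -> Omega -> R).
Hypothesis mX : forall i, measurable_fun setT (X i).
Variable p : I -> I -> Omega -> R.
Hypothesis mp : forall k i, gmeas G (p k i).
Hypothesis p_id : forall z, null_strategy P G X z ->
  {ae P, forall x, forall k, z k x = \sum_i p k i x * z i x}.
Hypothesis na : forall h : I -> Omega -> R, (forall i, gmeas G (h i)) ->
  {ae P, forall x, 0 <= \sum_i h i x * X i x} ->
  {ae P, forall x, \sum_i h i x * X i x = 0}.
Variable ga : Omega -> R.
Hypothesis mga : measurable_fun setT ga.
Hypothesis ga01 : forall x, 0 < ga x <= 1.

Let gW := gmeas_measurable sG GM.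
Let J : finType := option I.
Let dot x (v : J -> R) := v None + \sum_i v (Some i) * X i x.
(** A penalty on the null component: it lets the minimisation run over all positions, and it
    vanishes on reduced ones. *)
Let pen x (v : J -> R) := \sum_k `|\sum_i p k i x * v (Some i)|.
(** Dividing by this size makes [phi] at most 1 on the unit cube, hence integrable there, and only
    lowers the weight [ga]. *)
Let sz x := 1 + \sum_i `|X i x| + \sum_k \sum_i `|p k i x|.
Let rho x := ga x / sz x.
Let phi x v := rho x * (negp (dot x v) + pen x v).

Let sz_ge1 x : 1 <= sz x.
Proof.
rewrite /sz -addrA lerDl addr_ge0// ?sumr_ge0// => k _.
by rewrite sumr_ge0.
Qed.

Let rho_gt0 x : 0 < rho x.
Proof.
have /andP[g0 _] := ga01 x; apply: divr_gt0 => //.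
exact: lt_le_trans ltr01 (sz_ge1 x).
Qed.

Let rho_le x : rho x <= ga x.
Proof.
have /andP[g0 _] := ga01 x.
by rewrite ler_pdivrMr ?(lt_le_trans ltr01 (sz_ge1 x))// ler_peMr ?sz_ge1// ltW.
Qed.

Let pen_ge0 x v : 0 <= pen x v.
Proof. by apply: sumr_ge0. Qed.

Let phi_ge0 x v : 0 <= phi x v.
Proof. by rewrite mulr_ge0 ?(ltW (rho_gt0 x))// addr_ge0// ?negp_ge0. Qed.

Let phi_le1 x v : (forall j, `|v j| <= 1) -> phi x v <= 1.
Proof.
move=> v1; have /andP[g0 g1] := ga01 x.
have s0 := lt_le_trans ltr01 (sz_ge1 x).
rewrite /phi /rho mulrAC ler_pdivrMr// mul1r.
apply: (@le_trans _ _ (negp (dot x v) + pen x v)).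
  by rewrite ler_piMl// addr_ge0// negp_ge0.
rewrite /sz lerD//.
  apply: (le_trans (negp_le_norm _)); apply: (le_trans (ler_normD _ _)).
  rewrite lerD//; apply: (le_trans (ler_norm_sum _ _ _)); apply: ler_sum => i _.
  by rewrite normrM ler_piMl.
apply: ler_sum => k _; apply: (le_trans (ler_norm_sum _ _ _)); apply: ler_sum => i _.
by rewrite normrM ler_piMr.
Qed.

Let measurable_phi (y : J -> Omega -> R) : (forall j, measurable_fun setT (y j)) ->
  measurable_fun setT (fun x => phi x (y^~ x)).
Proof.
move=> my; have mpk k i : measurable_fun setT (p k i) by exact: gW.
apply: measurable_funM.
  apply: measurable_funM => //; apply: measurable_funV.
  apply: measurable_funD; first apply: measurable_funD => //.
    by apply: measurable_sum => i; exact: measurableT_comp.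
  by apply: measurable_sum => k; apply: measurable_sum => i; exact: measurableT_comp.
apply: measurable_funD.
  apply: measurable_negp; apply: measurable_funD => //.
  by apply: measurable_sum => i; exact: measurable_funM.
apply: measurable_sum => k; apply: measurableT_comp => //.
by apply: measurable_sum => i; exact: measurable_funM.
Qed.

Let phi_mid x v w : phi x (fun j => (v j + w j) / 2) <= (phi x v + phi x w) / 2.
Proof.
rewrite /phi -mulrDr -mulrA ler_pM2l//.
have -> : dot x (fun j => (v j + w j) / 2) = (dot x v + dot x w) / 2.
  rewrite /dot [in RHS]addrACA -big_split/= [in RHS]mulrDl [in RHS]mulr_suml; congr (_ + _).
  by apply: eq_bigr => i _; field.
have h1 := negp_mid (dot x v) (dot x w).
have h2 : pen x (fun j => (v j + w j) / 2) <= (pen x v + pen x w) / 2.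
  rewrite /pen -big_split mulr_suml/=; apply: ler_sum => k _.
  have -> : \sum_i p k i x * ((v (Some i) + w (Some i)) / 2) =
     (\sum_i p k i x * v (Some i) + \sum_i p k i x * w (Some i)) / 2.
    by rewrite -big_split mulr_suml/=; apply: eq_bigr => i _; field.
  rewrite normrM (ger0_norm (_ : 0 <= 2^-1 :> R)) ?invr_ge0// ler_pM2r ?invr_gt0//.
  exact: ler_normD.
lra.
Qed.

Let phi_cvg x (v : nat -> J -> R) w : (forall j, v n j @[n --> \oo] --> w j) ->
  phi x (v n) @[n --> \oo] --> phi x w.
Proof.
move=> vw; apply: cvgM; first exact: cvg_cst.
apply: cvgD.
  apply: cvg_negp; apply: cvgD => //; apply: cvg_sum => i.
  by apply: cvgM => //; exact: cvg_cst.
apply: cvg_sum => k; apply: cvg_norm; apply: cvg_sum => i.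
by apply: cvgM => //; exact: cvg_cst.
Qed.

Let phiZ x c v : 0 <= c -> phi x (fun j => c * v j) = c * phi x v.
Proof.
move=> c0; rewrite /phi mulrCA; congr (_ * _).
have -> : dot x (fun j => c * v j) = c * dot x v.
  by rewrite /dot mulrDr mulr_sumr; congr (_ + _); apply: eq_bigr => i _; rewrite mulrA.
rewrite negpM// mulrDr; congr (_ + _); rewrite /pen mulr_sumr; apply: eq_bigr => k _.
rewrite -[X in X * _](ger0_norm c0) -normrM mulr_sumr; congr `| _ |.
by apply: eq_bigr => i _; ring.
Qed.

(** On the cube the wealth coordinate ranges over [-1, 0] and the positions over [-1, 1]. *)
Let ub (j : J) : R := if j is None then 0 else 1.

(* The index None carries the wealth w and Some i the position h_i.  The unit
   sphere of the cone w <= 0 is not convex, but the faces of the unit cube are, so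
   the expectation of phi attains its minimum on each of them. *)
Let face (j : J) (s : R) : set (J -> Omega -> R) := [set y : J -> Omega -> R |
  [/\ forall i, gmeas G (y i), forall i x, -1 <= y i x <= ub i & forall x, y j x = s]].

Let face_norm j s y : face j s y -> forall i x, `|y i x| <= 1.
Proof.
move=> [_ h _] i x; have /andP[h1 h2] := h i x; rewrite ler_norml h1/=.
by apply: (le_trans h2); rewrite /ub; case: i {h h1 h2}.
Qed.

Let face_meas j s y : face j s y -> forall i, measurable_fun setT (y i).
Proof. by move=> [h _ _] i; exact: gW. Qed.

Let face_argmin (j : J) (s : R) : -1 <= s <= ub j ->
  exists2 z, face j s z & forall y, face j s y ->
    (Ex P (fun x => phi x (z^~ x)) <= Ex P (fun x => phi x (y^~ x)))%E.
Proof.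
move=> s1; apply: (@argmin_exists _ _ _ P G sG GM J (face j s) phi 1).
- move=> y z [my y1 yj] [mz z1 zj]; split.
  + by move=> i; apply: measurable_funM => //; exact: measurable_funD.
  + by move=> i x; have := y1 i x; have := z1 i x; lra.
  + by move=> x; rewrite yj zj; field.
- by move=> y [].
- move=> y z fy mz yz.
  (* The limit is clamped into the face, whose constraints hold at every point; where the sequence
     converges the clamping changes nothing. *)
  exists (fun i x => if i == j then s else Num.max (-1) (Num.min (ub i) (z i x))).
    split.
    + move=> i; case: eqP => // _; apply: measurable_maxr => //.
      exact: measurable_minr.
    + move=> i x; case: eqP => [->//|_].
      rewrite le_max lexx/= ge_max ge_min lexx andbT.
      by rewrite /ub; case: i => [?|]; lra.
    + by move=> x; rewrite eqxx.
  apply: filterS yz => x yzx i; case: eqP => [->|_].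
    have h1 := yzx j; have h2 : y n j x @[n --> \oo] --> s.
      rewrite (_ : (fun n => y n j x) = cst s); first exact: cvg_cst.
      by apply/funext => n; have [_ _] := fy n.
    exact: (cvg_unique _ h2 h1).
  have lo : -1 <= z i x.
    apply: (cvgr_to_ge (yzx i)); apply: nearW => n.
    by have [_ /(_ i x)/andP[]] := fy n.
  have hi : z i x <= ub i.
    apply: (cvgr_to_le (yzx i)); apply: nearW => n.
    by have [_ /(_ i x)/andP[]] := fy n.
  by rewrite min_r// max_r.
- by move=> y fy; apply: measurable_phi; exact: face_meas fy.
- exact: phi_ge0.
- exact: phi_mid.
- exact: phi_cvg.
- move=> y fy i; apply: (@le_trans _ _ (Ex P (fun=> 1))).
    apply: le_Ex => //; last by move=> x; exact: face_norm fy i x.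
    by apply: measurableT_comp => //; exact: face_meas fy i.
  by rewrite Ex_cst leeDl// Ex_ge0.
- have fy0 : face j s (fun i _ => if i == j then s else 0).
    split => // [i x|x]; last by rewrite eqxx.
    by case: eqP => [->//|_]; rewrite /ub; case: i => [?|]; lra.
  exists (fun i _ => if i == j then s else 0) => //.
  apply: (@le_lt_trans _ _ (Ex P (fun=> 1))); last by rewrite Ex_cst ltry.
  apply: le_Ex => //; first by apply: measurable_phi; exact: face_meas fy0.
  by move=> x; apply: phi_le1 => i; exact: face_norm fy0 i x.
Qed.


Let face_paste j s y z (b : Omega -> bool) : gmeas G b -> face j s y -> face j s z ->
  face j s (fun i x => if b x then y i x else z i x).
Proof.
move=> mb [my y1 yj] [mz z1 zj]; split.
- by move=> i; exact: measurable_fun_ifT.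
- by move=> i x; case: ifP.
- by move=> x; case: ifP.
Qed.

(** A minimiser z of the expectation over the face also minimises on every [G]-event, by pasting, so
    [al] = E[phi(z) | G] bounds all conditional values from below. It is positive almost surely:
    where it vanishes, z would have nonnegative gains from nonpositive wealth and no null component,
    so by no arbitrage z = 0, against the coordinate s. *)
Let face_bound (j : J) (s : R) : -1 <= s <= ub j -> s != 0 ->
  exists al : Omega -> R, [/\ gmeas G al, forall x, 0 < al x <= 1 &
    forall (y : J -> Omega -> R) (m : Omega -> R), face j s y -> gmeas G m -> (forall
        x, 0 <= m x) ->
      (Ex P (fun x => m x * al x)%R <= Ex P (fun x => m x * phi x (y^~ x))%R)%E].
Proof.
move=> s1 s0; have [z fz zmin] := face_argmin s1.
pose xi x := phi x (z^~ x).
have mxi : measurable_fun setT xi by apply: measurable_phi; exact: face_meas fz.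
have xi0 x : 0 <= xi x by exact: phi_ge0.
have xi01 x : 0 <= xi x <= 1.
  by rewrite xi0/=; apply: phi_le1 => i; exact: face_norm fz i x.
have mif (b : Omega -> bool) (h : Omega -> R) : gmeas G b -> measurable_fun setT h ->
    measurable_fun setT (fun x => if b x then h x else 0).
  by move=> mb mh; apply: measurable_fun_ifT => //; exact: gW.
have loc y (b : Omega -> bool) : face j s y -> gmeas G b ->
    (Ex P (fun x => if b x then xi x else 0%R) <=
     Ex P (fun x => if b x then phi x (y^~ x) else 0%R))%E.
  move=> fy mb.
  have my : measurable_fun setT (fun x => phi x (y^~ x)).
    by apply: measurable_phi; exact: face_meas fy.
  have mNb : gmeas G (fun x => ~~ b x) by exact: measurable_neg.
  have fin : Ex P (fun x => if ~~ b x then xi x else 0) \is a fin_num.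
    apply: (@Ex_fin_num _ _ _ _ _ 1); first exact: mif.
    by move=> x; case: ifP => _; rewrite ?xi01// lexx ler01.
  rewrite -(leeD2rE _ _ fin) -!ExD//; first last.
  - by move=> x; case: ifP.
  - by move=> x; case: ifP.
  - exact: mif.
  - exact: mif.
  - by move=> x; case: ifP.
  - by move=> x; case: ifP.
  - exact: mif.
  - exact: mif.
  have := zmin _ (face_paste mb fy fz).
  rewrite -/xi.
  rewrite (@eq_Ex _ _ _ _ xi (fun x =>
    (if b x then xi x else 0) + (if ~~ b x then xi x else 0))); last first.
    by move=> x; case: ifP; rewrite ?addr0 ?add0r.
  move/le_trans; apply; rewrite le_eqVlt; apply/orP; left; apply/eqP; apply: eq_Ex => x.
  by case: (b x) => /=; rewrite ?addr0 ?add0r.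
have [al [mal al01 alE]] := cond_exp_exists P sG GM mxi xi01.
have al0 x : 0 <= al x by case/andP: (al01 x).
have mal' : measurable_fun setT al by exact: gW.
pose b x := al x <= 0.
have mb : gmeas G b by exact: measurable_fun_ler.
have [mz z1 zj] := fz.
(* The positions of z are cut off outside the event where [al] vanishes, which keeps them
   [G]-measurable and gives the arbitrage candidate. *)
pose h i x := if b x then z (Some i) x else 0.
have mh i : gmeas G (h i) by exact: measurable_fun_ifT.
have zb : {ae P, forall x, b x -> negp (dot x (z^~ x)) = 0 /\
    forall k, \sum_i p k i x * z (Some i) x = 0}.
  have : Ex P (fun x => if b x then xi x else 0) = 0%E.
    rewrite -alE// (@eq_Ex _ _ _ _ _ (fun=> 0)) ?Ex_cst// => x.
    by rewrite /b; case: ifPn => // h0; apply/eqP; rewrite eq_le h0 al0.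
  move/Ex_eq0 => /(_ (mif _ _ mb mxi)) h0.
  apply: filterS (h0 _) => [x|x]; last by case: ifP.
  move=> + bx; rewrite bx /xi /phi => /eqP; rewrite mulf_eq0 (gt_eqF (rho_gt0 x))/=.
  rewrite paddr_eq0 ?negp_ge0// => /andP[/eqP -> h1]; split => // k.
  move: h1; rewrite /pen psumr_eq0// => /allP /(_ k (mem_index_enum k)).
  by rewrite normr_eq0 => /eqP.
have hpos : {ae P, forall x, 0 <= \sum_i h i x * X i x}.
  apply: filterS zb => x; rewrite /h; case: (b x); last first.
    by move=> _; apply: sumr_ge0 => i _; rewrite mul0r.
  move=> /(_ isT) [/negp_eq0_ge0 + _]; rewrite /dot => d0.
  by have /andP[_] := z1 None x; rewrite /ub; lra.
have h0 := na mh hpos.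
have hn := p_id (conj mh h0).
have bF : {ae P, forall x, ~~ b x}.
  (* The gain of h is zero, so h equals its own projection; the vanishing penalty says this
     projection is 0. Then the wealth is both nonnegative and nonpositive. *)
  apply: filterS3 zb h0 hn => x zx h0x hnx; apply/negP => bx.
  have [/negp_eq0_ge0 d0 pz] := zx bx.
  have zS i : z (Some i) x = 0.
    have := hnx i; rewrite /h bx => ->.
    by rewrite -[RHS](pz i).
  have zN : z None x = 0.
    apply/eqP; rewrite eq_le; have /andP[_ ->] := z1 None x.
    move: d0; rewrite /dot big1 ?addr0// => i _.
    by rewrite zS mul0r.
  by move: s0; rewrite -(zj x); case: (j) => [i|]; rewrite ?zS ?zN eqxx.
exists (fun x => if b x then 1 else al x); split.
- exact: measurable_fun_ifT.
- move=> x; rewrite /b; case: ifPn; rewrite ?ltr01 ?lexx// -ltNge => ->.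
  by case/andP: (al01 x).
move=> y m fy mm m0.
have mm' : measurable_fun setT m by exact: gW.
have my : measurable_fun setT (fun x => phi x (y^~ x)).
  by apply: measurable_phi; exact: face_meas fy.
apply: (@le_trans _ _ (Ex P (fun x => m x * al x)%R)).
  apply: ae_le_Ex.
  - by apply: measurable_funM => //; apply: measurable_fun_ifT => //; exact: gW.
  - exact: measurable_funM.
  - by move=> x; apply: mulr_ge0 => //; case: ifP.
  - by move=> x; exact: mulr_ge0.
  - by apply: filterS bF => x /negPf ->.
apply: (Ex_multiplier sG GM) => // c mc.
by rewrite alE//; exact: loc.
Qed.


(** The faces that meet the cone: position i equal to 1 or -1, or wealth equal to -1. *)
Let F : finType := option (I * bool).
Let fj (f : F) : J := if f is Some (i, _) then Some i else None.
Let fs (f : F) : R := if f is Some (_, true) then 1 else -1.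

Let fs_bound f : -1 <= fs f <= ub (fj f).
Proof. by case: f => [[i []]|]; rewrite /fs /ub/=; lra. Qed.

Let fs_neq0 f : fs f != 0.
Proof. by case: f => [[i []]|]; rewrite /fs ?oppr_eq0 oner_eq0. Qed.

Let fs_mul f : fs f * fs f = 1.
Proof. by case: f => [[i []]|]; rewrite /fs ?mulrNN mulr1. Qed.

(** Divided by its maximum norm, a nonzero vector of the cone lies on a face, and [phi] is
    positively homogeneous; the bounds on the faces are then averaged. *)
Let conic_bound : exists al : Omega -> R, [/\ gmeas G al, forall x, 0 < al x <= 1 &
  forall y : J -> Omega -> R, (forall j, gmeas G (y j)) -> (forall x, y None x <= 0) ->
    (Ex P (fun x => al x * \sum_j `|y j x|)%R <= Ex P (fun x => phi x (y^~ x)))%E].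
Proof.
have /choice[a aP] f := face_bound (fs_bound f) (fs_neq0 f).
(* [#|J|] compares the sum of the absolute values with their maximum, [#|F|] comes from averaging
   over the faces. *)
pose c : R := #|J|%:R * #|F|%:R.
have cJ : 0 < #|J|%:R :> R by rewrite ltr0n; apply/card_gt0P; exists None.
have cF : 0 < #|F|%:R :> R by rewrite ltr0n; apply/card_gt0P; exists None.
have c0 : 0 < c by exact: mulr_gt0.
have c1 : c^-1 <= 1 by rewrite invf_le1// /c -natrM ler1n -(ltr0n R) natrM.
pose pr x := \prod_f a f x.
have a0 f x : 0 < a f x by have [_ /(_ x)/andP[]] := aP f.
have a1 f x : a f x <= 1 by have [_ /(_ x)/andP[]] := aP f.
have pr0 x : 0 < pr x by apply: prodr_gt0 => f _.
have pr_le x f : pr x <= a f x.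
  rewrite /pr (bigD1 f)//= ler_piMr ?(ltW (a0 f x))//.
  apply: (@le_trans _ _ (\prod_(g | g != f) 1)); last by rewrite big1.
  by apply: ler_prod => g _; rewrite (ltW (a0 g x)) a1.
pose al x := c^-1 * pr x.
have mal : gmeas G al.
  apply: measurable_funM => //; apply: measurable_prod => f _.
  by have [] := aP f.
have mal' : measurable_fun setT al by exact: gW.
exists al; split => //.
  move=> x; rewrite mulr_gt0 ?invr_gt0//=.
  by rewrite mulr_ile1 ?invr_ge0 ?(ltW c0) ?(ltW (pr0 x))// (le_trans (pr_le x None)).
move=> y my yN.
have my' j : measurable_fun setT (y j) by exact: gW.
have mphiy : measurable_fun setT (fun x => phi x (y^~ x)) by exact: measurable_phi.
pose t f x := fs f * y (fj f) x.
have mt f : gmeas G (t f) by exact: measurable_funM.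
(* The event that the normalised vector lies on face f: [t f x] is positive and dominates all |y_j|.
   Summing excesses states the domination as one measurable inequality. *)
pose b f x := (0 < t f x) && (\sum_j Num.max (`|y j x| - t f x) 0 <= 0).
have mb f : gmeas G (b f).
  apply: measurable_and; first exact: measurable_fun_ltr.
  apply: measurable_fun_ler => //; apply: measurable_sum => j; apply: measurable_maxr => //.
  by apply: measurable_funB => //; exact: measurableT_comp.
have bP f x : b f x -> 0 < t f x /\ forall j, `|y j x| <= t f x.
  move=> /andP[t0 h]; split => // j; rewrite -subr_le0.
  apply: le_trans h; rewrite (bigD1 j)//=.
  apply: (@le_trans _ _ (Num.max (`|y j x| - t f x) 0)); first by rewrite le_max lexx.
  by rewrite lerDl; apply: sumr_ge0 => i _; rewrite le_max lexx orbT.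
have bE f x : 0 < t f x -> (forall j, `|y j x| <= t f x) -> b f x.
  move=> t0 h; rewrite /b t0/=; apply: sumr_le0 => j _.
  by rewrite ge_max lexx andbT subr_le0.
pose m f x := if b f x then t f x else 0.
have mm f : gmeas G (m f) by exact: measurable_fun_ifT.
have m0 f x : 0 <= m f x.
  by rewrite /m; case: ifPn => // /bP[/ltW].
(* Off the event an arbitrary constant point of the face is used; the multiplier [m f] is 0
   there. *)
pose yf f j x := if b f x then (t f x)^-1 * y j x else (if j == fj f then fs f else 0).
have fyf f : face (fj f) (fs f) (yf f).
  split.
  - move=> j; apply: measurable_fun_ifT => //.
    by apply: measurable_funM => //; exact: measurable_funV.
  - move=> j x; rewrite /yf; case: ifPn => [/bP[t0 h]|_]; last first.
      by case: eqP => [->|_]; [exact: fs_bound|rewrite /ub; case: j => [?|]; lra].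
    have := h j; rewrite ler_norml => /andP[h1 h2].
    rewrite mulrC ler_pdivlMr// mulN1r h1/= ler_pdivrMr// /ub.
    by case: j {h1} h2 => [i|] h2; rewrite ?mul1r// mul0r.
  - move=> x; rewrite /yf eqxx; case: ifPn => // /bP[t0 _].
    have y0 : y (fj f) x != 0 by apply: contraTneq t0; rewrite /t => ->; rewrite mulr0 ltxx.
    rewrite /t invfM -mulrA mulVf// mulr1.
    by apply: (mulfI (fs_neq0 f)); rewrite divff// fs_mul.
have key f : (Ex P (fun x => m f x * a f x)%R <= Ex P (fun x => phi x (y^~ x)))%E.
  have [_ _ /(_ _ _ (fyf f) (mm f) (m0 f))] := aP f; move/le_trans; apply.
  apply: le_Ex => //.
  - apply: measurable_funM; first exact: gW.
    by apply: measurable_phi; exact: face_meas (fyf f).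
  - by move=> x; exact: mulr_ge0.
  - move=> x; rewrite /m; case: ifPn => [bx|_]; last by rewrite mul0r.
    have [t0 _] := bP _ _ bx.
    rewrite -phiZ ?(ltW t0)// le_eqVlt; apply/orP; left; apply/eqP; congr (phi x _).
    by apply/funext => j; rewrite /yf bx mulrA divff ?mul1r// gt_eqF.
apply: (@le_trans _ _ (Ex P (fun x => #|F|%:R^-1 * \sum_f m f x * a f x)%R)).
  have msum : measurable_fun setT (fun x => \sum_f m f x * a f x).
    by apply: measurable_sum => f; apply: measurable_funM; apply: gW => //; have [] := aP f.
  apply: le_Ex => //.
  - by apply: measurable_funM => //; apply: measurable_sum => j; exact: measurableT_comp.
  - exact: measurable_funM.
  - move=> x; apply: mulr_ge0; last exact: sumr_ge0.
    by rewrite mulr_ge0// ?invr_ge0 ltW.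
  move=> x; rewrite /al /c invfM -!mulrA mulrCA ler_pM2l ?invr_gt0//.
  have [f [fb|all0]] : exists f, b f x \/ forall j, y j x = 0.
    have [jm _ jmax] := @arg_maxP _ _ J None predT (fun j => `|y j x|) isT.
    have [j0|j0] := eqVneq (y jm x) 0.
      exists None; right => j; apply/eqP; rewrite -normr_le0.
      by apply: (le_trans (jmax j isT)); rewrite j0 normr0.
    suff [f ft] : exists f, t f x = `|y jm x|.
      exists f; left; apply: bE; rewrite ft ?normr_gt0// => j; exact: jmax.
    case: jm {jmax} j0 => [i|] j0.
      exists (Some (i, 0 <= y (Some i) x)); rewrite /t /fs/=.
      by case: ger0P; rewrite ?mul1r ?mulN1r.
    by exists None; rewrite /t /fs/= mulN1r ler0_norm.
  - have [t0 h] := bP _ _ fb.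
    apply: (@le_trans _ _ (pr x * t f x)).
      rewrite mulrCA ler_pM2l// mulrC ler_pdivrMr//.
      apply: (le_trans (ler_sum _ (fun j _ => h j))).
      by rewrite sumr_const mulr_natr.
    rewrite (bigD1 f)//= /m fb -[leLHS]addr0 mulrC lerD ?ler_pM2l//.
    by apply: sumr_ge0 => g _; apply: mulr_ge0; [exact: (m0 g x)|exact: ltW].
  - rewrite (eq_bigr (fun=> 0)); last by move=> j _; rewrite all0 normr0.
    rewrite big1// !mulr0; apply: sumr_ge0 => g _; by rewrite mulr_ge0// ltW.
have ma f : measurable_fun setT (a f) by apply: gW; have [] := aP f.
have mma f : measurable_fun setT (fun x => m f x * a f x).
  by apply: measurable_funM => //; exact: gW.
have ma0 f x : 0 <= m f x * a f x by rewrite mulr_ge0// ltW.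
rewrite ExZ ?invr_ge0 ?ler0n//; [|exact: measurable_sum|by move=> x; exact: sumr_ge0].
rewrite Ex_sum// lee_pdivrMl//.
apply: (le_trans (lee_sum _ (fun f _ => key f))).
by rewrite sumr_const mule_natl.
Qed.

(** The conic bound is applied to min(w, 0) in place of w; discarding the positive wealth raises the
    negative part by at most max(w, 0), which is the last term. *)
Lemma one_step_bound : exists al : Omega -> R, [/\ gmeas G al, forall x, 0 < al x <= 1 &
  forall (w : Omega -> R) (h : I -> Omega -> R), gmeas G w -> (forall i, gmeas G (h i)) ->
    {ae P, forall x, forall k, \sum_i p k i x * h i x = 0} ->
    (Ex P (fun x => al x * (negp (w x) + \sum_i `|h i x|))%R <=
     Ex P (fun x => ga x * negp (w x + \sum_i h i x * X i x))%R +
     Ex P (fun x => Num.max (w x) 0%R))%E].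
Proof.
have [al [mal al01 alP]] := conic_bound; exists al; split => // w h mw mh ph.
have mal' : measurable_fun setT al by exact: gW.
have mw' : measurable_fun setT w by exact: gW.
have mh' i : measurable_fun setT (h i) by exact: gW.
have ga0 x : 0 <= ga x by case/andP: (ga01 x) => /ltW.
pose y (j : J) x := if j is Some i then h i x else Num.min (w x) 0.
have my j : gmeas G (y j) by case: j => [i|]; [exact: mh|exact: measurable_minr].
have my' j : measurable_fun setT (y j) by exact: gW.
have yN x : y None x <= 0 by rewrite /y ge_min lexx orbT.
have mdot : measurable_fun setT (fun x => w x + \sum_i h i x * X i x).
  apply: measurable_funD => //; apply: measurable_sum => i; exact: measurable_funM.
have mdot0 : measurable_fun setT (fun x => ga x * negp (w x + \sum_i h i x * X i x)).
  by apply: measurable_funM => //; exact: measurable_negp.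
have mmax : measurable_fun setT (fun x => Num.max (w x) 0) by exact: measurable_maxr.
have := alP y my yN.
rewrite (@eq_Ex _ _ _ _ _ (fun x => al x * (negp (w x) + \sum_i `|h i x|))); last first.
  move=> x; congr (_ * _); rewrite (bigD1 None)//=; congr (_ + _).
    rewrite /y; have [w0|w0] := leP (w x) 0.
      by rewrite ler0_norm// negp_leN.
    by rewrite normr0 negp_eq0// ltW.
  rewrite [LHS](reindex_omap Some id)/=; last by case.
  by apply: eq_big => i; rewrite ?eqxx.
move/le_trans; apply; rewrite -ExD//; last first.
- by move=> x; rewrite le_max lexx orbT.
- by move=> x; rewrite mulr_ge0// negp_ge0.
apply: ae_le_Ex.
- exact: measurable_phi.
- exact: measurable_funD.
- by move=> x; exact: phi_ge0.
- by move=> x; apply: addr_ge0; [rewrite mulr_ge0 ?negp_ge0|rewrite le_max lexx orbT].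
apply: filterS ph => x phx; have /andP[_ g1] := ga01 x.
rewrite /phi (_ : pen x _ = 0) ?addr0; last by apply: big1 => k _; rewrite phx normr0.
set S := \sum_i h i x * X i x.
have -> : dot x (y^~ x) = (w x + S) - Num.max (w x) 0.
  rewrite /dot /y -/S; have := addr_max_min (w x) 0; lra.
have mx0 : 0 <= Num.max (w x) 0 by rewrite le_max lexx orbT.
apply: (@le_trans _ _ (ga x * negp (w x + S - Num.max (w x) 0))).
  by rewrite ler_wpM2r ?negp_ge0.
apply: (@le_trans _ _ (ga x * (negp (w x + S) + Num.max (w x) 0))).
  by rewrite ler_wpM2l// negpB.
by rewrite mulrDr lerD2l ler_piMl.
Qed.

End one_step.

(** * Regular conditional distributions *)

Section ternary.
Context {R : realType}.
Implicit Types b : nat -> bool.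

(** Base 3 with digits 0 and 1 leaves a tail of at most 1/2 after the leading digit, so comparison
    with 1 reads off that digit without the ambiguity of base 2. *)
Definition tpart b N : R := \sum_(0 <= k < N) (b k)%:R * 3^-1 ^+ k.

Lemma tpartS b N : tpart b N.+1 = (b 0%N)%:R + 3^-1 * tpart (fun k => b k.+1) N.
Proof.
rewrite /tpart big_nat_recl//= expr0 mulr1; congr (_ + _).
by rewrite mulr_sumr; apply: eq_bigr => k _; rewrite exprS; ring.
Qed.

Lemma tpart_bound b N : 0 <= tpart b N <= 3 / 2.
Proof.
elim: N b => [|N IH] b; first by rewrite /tpart big_nil; lra.
by rewrite tpartS; have := IH (fun k => b k.+1); case: (b 0%N) => /=; lra.
Qed.

Definition ternary b : R := limn (tpart b).

Lemma cvg_tpart b : tpart b n @[n --> \oo] --> ternary b.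
Proof.
apply: nondecreasing_is_cvgn.
  apply/nondecreasing_seqP => n; rewrite /tpart big_nat_recr//= lerDl.
  by rewrite mulr_ge0// exprn_ge0// invr_ge0.
by exists (3 / 2) => _ [n _ <-]; case/andP: (tpart_bound b n).
Qed.

Lemma ternary_bound b : 0 <= ternary b <= 3 / 2.
Proof.
apply/andP; split.
  by apply: limr_ge; [exact: cvg_tpart|]; apply: nearW => n; case/andP: (tpart_bound b n).
by apply: limr_le; [exact: cvg_tpart|]; apply: nearW => n; case/andP: (tpart_bound b n).
Qed.

Lemma ternaryS b : ternary b = (b 0%N)%:R + 3^-1 * ternary (fun k => b k.+1).
Proof.
have h1 : tpart b n.+1 @[n --> \oo] --> ternary b by rewrite (cvg_shiftS (tpart b));
    exact: cvg_tpart.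
have h2 : tpart b n.+1 @[n --> \oo] --> (b 0%N)%:R + 3^-1 * ternary (fun k => b k.+1).
  under eq_fun do rewrite tpartS.
  by apply: cvgD; [exact: cvg_cst|apply: cvgM; [exact: cvg_cst|exact: cvg_tpart]].
exact: (cvg_unique _ h1 h2).
Qed.

(** The remainder after removing n leading digits, rescaled so that the next digit is again read off
    by comparison with 1. *)
Fixpoint trem n (y : R) : R :=
  if n is m.+1 then let r := trem m y in 3 * (r - (if 1 <= r then 1 else 0)) else y.

Definition tdigit n y : bool := 1 <= trem n y.

Lemma tdigit0 b : (1 <= ternary b) = b 0%N.
Proof.
rewrite ternaryS; have := ternary_bound (fun k => b k.+1).
by case: (b 0%N) => /= h; [apply/idP; lra|apply/negP; lra].
Qed.

Lemma trem_ternary b n : trem n (ternary b) = ternary (fun k => b (n + k)%N).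
Proof.
elim: n => //= n ->; rewrite tdigit0 addn0 ternaryS addn0.
rewrite (_ : (fun k => b (n + k.+1)%N) = (fun k => b (n.+1 + k)%N)); last first.
  by apply/funext => k; rewrite addnS.
by case: (b n) => /=; field.
Qed.

Lemma tdigit_ternary b n : tdigit n (ternary b) = b n.
Proof. by rewrite /tdigit trem_ternary tdigit0 addn0. Qed.

Lemma measurable_trem n : measurable_fun setT (trem n).
Proof.
elim: n => [|n IH] /=; first exact: measurable_id.
apply: measurable_funM => //; apply: measurable_funB => //.
by apply: measurable_fun_ifT => //; exact: measurable_fun_ler.
Qed.

Lemma measurable_tdigit n : measurable_fun setT (tdigit n).
Proof. by apply: measurable_fun_ler => //; exact: measurable_trem. Qed.

End ternary.

(** * A measurable code for vectors by real numbers *)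

Section coding.
Context {R : realType} (d : nat).
Notation Rd := (d.-tuple R).

(* x is encoded by the bits x_i < q, q rational, read as ternary digits: only a
   measurable left inverse is needed to transport conditional distributions. *)
Definition ratcut (n : nat) (x : Rd) : bool :=
  if unpickle n is Some (i, q) then tnth x i < ratr q :> R
  else false.

Definition ratcut_encode (x : Rd) : R := ternary (fun n => ratcut n x).

(** The coordinate is recovered as the infimum of the rationals whose bit is set; unset bits
    contribute +oo, so they do not affect it. *)
Definition ratcut_value (i : 'I_d) (k : nat) (y : R) : \bar R :=
  if unpickle k is Some q then
    if tdigit (pickle (i, q)) y then (ratr q)%:E else +oo%E
  else +oo%E.

Definition ratcut_decode (y : R) : Rd :=
  [tuple fine (einfs (fun k => ratcut_value i k y) 0) | i < d].

Lemma ratcut_encodeK : cancel ratcut_encode ratcut_decode.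
Proof.
move=> x; apply: eq_from_tnth => i; rewrite tnth_mktuple.
set u := fun k => _.
have uE q : u (pickle q) = if tnth x i < ratr q then (ratr q)%:E else +oo%E.
  by rewrite /u /ratcut_value pickleK /ratcut_encode tdigit_ternary /ratcut pickleK.
suff -> : einfs u 0 = (tnth x i)%:E by [].
apply/eqP; rewrite eq_le; apply/andP; split.
- apply/lee_addgt0Pr => e e0.
  have : tnth x i < tnth x i + e by rewrite ltrDl.
  move=> /rat_in_itvoo[q]; rewrite in_itv/= => /andP[q1 q2].
  apply: (@le_trans _ _ (u (pickle q))); first by apply: ereal_inf_lbound; exists
      (pickle q).
  by rewrite uE q1 -EFinD lee_fin ltW.
- apply: le_ereal_inf_tmp => _ [k _ <-]; rewrite /u /ratcut_value.
  case: (unpickle k) => [q|]; last exact: leey.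
  rewrite /ratcut_encode tdigit_ternary /ratcut pickleK.
  by case: ifPn => [h|_]; [rewrite lee_fin ltW|exact: leey].
Qed.

Lemma measurable_ratcut_encode : measurable_fun setT ratcut_encode.
Proof.
apply: (@measurable_fun_cvg _ _ _ _ (fun N x => tpart (fun n => ratcut n x) N)); last first.
  by move=> x _; exact: cvg_tpart.
move=> N; apply: measurable_sum => k; apply: measurable_funM => //.
rewrite (_ : (fun x => _) = (fun x => if ratcut k x then 1 else 0)); last first.
  by apply/funext => x; case: (ratcut k x).
apply: measurable_fun_ifT => //; rewrite /ratcut; case: (unpickle k) => [[i q]|] //.
by apply: measurable_fun_ltr => //; exact: measurable_tnth.
Qed.

Lemma measurable_ratcut_decode : measurable_fun setT ratcut_decode.
Proof.
apply/measurable_fun_tnthP => i.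
rewrite (_ : _ \o _ = fun y => fine (einfs (fun k => ratcut_value i k y) 0)); last first.
  by apply/funext => y; rewrite /= tnth_mktuple.
apply: measurableT_comp => //.
apply: (@measurable_fun_einfs _ _ _ _ (ratcut_value i)) => k; rewrite /ratcut_value.
case: (unpickle k) => [q|] //; apply: measurable_fun_ifT => //.
exact: measurable_tdigit.
Qed.

End coding.

(** * Laws on the line built from countably many levels *)

Section quantile.
Context {R : realType}.
Variable phi : rat -> R.
Hypothesis phi01 : forall r, 0 <= phi r <= 1.

(* The levels phi r = P(Z < r | G) are only almost surely nondecreasing in r;
   the infimum below needs no monotonicity. *)
Definition qlevel (k : nat) (u : R) : \bar R :=
  if (unpickle k : option rat) is Some r then
    if (0 < r) && (u <= phi r) then (ratr r)%:E else 2%:E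
  else 2%:E.

(** The generalised inverse inf {r > 0 : u <= phi r}, capped at 2 because the variables encoded take
    values in [0, 2). *)
Definition quantile (u : R) : R := fine (einfs (fun k => qlevel k u) 0).

(** The supremum of [phi r] over rationals 0 < r < x; it stands for the conditional probability of
    {Z < x}. *)
Definition qsup (x : R) : \bar R := esups (fun k =>
  (if (unpickle k : option rat) is Some r then
     if (0 < r) && (ratr r < x) then phi r else 0
   else 0)%:E) 0.

Lemma quantile_fin u : (quantile u)%:E = einfs (fun k => qlevel k u) 0.
Proof.
rewrite /quantile fineK// fin_numElt; apply/andP; split.
  apply: (@lt_le_trans _ _ 0%:E); first exact: ltNyr.
  apply: le_ereal_inf_tmp => _ [k _ <-]; rewrite /qlevel.
  case: (unpickle k) => [r|]; last by rewrite lee_fin.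
  by case: ifPn => [/andP[r0 _]|_]; rewrite lee_fin ?ler0q ?(ltW r0).
apply: (@le_lt_trans _ _ 2%:E); last exact: ltry.
apply: (@le_trans _ _ (qlevel (pickle (-1 : rat)) u)).
  by apply: ereal_inf_lbound; exists (pickle (-1 : rat)).
by rewrite /qlevel pickleK.
Qed.

Lemma quantile_lt u x : quantile u < x <->
  2 < x \/ exists r, [/\ 0 < r, ratr r < x & u <= phi r].
Proof.
rewrite -lte_fin quantile_fin; split.
  move/ereal_inf_lt => [_ [k _ <-]]; rewrite /qlevel.
  case: (unpickle k) => [r|]; last by rewrite lte_fin; left.
  by case: ifPn => [/andP[r0 ur]|_]; rewrite lte_fin => ?; [right; exists r|left].
move=> [x2|[r [r0 rx ur]]].
  apply: (@le_lt_trans _ _ (qlevel (pickle (-1 : rat)) u)).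
    by apply: ereal_inf_lbound; exists (pickle (-1 : rat)).
  by rewrite /qlevel pickleK/= lte_fin.
apply: (@le_lt_trans _ _ (qlevel (pickle r) u)).
  by apply: ereal_inf_lbound; exists (pickle r).
by rewrite /qlevel pickleK r0 ur/= lte_fin.
Qed.

Lemma measurable_quantile : measurable_fun setT quantile.
Proof.
apply: measurableT_comp => //; apply: measurable_fun_einfs => k.
rewrite /qlevel; case: (unpickle k) => [r|] //; case: (0 < r) => //=.
by apply: measurable_fun_ifT => //; exact: measurable_fun_ler.
Qed.

Lemma qsup_bound x : (0 <= qsup x <= 1)%E.
Proof.
apply/andP; split.
  apply: (@le_trans _ _ 0%:E) => //.
  by apply: ereal_sup_ubound; exists (pickle (-1 : rat)) => //; rewrite pickleK.
apply: ge_ereal_sup => _ [k _ <-]; rewrite lee_fin.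
by case: (unpickle k) => [r|] //; case: ifP => // _; case/andP: (phi01 r).
Qed.

Lemma qsup_fin x : qsup x \is a fin_num.
Proof.
have /andP[h1 h2] := qsup_bound x.
by rewrite ge0_fin_numE// (le_lt_trans h2)// ltry.
Qed.

Lemma uniform_prob_sub (A : set R) : measurable A -> A `<=` `[0, 1] ->
  uniform_prob (@ltr01 R) A = lebesgue_measure A.
Proof.
move=> mA A01; rewrite /uniform_prob integral_uniform_pdf setIidl//.
rewrite (eq_integral (fun=> 1%E)); first by rewrite integral_cst// mul1e.
move=> x; rewrite inE => /A01/=; rewrite in_itv/= /uniform_pdf => ->.
by rewrite subr0 invr1.
Qed.

Lemma uniform_prob_setI01 (A : set R) :
  uniform_prob (@ltr01 R) A = uniform_prob (@ltr01 R) (A `&` `[0, 1]).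
Proof. by rewrite /uniform_prob integral_uniform_pdf. Qed.

(** With s = [qsup x], the part of the preimage in [0, 1] lies between [0, s[ and [0, s]. The bound
    on x keeps the cap at 2 out of the event. *)
Lemma quantile_law x : x <= 2 ->
  uniform_prob (@ltr01 R) (quantile @^-1` `]-oo, x[) = qsup x.
Proof.
move=> x2; set B := _ @^-1` _.
have mB : measurable B.
  by rewrite -[B]setTI; apply: measurable_quantile.
have BE u : B u <-> exists r, [/\ 0 < r, ratr r < x & u <= phi r].
  rewrite /B /= in_itv/=; split => [/quantile_lt[]//|h].
    by rewrite ltNge x2.
  by apply/quantile_lt; right.
rewrite uniform_prob_setI01//.
have mBI : measurable (B `&` `[0, 1]) by exact: measurableI.
rewrite uniform_prob_sub//.
set s := fine (qsup x).
have sE : qsup x = s%:E by rewrite fineK// qsup_fin.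
have /andP[] := qsup_bound x; rewrite sE !lee_fin => s0 s1.
apply/eqP; rewrite eq_le; apply/andP; split.
- apply: (@le_trans _ _ (lebesgue_measure (`[0, s] : set R))).
    apply: le_measure; rewrite ?inE//.
    move=> u [/BE[r [r0 rx ur]]]; rewrite /= !in_itv/= => /andP[-> _] /=.
    apply: (le_trans ur); rewrite -lee_fin -sE.
    by apply: ereal_sup_ubound; exists (pickle r) => //; rewrite pickleK r0 rx.
  rewrite lebesgue_measure_itv/= lte_fin; case: ifPn => _.
    by rewrite oppr0 adde0.
  by rewrite lee_fin.
- apply: (@le_trans _ _ (lebesgue_measure (`[0, s[ : set R))).
    rewrite lebesgue_measure_itv/= lte_fin; case: ifPn => [_|].
      by rewrite oppr0 adde0.
    by rewrite -leNgt lee_fin.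
  apply: le_measure; rewrite ?inE//.
  move=> u; rewrite /= !in_itv/= => /andP[u0 us]; split.
    apply/BE; move: us; rewrite -lte_fin -sE => /ereal_sup_gt[_ [k _ <-]].
    case: (unpickle k) => [r|]; last by rewrite lte_fin ltNge u0.
    case: ifPn => [/andP[r0 rx]|_]; rewrite lte_fin => h; last by rewrite ltNge u0 in h.
    by exists r; split => //; exact: ltW.
  by rewrite u0/= (le_trans (ltW us)).
Qed.

End quantile.

Section rcd_exists.
Context {R : realType} {dO : measure_display} {Omega : measurableType dO}.
Variable P : probability Omega R.
Variable G : set (set Omega).
Hypothesis sG : sigma_algebra setT G.
Hypothesis GM : G `<=` measurable.

Let gW := gmeas_measurable sG GM.
Let U : probability (measurableTypeR R) R := uniform_prob (@ltr01 R).

Let gmeas_in (A : set Omega) : G A -> gmeas G (fun x => x \in A).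
Proof.
move=> GA; apply: (measurable_fun_bool true); rewrite setTI.
rewrite (_ : _ @^-1` _ = A); first by rewrite (measurable_g_measurableTypeE sG).
by apply/seteqP; split => x /=; [move/set_mem|move/mem_set].
Qed.

(** [F x r] is a version of P(Z < r | G) at x, and the kernel is the law of its quantile function
    under the uniform measure. The disintegration is checked on half-lines and extended by Dynkin's
    theorem. *)
Lemma real_rcd_exists (Z : Omega -> R) : measurable_fun setT Z ->
  (forall x, 0 <= Z x < 2) ->
  exists F : Omega -> rat -> R, (forall x r, 0 <= F x r <= 1) /\
    forall B : set R, measurable B ->
      gmeas G (fun x => U (quantile (F x) @^-1` B) : \bar R) /\
      forall A, G A ->
        (P (A `&` Z @^-1` B) = \int[P]_(x in A) U (quantile (F x) @^-1` B))%E.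
Proof.
move=> mZ Z02.
have mind r : measurable_fun setT (fun x => if Z x < r then 1 else 0 : R).
  by apply: measurable_fun_ifT => //; exact: measurable_fun_ltr.
have ind01 r x : 0 <= (if Z x < r then 1 else 0 : R) <= 1.
  by case: ifP; rewrite ?lexx ler01.
have /choice[C CP] (r : R) := cond_exp_exists P sG GM (mind r) (ind01 r).
pose F x (r : rat) := C (ratr r) x.
have F01 x r : 0 <= F x r <= 1 by have [_ h _] := CP (ratr r); exact: h.
exists F; split => //.
have mF r : gmeas G (F^~ r) by have [] := CP (ratr r).
have mpre x B : measurable B -> measurable (quantile (F x) @^-1` B).
  by move=> mB; rewrite -[X in measurable X]setTI; exact: (measurable_quantile (F x)).
have mZB B : measurable B -> measurable (Z @^-1` B).
  by move=> mB; rewrite -[X in measurable X]setTI; exact: mZ.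
have base x : gmeas G (fun o => U (quantile (F o) @^-1` `]-oo, x[) : \bar R) /\
    forall A, G A -> (P (A `&` Z @^-1` `]-oo, x[) =
       \int[P]_(o in A) U (quantile (F o) @^-1` `]-oo, x[))%E.
  have [x2|x2] := leP x 2; last first.
    have UE o : U (quantile (F o) @^-1` `]-oo, x[) = 1%E.
      rewrite (_ : _ @^-1` _ = setT) ?probability_setT//.
      apply/seteqP; split => // u _ /=; rewrite in_itv/=.
      by apply/quantile_lt; left.
    split; first by under eq_fun do rewrite UE; exact: measurable_cst.
    move=> A GA; under eq_integral do rewrite UE.
    rewrite integral_cst ?mul1e; last exact: GM.
    congr (P _); apply/seteqP; split; first by move=> o [].
    move=> o Ao; split => //=.
    by rewrite in_itv/=; case/andP: (Z02 o) => _ /lt_trans; apply.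
  have UE o : U (quantile (F o) @^-1` `]-oo, x[) = qsup (F o) x by exact: quantile_law.
  have mq : gmeas G (fun o => qsup (F o) x).
    apply: measurable_fun_esups => k; apply/measurable_EFinP.
    by case: (unpickle k) => [r|] //; case: (_ && _).
  split; first by under eq_fun do rewrite UE.
  move=> A GA; pose s o := fine (qsup (F o) x).
  have sE o : qsup (F o) x = (s o)%:E by rewrite fineK// qsup_fin.
  have ms : gmeas G s by exact: measurableT_comp.
  have s01 o : 0 <= s o <= 1.
    by have := qsup_bound (F01 o) x; rewrite sE !lee_fin.
  have s0 o : 0 <= s o by case/andP: (s01 o).
  have mb := gmeas_in GA.
  have mb' : measurable_fun setT (fun x => x \in A) by exact: gW.
  have mif (h : Omega -> R) : measurable_fun setT h -> measurable_fun setT (fun o => if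
      o \in A then h o else 0).
    by move=> mh; exact: measurable_fun_ifT.
  transitivity (Ex P (fun o => if o \in A then (if Z o < x then 1 else 0) else 0)).
    rewrite -[X in P X]setIT -integral_indic//; last by apply: measurableI; [exact:
        GM|exact: mZB].
    apply: eq_integral => o _; rewrite indicE in_setI.
    case: (o \in A) => //=; congr (_%:E).
    rewrite (_ : (o \in _) = (Z o < x)); first by case: ifP.
    by apply/idP/idP; rewrite inE/= in_itv.
  transitivity (Ex P (fun o => if o \in A then s o else 0)); last first.
    rewrite [RHS](_ : _ = \int[P]_(o in [set o | o \in A]) (s o)%:E)%E; last first.
      rewrite (_ : [set o | o \in A] = A); last by apply/seteqP; split => o /=;
          [move/set_mem|move/mem_set].
      by apply: eq_integral => o _; rewrite UE sE.
    by rewrite -Ex_if.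
  (* For a fixed x only countably many comparisons are needed, so one null set suffices; they give s
     <= C x. *)
  have Cmono : {ae P, forall o, forall k : nat, if (unpickle k : option rat) is Some r then
      (0 < r) && (ratr r < x) -> F o r <= C x o else True}.
    apply: ae_foralln => k; case: (unpickle k) => [r|]; last exact: nearW.
    case: (boolP ((0 < r) && (ratr r < x))) => [/andP[r0 rx]|_]; last exact: nearW.
    have [mCx Cx01 CxE] := CP x; have [mCr Cr01 CrE] := CP (ratr r).
    have := @ae_le_of_Ex _ _ _ P G sG GM (C (ratr r)) (C x) mCr mCx.
    move=> h; apply: filterS (h _ _ _ _) => //.
    - by move=> o; case/andP: (Cr01 o).
    - by move=> o; case/andP: (Cx01 o).
    - rewrite -ge0_fin_numE; last by apply: Ex_ge0 => o; case/andP: (Cx01 o).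
      by apply: (@Ex_fin_num _ _ _ _ _ 1) => //; exact: gW.
    move=> b mb0; rewrite CrE// CxE//; have mb0' := gW mb0.
    apply: le_Ex.
    - by apply: measurable_fun_ifT.
    - by apply: measurable_fun_ifT.
    - by move=> o; case: ifP => // _; case: ifP.
    - move=> o; case: ifP => // _; case: ifPn => [h1|_]; last by case: ifP.
      by rewrite (lt_trans h1 rx).
  have [mCx Cx01 CxE] := CP x.
  have Cx0 o : 0 <= C x o by case/andP: (Cx01 o).
  apply/eqP; rewrite eq_le; apply/andP; split; last first.
    rewrite -CxE//; apply: ae_le_Ex.
    - by apply: mif; exact: gW.
    - by apply: mif; exact: gW.
    - by move=> o; case: ifP.
    - by move=> o; case: ifP.
    - apply: filterS Cmono => o h; case: ifP => // _.
      rewrite -lee_fin -sE; apply: ge_ereal_sup => _ [k _ <-]; rewrite lee_fin.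
      have := h k; case: (unpickle k) => [r|] //; case: ifP => // _; exact.
  have [x0|x0] := leP x 0.
    rewrite (@eq_Ex _ _ _ _ _ (fun=> 0)); last first.
      move=> o; case: ifP => // _; rewrite ltNge (le_trans x0)//.
      by case/andP: (Z02 o).
    by rewrite Ex_cst; apply: Ex_ge0 => o; case: ifP.
  have fin : Ex P (fun o => if o \in A then s o else 0) \is a fin_num.
    apply: (@Ex_fin_num _ _ _ _ _ 1); first by apply: mif; exact: gW.
    by move=> o; case: ifP => _; rewrite ?s01// lexx ler01.
  rewrite -(fineK fin).
  (* For the converse, the indicators of {Z < r n} converge to that of {Z < x}, while their
     integrals over A stay below that of s; Fatou concludes. *)
  have /choice[r rP] n : exists r : rat, [/\ 0 < r, ratr r < x & x - n.+1%:R^-1 < ratr r].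
    have : Num.max 0 (x - n.+1%:R^-1) < x by rewrite gt_max x0/= ltrBlDr ltrDl invr_gt0.
    move=> /rat_in_itvoo[r]; rewrite in_itv/= gt_max => /andP[/andP[r1 r2] r3].
    by exists r; split => //; rewrite -(ltr0q R).
  apply: (@Ex_fatou _ _ _ _ (fun n o => if o \in A then (if Z o < ratr (r n) then 1
      else 0) else 0)).
  - by move=> n; exact: mif.
  - by move=> n o; case: ifP => // _; case: ifP.
  - exact: mif.
  - by move=> o; case: ifP => // _; case: ifP.
  - apply: nearW => o c; case: ifP => // _; last by move=> c0; apply: nearW => n;
      exact: ltW.
    case: ifPn => Zx h; last by apply: nearW => n; case: ifP => _; [exact: le_trans
        (ltW h) ler01|exact: ltW].
    have d0 : 0 < x - Z o by rewrite subr_gt0.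
    have : \forall n \near \oo, n.+1%:R^-1 < x - Z o by exact: (near_infty_natSinv_lt
        (PosNum d0)).
    apply: filterS => n hn; have [_ _ rn] := rP n.
    rewrite (_ : Z o < ratr (r n)); first exact: ltW.
    by apply: lt_trans rn; rewrite ltrBrDr -ltrBrDl.
  - move=> n; rewrite EFinD fineK//; have [r0 rx _] := rP n.
    apply: (@le_trans _ _ (Ex P (fun o => if o \in A then s o else 0))); last first.
      by rewrite leeDl// lee_fin invr_ge0.
    have [mCr Cr01 CrE] := CP (ratr (r n)); rewrite -CrE//.
    apply: le_Ex.
    - by apply: mif; exact: gW.
    - by apply: mif; exact: gW.
    - by move=> o; case: ifP => // _; case/andP: (Cr01 o).
    - move=> o; case: ifP => // _; rewrite -lee_fin -sE.
      apply: ereal_sup_ubound; exists (pickle (r n)) => //.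
      by rewrite pickleK r0 rx.
have mR : @measurable _ R = <<s @RGenInftyO.G R >> by exact: RGenInftyO.measurableE.
move=> B mB.
pose Q : set_system R := [set B | gmeas G (fun x => U (quantile (F x) @^-1` B) : \bar R) /\
      forall A, G A ->
        (P (A `&` Z @^-1` B) = \int[P]_(x in A) U (quantile (F x) @^-1` B))%E].
apply: (@dynkin_induction _ R (@RGenInftyO.G R) Q mR).
- move=> _ _ [x ->] [y ->]; exists (Num.min x y).
  by apply/seteqP; split => z /=; rewrite !in_itv/= lt_min; [move=> [-> ->]|move=> /andP[]].
- split.
    rewrite (_ : (fun=> _) = cst 1%E); first exact: measurable_cst.
    by apply/funext => x; rewrite preimage_setT probability_setT.
  move=> A GA; rewrite preimage_setT setIT (eq_integral (fun=> 1%E)).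
    by rewrite integral_cst ?mul1e//; exact: GM.
  by move=> x _; rewrite preimage_setT probability_setT.
- by move=> _ [x ->]; exact: base.
- move=> S mS [mKS KS].
  have UC o : U (quantile (F o) @^-1` (~` S)) = (1 - U (quantile (F o) @^-1` S))%E.
    by rewrite preimage_setC probability_setC//; exact: mpre.
  have mKC : gmeas G (fun x => U (quantile (F x) @^-1` (~` S)) : \bar R).
    rewrite (_ : (fun=> _) = (fun x => 1 - U (quantile (F x) @^-1` S))%E); last
        exact/funext.
    by apply: emeasurable_funB => //; exact: measurable_cst.
  split => // A GA; have mA := GM GA.
  have fin : (\int[P]_(x in A) U (quantile (F x) @^-1` S))%E \is a fin_num.
    by rewrite -KS//; apply: fin_num_measure; apply: measurableI => //; exact: mZB.
  have eqA : (P A = P (A `&` Z @^-1` (~` S)) + P (A `&` Z @^-1` S))%E.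
    rewrite -measureU; first by rewrite -setIUr preimage_setC setUC setUv setIT.
    - by apply: measurableI => //; apply: mZB; exact: measurableC.
    - by apply: measurableI => //; exact: mZB.
    - by rewrite setIACA setIid preimage_setC setICl setI0.
  have eqI : (P A = \int[P]_(x in A) U (quantile (F x) @^-1` (~` S)) +
                    \int[P]_(x in A) U (quantile (F x) @^-1` S))%E.
    rewrite -ge0_integralD//; first last.
    + by apply: measurable_funTS; exact: gW.
    + by apply: measurable_funTS; exact: gW.
    rewrite (eq_integral (fun=> 1%E)); first by rewrite integral_cst// mul1e.
    move=> o _; rewrite UC subeK// fin_num_measure//; exact: mpre.
  rewrite -[LHS](addeK _ fin) -[RHS](addeK _ fin); congr (_ - _)%E.
  by rewrite -eqI eqA KS.
- move=> S mS tS QS.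
  have tpre (T : Type) (f : T -> R) : trivIset setT (fun n => f @^-1` S n).
    apply/trivIsetP => i j _ _ ij; rewrite -preimage_setI.
    by move/trivIsetP : tS => /(_ _ _ Logic.I Logic.I ij) ->; rewrite preimage_set0.
  have UE o : U (quantile (F o) @^-1` (\bigcup_k S k)) =
      (\sum_(0 <= k <oo) U (quantile (F o) @^-1` (S k)))%E.
    rewrite preimage_bigcup measure_bigcup//; last by move=> k _; exact: mpre.
    by apply: eq_eseriesl => k; rewrite in_setT.
  have mU : gmeas G (fun o => U (quantile (F o) @^-1` (\bigcup_k S k)) : \bar R).
    rewrite (_ : (fun=> _) = (fun o => \sum_(0 <= k <oo) U (quantile (F o) @^-1` (S
        k)))%E); last exact/funext.
    apply: (@ge0_emeasurable_sum _ (g_sigma_algebraType G) _ _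
      (fun k (o : Omega) => U (quantile (F o) @^-1` (S k))) predT) => // k _.
    by have [] := QS k.
  split => // A GA; have mA := GM GA.
  under eq_integral do rewrite UE.
  rewrite integral_nneseries//; last first.
    by move=> k; apply: measurable_funTS; apply: gW; have [] := QS k.
  rewrite preimage_bigcup setI_bigcupr measure_bigcup.
  + rewrite (eq_eseriesl (Q := predT)); last by move=> k; rewrite in_setT.
    by apply: eq_eseriesr => k _; have [_ h] := QS k; exact: h.
  + by move=> k _; apply: measurableI => //; exact: mZB.
  + by apply: trivIset_setIl; exact: tpre.
- by rewrite -mR.
Qed.

(** The kernel of the real code of Y is pushed forward by the decoding map. *)
Lemma rcd_exists (d : nat) (Y : Omega -> d.-tuple R) : measurable_fun setT Y ->
  exists kappa, rcd P G Y kappa.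
Proof.
move=> mY; pose Z x := ratcut_encode (Y x).
have mZ : measurable_fun setT Z by apply: measurableT_comp => //; exact:
    measurable_ratcut_encode.
have Z02 x : 0 <= Z x < 2.
  by have := ternary_bound (R := R) (fun n => ratcut n (Y x)); rewrite /Z
      /ratcut_encode; lra.
have [F [F01 FP]] := real_rcd_exists mZ Z02.
have mk x : measurable_fun [set: measurableTypeR R] (fun u => @ratcut_decode R d
    (quantile (F x) u)).
  exact: (measurableT_comp (@measurable_ratcut_decode R d) (measurable_quantile (F x))).
exists (fun x => distribution U (mfun_Sub (mem_set (mk x)))).
have mdec (B : set (d.-tuple R)) : measurable B -> measurable (@ratcut_decode R d @^-1` B).
  by move=> mB; rewrite -[X in measurable X]setTI; exact: measurable_ratcut_decode.
split.
  move=> B mB; apply/(sub_measurableP sG).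
  by have [+ _] := FP _ (mdec B mB).
move=> B mB A GA; have [_ /(_ A GA) <-] := FP _ (mdec B mB).
congr (P (A `&` _)); apply/seteqP.
by split => x /=; rewrite /Z ratcut_encodeK.
Qed.

End rcd_exists.

(** * Conditional supports and null strategies *)

Section boxes.
Context {R : realType} (d : nat).
Notation Rd := (d.-tuple R).

Lemma measurable_boxball (x : Rd) (e : R) : measurable (boxball x e).
Proof.
rewrite (_ : boxball x e = \bigcap_(i in [set: 'I_d]) [set y : Rd | `|tnth y i - tnth x
    i| < e]).
  apply: fin_bigcap_measurable => // i _.
  have m : measurable_fun setT (fun y : Rd => `|tnth y i - tnth x i| < e).
    apply: measurable_fun_ltr => //; apply: measurableT_comp => //.
    by apply: measurable_funB => //; exact: measurable_tnth.
  by rewrite -[X in measurable X]setTI; apply: (m measurableT [set true]).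
by apply/seteqP; split => y /= h i; [move=> _|]; exact: h.
Qed.

Definition rbox (p : d.-tuple rat * rat) : set Rd :=
  boxball [tuple ratr (tnth p.1 i) | i < d] (ratr p.2).

Lemma measurable_rbox p : measurable (rbox p).
Proof. exact: measurable_boxball. Qed.

Lemma rbox_between (x : Rd) (e : R) : 0 < e ->
  exists p, boxball x (e / 4) `<=` rbox p /\ rbox p `<=` boxball x e.
Proof.
move=> e0.
have /choice[a aP] (i : 'I_d) : exists q : rat, `|ratr q - tnth x i| < e / 4.
  have : tnth x i < tnth x i + e / 4 by rewrite ltrDl; lra.
  move=> /rat_in_itvoo[q]; rewrite in_itv/= => /andP[q1 q2]; exists q.
  by rewrite ger0_norm; lra.
(* The rational centre is within e/4 of x: a radius above e/2 covers the small box, and a radius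
   below 3e/4 stays in the large one. *)
have : e / 2 < 3 * e / 4 by lra.
move=> /rat_in_itvoo[q]; rewrite in_itv/= => /andP[q1 q2].
exists ([tuple a i | i < d], q); split => y h i; have := h i; have := aP i;
  rewrite /= !tnth_mktuple => ai hi.
- have := ler_normB (tnth y i - tnth x i) (ratr (a i) - tnth x i).
  rewrite (_ : _ - _ - _ = tnth y i - ratr (a i)); [lra|ring].
- have := ler_normD (tnth y i - ratr (a i)) (ratr (a i) - tnth x i).
  rewrite (_ : _ - _ + _ = tnth y i - tnth x i); [lra|ring].
Qed.

Lemma boxball_center (x : Rd) (e : R) : 0 < e -> boxball x e x.
Proof. by move=> e0 i; rewrite subrr normr0. Qed.

Lemma dotp_neq0_open (v w : Rd) : dotp v w != 0 -> exists2 e, 0 < e &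
  forall v' w', boxball v e v' -> boxball w e w' -> dotp v' w' != 0.
Proof.
move=> vw; pose C := 1 + \sum_i (`|tnth v i| + `|tnth w i| + 1).
have C0 : 0 < C by rewrite ltr_pwDl// sumr_ge0// => i _; rewrite !addr_ge0.
have n0 : 0 < `|dotp v w| by rewrite normr_gt0.
pose e := Num.min 1 (`|dotp v w| / (2 * C)).
have e0 : 0 < e by rewrite lt_min ltr01 divr_gt0// mulr_gt0.
have e1 : e <= 1 by rewrite ge_min lexx.
have eC : e * C <= `|dotp v w| / 2.
  have : e <= `|dotp v w| / (2 * C) by rewrite ge_min lexx orbT.
  rewrite ler_pdivlMr ?mulr_gt0//; lra.
exists e => // v' w' hv hw; apply: contraTneq n0 => dp0; rewrite -leNgt.
have : `|dotp v' w' - dotp v w| <= e * \sum_i (`|tnth v i| + `|tnth w i| + 1).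
  rewrite /dotp -sumrB mulr_sumr; apply: (le_trans (ler_norm_sum _ _ _)).
  apply: ler_sum => i _; have := hv i; have := hw i.
  set a := tnth v i; set b := tnth w i; set a' := tnth v' i; set b' := tnth w' i.
  move=> hb ha.
  have -> : a' * b' - a * b = (a' - a) * (b' - b) + (a' - a) * b + a * (b' - b) by ring.
  apply: (le_trans (ler_normD _ _)); apply: (le_trans (lerD (ler_normD _ _) (lexx _))).
  rewrite !normrM.
  have h1 : `|a' - a| * `|b' - b| <= e * 1.
    by apply: ler_pM => //; [exact: ltW|exact: le_trans (ltW hb) e1].
  have h2 : `|a' - a| * `|b| <= e * `|b| by rewrite ler_wpM2r// ltW.
  have h3 : `|a| * `|b' - b| <= `|a| * e by rewrite ler_wpM2l// ltW.
  rewrite (_ : e * _ = e * 1 + e * `|b| + `|a| * e); [lra|ring].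
rewrite dp0 sub0r normrN; move: eC; rewrite /C mulrDr mulr1.
by have := normr_ge0 (dotp v w); lra.
Qed.

(** A point off the support has a null box, hence lies in a null rational box, and there are
    countably many of these. *)
Lemma support_disjoint0 (mu : probability Rd R) (B : set Rd) : measurable B ->
  (forall w, B w -> ~ Defs.support mu w) -> mu B = 0%E.
Proof.
move=> mB h.
pose N k : set Rd := if (unpickle k : option (d.-tuple rat * rat)) is Some p then
  (if mu (rbox p) == 0%E then rbox p else set0) else set0.
have mN k : measurable (N k).
  rewrite /N; case: (unpickle k) => [p|] //; case: ifP => // _; exact: measurable_rbox.
have N0 k : mu (N k) = 0%E.
  by rewrite /N; case: (unpickle k) => [p|]; rewrite ?measure0//; case: ifPn =>
      [/eqP|_]; rewrite ?measure0.
have mU : measurable (\bigcup_k N k) by exact: bigcupT_measurable.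
have U0 : mu (\bigcup_k N k) = 0%E.
  apply/negligibleP => //; apply: negligible_bigcup => k.
  by apply/negligibleP; [exact: mN|exact: N0].
apply: (subset_measure0 mB mU _ U0) => w Bw.
have [e e0] : exists2 e, 0 < e & mu (boxball w e) = 0%E.
  apply: contrapT => hn; apply: (h w Bw) => e e0; rewrite lt_neqAle measure_ge0 andbT.
  by apply/eqP => he; apply: hn; exists e.
move=> wz; have [p [p1 p2]] := rbox_between w e0.
exists (pickle p) => //; rewrite /N pickleK.
rewrite (_ : mu (rbox p) = 0%E) ?eqxx.
  by apply: p1; apply: boxball_center; rewrite divr_gt0.
by apply: (subset_measure0 (measurable_rbox p) (measurable_boxball _ _) p2).
Qed.

End boxes.

Section null_transfer.
Context {R : realType} {dO : measure_display} {Omega : measurableType dO}.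
Variable P : probability Omega R.
Variable G : set (set Omega).
Hypothesis sG : sigma_algebra setT G.
Hypothesis GM : G `<=` measurable.
Variable d : nat.
Notation Rd := (d.-tuple R).
Variable h : Omega -> Rd.
Hypothesis mh : sub_measurable G h.

(** Kernel identities concern fixed Borel sets, whereas the hyperplane orthogonal to h(x) varies
    with x. The relation <v, w> != 0 is open, hence a countable union of products of rational boxes;
    on the [G]-event that h lies in the first box, only the fixed second box has to be tested. *)
Let far (p q : d.-tuple rat * rat) :=
  forall v w : Rd, rbox p v -> rbox q w -> dotp v w != 0.

Let far_exists (v w : Rd) : dotp v w != 0 ->
  exists p q, [/\ far p q, rbox p v, rbox q w & exists2 e, 0 < e & boxball w e `<=` rbox q].
Proof.
move=> /dotp_neq0_open[e e0 he].
have [p [p1 p2]] := rbox_between v e0; have [q [q1 q2]] := rbox_between w e0.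
have e4 : 0 < e / 4 by rewrite divr_gt0.
exists p, q; split.
- by move=> v' w' /p2 hv /q2 hw; exact: he.
- by apply: p1; exact: boxball_center.
- by apply: q1; exact: boxball_center.
- by exists (e / 4).
Qed.

Let mhp p : G (h @^-1` rbox p).
Proof. by apply: mh; exact: measurable_rbox. Qed.

Lemma support_orthogonal (X : Omega -> Rd) kappa : measurable_fun setT X ->
  rcd P G X kappa -> {ae P, forall x, dotp (h x) (X x) = 0} ->
  {ae P, forall x, Defs.support (kappa x) `<=` [set v | dotp (h x) v = 0]}.
Proof.
move=> mX [mk kE] hX.
have key : {ae P, forall x, forall k,
    if (unpickle k : option ((d.-tuple rat * rat) * (d.-tuple rat * rat))) is Some (p, q)
    then far p q -> rbox p (h x) -> kappa x (rbox q) = 0%E else True}.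
  apply: ae_foralln => k; case: (unpickle k) => [[p q]|]; last exact: nearW.
  have [fpq|nf] := pselect (far p q); last by apply: nearW => x /nf.
  have mA := GM (mhp p).
  have I0 : (\int[P]_(x in h @^-1` rbox p) kappa x (rbox q) = 0)%E.
    rewrite -kE//; last exact: measurable_rbox.
    have mXq : measurable (X @^-1` rbox q).
      by rewrite -[X in measurable X]setTI; apply: mX => //; exact: measurable_rbox.
    apply/negligibleP; first exact: measurableI.
    apply: negligibleS hX => x [hx Xx] /= hX0.
    by have := fpq _ _ hx Xx; rewrite hX0 eqxx.
  have mkq : measurable_fun (h @^-1` rbox p) (fun x => kappa x (rbox q)).
    apply: measurable_funTS; apply: (gmeas_measurable sG GM).
    by apply/(sub_measurableP sG); apply: mk; exact: measurable_rbox.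
  have : (\int[P]_(x in h @^-1` rbox p) `|kappa x (rbox q)|)%E = 0%E.
    by rewrite -[RHS]I0; apply: eq_integral => x _; rewrite gee0_abs.
  move/(ae_eq_integral_abs P mA mkq); apply: filterS => x hx _ hp.
  exact: hx.
apply: filterS key => x key v sv /=; apply: contrapT => /eqP hv.
have [p [q [fpq ph _ [e e0 eq]]]] := far_exists hv.
have := key (pickle (p, q)); rewrite pickleK => /(_ fpq ph) k0.
have := sv e e0; rewrite (_ : kappa x (boxball v e) = 0%E) ?ltxx//.
exact: (subset_measure0 (measurable_boxball _ _) (measurable_rbox q) eq).
Qed.

Lemma orthogonal_support (Y : Omega -> Rd) kappa : measurable_fun setT Y ->
  rcd P G Y kappa ->
  {ae P, forall x, Defs.support (kappa x) `<=` [set v | dotp (h x) v = 0]} ->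
  {ae P, forall x, dotp (h x) (Y x) = 0}.
Proof.
move=> mY [mk kE] hs.
have key : {ae P, forall x, forall k,
    if (unpickle k : option ((d.-tuple rat * rat) * (d.-tuple rat * rat))) is Some (p, q)
    then far p q -> ~ (rbox p (h x) /\ rbox q (Y x)) else True}.
  apply: ae_foralln => k; case: (unpickle k) => [[p q]|]; last exact: nearW.
  have [fpq|nf] := pselect (far p q); last by apply: nearW => x /nf.
  have mA := GM (mhp p).
  have mYq : measurable (Y @^-1` rbox q).
    by rewrite -[X in measurable X]setTI; apply: mY => //; exact: measurable_rbox.
  have mkq : measurable_fun (h @^-1` rbox p) (fun x => kappa x (rbox q)).
    apply: measurable_funTS; apply: (gmeas_measurable sG GM).
    by apply/(sub_measurableP sG); apply: mk; exact: measurable_rbox.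
  have : P (h @^-1` rbox p `&` Y @^-1` rbox q) = 0%E.
    rewrite kE//; last exact: measurable_rbox.
    rewrite (eq_integral (fun x => `|kappa x (rbox q)|)%E); last by move=> x _; rewrite
        gee0_abs.
    apply/(ae_eq_integral_abs P mA mkq); apply: filterS hs => x hx hp.
    apply: support_disjoint0; first exact: measurable_rbox.
    by move=> w qw /hx /= hw; have := fpq _ _ hp qw; rewrite hw eqxx.
  move/(negligibleP P (measurableI _ _ mA mYq)); apply: negligibleS => x /= hx.
  by apply: contrapT => hn; apply: hx => _.
apply: filterS key => x key; apply: contrapT => /eqP hv.
have [p [q [fpq ph qY _]]] := far_exists hv.
by have := key (pickle (p, q)); rewrite pickleK => /(_ fpq); apply.
Qed.

Lemma affine_set_orthogonal (v : Rd) : affine_set [set w | dotp v w = 0].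
Proof.
move=> x y /= hx hy l; rewrite /dotp.
transitivity (l * dotp v x + (1 - l) * dotp v y); last by rewrite hx hy !mulr0 addr0.
rewrite /dotp !mulr_sumr -big_split/=; apply: eq_bigr => i _.
by rewrite tnth_mktuple; ring.
Qed.

Lemma null_transfer (X Y : Omega -> Rd) :
  measurable_fun setT X -> measurable_fun setT Y ->
  (forall kX kY, rcd P G Y kY -> rcd P G X kX ->
    {ae P, forall x, affine_hull (Defs.support (kY x)) `<=` affine_hull (Defs.support
        (kX x))}) ->
  {ae P, forall x, dotp (h x) (X x) = 0} -> {ae P, forall x, dotp (h x) (Y x) = 0}.
Proof.
move=> mX mY incl hX.
have [kX rX] := rcd_exists P sG GM mX; have [kY rY] := rcd_exists P sG GM mY.
apply: (orthogonal_support mY rY).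
apply: filterS2 (incl _ _ rY rX) (support_orthogonal mX rX hX) => x i1 i2 v sv.
have : affine_hull (Defs.support (kY x)) v by move=> B _; apply.
by move/i1; apply => //; exact: affine_set_orthogonal.
Qed.

End null_transfer.

(** * Multi-period estimates *)

Section market.
Context {R : realType} {dO : measure_display} {Omega : measurableType dO}.
Variable P : probability Omega R.
Variables (d T : nat) (F : nat -> set (set Omega)).
Hypothesis filtF : filtration P F T.
Notation Rd := (d.-tuple R).
Notation proc := (@process R _ Omega d).

Let sF t : (t <= T)%N -> sigma_algebra setT (F t).
Proof. by case: filtF => h _ _ _; exact: h. Qed.

Let FM t : (t <= T)%N -> F t `<=` measurable.
Proof. by case: filtF => _ h _ _; exact: h. Qed.

Let gW t (tT : (t <= T)%N) := gmeas_measurable (sF tT) (FM tT).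

Lemma gmeas_mono s t dV (V : measurableType dV) (f : Omega -> V) :
  (s <= t)%N -> (t <= T)%N -> gmeas (F s) f -> gmeas (F t) f.
Proof.
move=> st tT mf _ B mB; rewrite (measurable_g_measurableTypeE (sF tT)) setTI.
have [_ _ h _] := filtF; apply: (h s t st tT).
have := mf measurableT B mB.
by rewrite (measurable_g_measurableTypeE (sF (leq_trans st tT))) setTI.
Qed.

Lemma strategies_tnth (phi : proc) t i : strategies F T phi -> (t < T)%N ->
  gmeas (F t) (fun x => tnth (phi t.+1 x) i).
Proof.
move=> sphi tT; have := sphi t.+1 tT.
move/(sub_measurableP (sF (ltnW tT))).
by move/measurable_fun_tnthP => /(_ i).
Qed.

Lemma strategies_tuple (f : nat -> 'I_d -> Omega -> R) :
  (forall t i, (t < T)%N -> gmeas (F t) (f t.+1 i)) ->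
  strategies F T (fun t x => [tuple f t i x | i < d]).
Proof.
move=> mf [|t]//= tT; apply/(sub_measurableP (sF (ltnW tT))).
apply/measurable_fun_tnthP => i.
rewrite (_ : _ \o _ = f t.+1 i); first exact: mf.
by apply/funext => x /=; rewrite tnth_mktuple.
Qed.

Lemma adapted_DeltaS (S : proc) t i : adapted F T S -> (t < T)%N ->
  gmeas (F t.+1) (fun x => tnth (DeltaS S t.+1 x) i).
Proof.
move=> aS tT.
rewrite (_ : (fun x => _) = (fun x => tnth (S t.+1 x) i - tnth (S t x) i)); last first.
  by apply/funext => x; rewrite tnth_mktuple.
apply: measurable_funB.
  have /(sub_measurableP (sF tT)) := aS _ tT.
  by move/measurable_fun_tnthP => /(_ i).
apply: (gmeas_mono (leqnSn t) tT).
have /(sub_measurableP (sF (ltnW tT))) := aS _ (ltnW tT).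
by move/measurable_fun_tnthP => /(_ i).
Qed.

Lemma measurable_DeltaS (S : proc) t : adapted F T S -> (t < T)%N ->
  measurable_fun setT (DeltaS S t.+1).
Proof.
move=> aS tT; apply/measurable_fun_tnthP => i.
by apply: (gW tT); exact: adapted_DeltaS.
Qed.

Lemma wealthS (S : proc) w phi t x :
  wealth S w phi t.+1 x = wealth S w phi t x + dotp (phi t.+1 x) (DeltaS S t.+1 x).
Proof. by rewrite /wealth big_nat_recr//= addrA. Qed.

Lemma wealth0 (S : proc) w phi x : wealth S w phi 0 x = w.
Proof. by rewrite /wealth big_geq// addr0. Qed.

Lemma gmeas_wealth (S : proc) w phi t : adapted F T S -> strategies F T phi ->
  (t <= T)%N -> gmeas (F t) (wealth S w phi t).
Proof.
move=> aS sphi; elim: t => [|t IH] tT.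
  rewrite (_ : wealth _ _ _ _ = cst w); first exact: measurable_cst.
  by apply/funext => x; rewrite wealth0.
rewrite (_ : wealth _ _ _ _ = (fun x => wealth S w phi t x +
    \sum_i tnth (phi t.+1 x) i * tnth (DeltaS S t.+1 x) i)); last first.
  by apply/funext => x; rewrite wealthS.
apply: measurable_funD; first by apply: (gmeas_mono (leqnSn t) tT); exact: IH (ltnW tT).
apply: measurable_sum => i; apply: measurable_funM; last exact: adapted_DeltaS.
by apply: (gmeas_mono (leqnSn t) tT); exact: strategies_tnth.
Qed.

Variable S0 : proc.
Hypothesis aS0 : adapted F T S0.
Hypothesis naS0 : NA P F T S0.

Let X t (i : 'I_d) x := tnth (DeltaS S0 t x) i.

Let mX t i : (t < T)%N -> measurable_fun setT (X t.+1 i).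
Proof. by move=> tT; apply: (gW tT); exact: adapted_DeltaS. Qed.

(** The position h is held in period t+1 only, so the terminal wealth is its one-period gain. *)
Lemma NA_one_step t (h : 'I_d -> Omega -> R) : (t < T)%N ->
  (forall i, gmeas (F t) (h i)) ->
  {ae P, forall x, 0 <= \sum_i h i x * X t.+1 i x} ->
  {ae P, forall x, \sum_i h i x * X t.+1 i x = 0}.
Proof.
move=> tT mh h0.
pose phi : proc := fun s x => [tuple (if s == t.+1 then h i x else 0) | i < d].
have sphi : strategies F T phi.
  apply: (@strategies_tuple (fun s i x => if s == t.+1 then h i x else 0)) => s i sT.
  by rewrite eqSS; case: (s =P t) => [->|_]; [exact: mh|exact: measurable_cst].
have dotE s x : dotp (phi s x) (DeltaS S0 s x) =
    if s == t.+1 then \sum_i h i x * X t.+1 i x else 0.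
  rewrite /dotp; case: (s =P t.+1) => [->|/eqP/negPf st].
    by apply: eq_bigr => i _; rewrite tnth_mktuple eqxx.
  by apply: big1 => i _; rewrite tnth_mktuple st mul0r.
have WE x : wealth S0 0 phi T x = \sum_i h i x * X t.+1 i x.
  rewrite /wealth add0r (eq_bigr (fun s => if s == t.+1 then \sum_i h i x * X t.+1 i x
      else 0)); last first.
    by move=> s _; exact: dotE.
  rewrite -big_mkcond/= big_nat1_eq/=.
  by rewrite ltnS tT.
have : {ae P, forall x, 0 <= wealth S0 0 phi T x} by apply: filterS h0 => x; rewrite WE.
by move/(naS0 sphi); apply: filterS => x; rewrite WE.
Qed.

Lemma projections : exists p : nat -> 'I_d -> 'I_d -> Omega -> R, forall t, (t < T)%N ->
  [/\ forall k i, gmeas (F t) (p t.+1 k i),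
      forall h : 'I_d -> Omega -> R, (forall i, gmeas (F t) (h i)) ->
        null_strategy P (F t) (X t.+1) (fun k x => \sum_i p t.+1 k i x * h i x) &
      forall z, null_strategy P (F t) (X t.+1) z ->
        {ae P, forall x, forall k, z k x = \sum_i p t.+1 k i x * z i x}].
Proof.
have /choice[p pP] (t : nat) : exists p : 'I_d -> 'I_d -> Omega -> R, (t < T)%N ->
  [/\ forall k i, gmeas (F t) (p k i),
      forall h : 'I_d -> Omega -> R, (forall i, gmeas (F t) (h i)) ->
        null_strategy P (F t) (X t.+1) (fun k x => \sum_i p k i x * h i x) &
      forall z, null_strategy P (F t) (X t.+1) z ->
        {ae P, forall x, forall k, z k x = \sum_i p k i x * z i x}].
  have [tT|tT] := ltnP t T; last by exists (fun _ _ _ => 0).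
  have [p pP] := null_projection P (sF (ltnW tT)) (FM (ltnW tT)) (X t.+1).
  by exists p.
by exists (fun t => p t.-1) => t tT; exact: pP.
Qed.

Variable p : nat -> 'I_d -> 'I_d -> Omega -> R.
Hypothesis pP : forall t, (t < T)%N ->
  [/\ forall k i, gmeas (F t) (p t.+1 k i),
      forall h : 'I_d -> Omega -> R, (forall i, gmeas (F t) (h i)) ->
        null_strategy P (F t) (X t.+1) (fun k x => \sum_i p t.+1 k i x * h i x) &
      forall z, null_strategy P (F t) (X t.+1) z ->
        {ae P, forall x, forall k, z k x = \sum_i p t.+1 k i x * z i x}].

(* p t projects onto the null strategies of period t. *)
Definition reduced (phi : proc) := strategies F T phi /\
  forall t, (t < T)%N ->
    {ae P, forall x, forall k, \sum_i p t.+1 k i x * tnth (phi t.+1 x) i = 0}.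

Lemma ae_forall_ltn (A : nat -> Omega -> Prop) (n : nat) :
  (forall t, (t < n)%N -> {ae P, forall x, A t x}) ->
  {ae P, forall x, forall t, (t < n)%N -> A t x}.
Proof.
move=> h; apply: ae_foralln => t; have [tn|tn] := ltnP t n; last exact: nearW.
by apply: filterS (h t tn).
Qed.

Lemma eq_wealth_dotp (S : proc) w phi psi :
  (forall t, (t < T)%N ->
    {ae P, forall x, dotp (phi t.+1 x) (DeltaS S t.+1 x) = dotp (psi t.+1 x) (DeltaS S
        t.+1 x)}) ->
  {ae P, forall x, wealth S w phi T x = wealth S w psi T x}.
Proof.
move=> /ae_forall_ltn; apply: filterS => x h; congr (w + _).
rewrite !big_add1/= !big_mkord; apply: eq_bigr => t _; exact: h.
Qed.

Lemma reduce (phi : proc) : strategies F T phi -> exists2 psi, reduced psi &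
  forall S w, adapted F T S -> D_incl P F T S S0 ->
    {ae P, forall x, wealth S w psi T x = wealth S w phi T x}.
Proof.
move=> sphi; pose q t k x := \sum_i p t k i x * tnth (phi t x) i.
have mphi t i : (t < T)%N -> gmeas (F t) (fun x => tnth (phi t.+1 x) i) by exact:
    strategies_tnth.
have mq t k : (t < T)%N -> gmeas (F t) (q t.+1 k).
  move=> tT; have [mp _ _] := pP tT; apply: measurable_sum => i; apply: measurable_funM
      => //.
  exact: mphi.
have nq t : (t < T)%N -> null_strategy P (F t) (X t.+1) (q t.+1).
  by move=> tT; have [_ h _] := pP tT; apply: h => i; exact: mphi.
exists (fun t x => [tuple tnth (phi t x) k - q t k x | k < d]).
  split.
    apply: (@strategies_tuple (fun t k x => tnth (phi t x) k - q t k x)) => t k tT.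
    by apply: measurable_funB; [exact: mphi|exact: mq].
  move=> t tT; have [_ _ h] := pP tT.
  (* The projected part q is null, so the projection fixes it and annihilates phi - q. *)
  apply: filterS (h _ (nq t tT)) => x hx k.
  rewrite (eq_bigr (fun i => p t.+1 k i x * tnth (phi t.+1 x) i - p t.+1 k i x * q t.+1
      i x)).
    by rewrite sumrB -hx subrr.
  by move=> i _; rewrite tnth_mktuple mulrBr.
move=> S w aS inclS; apply: eq_wealth_dotp => t tT.
have sq : sub_measurable (F t) (fun x => [tuple q t.+1 k x | k < d]).
  apply/(sub_measurableP (sF (ltnW tT))); apply/measurable_fun_tnthP => k.
  rewrite (_ : _ \o _ = q t.+1 k); first exact: mq.
  by apply/funext => x /=; rewrite tnth_mktuple.
have q0 : {ae P, forall x, dotp [tuple q t.+1 k x | k < d] (DeltaS S0 t.+1 x) = 0}.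
  apply: filterS (nq t tT).2 => x h; rewrite -[RHS]h; apply: eq_bigr => i _.
  by rewrite tnth_mktuple.
have := null_transfer (sF (ltnW tT)) (FM (ltnW tT)) sq
  (measurable_DeltaS aS0 tT) (measurable_DeltaS aS tT) _ q0.
move=> h; apply: filterS (h _) => [x hx|kX kY rY rX]; last exact: (inclS t.+1 tT).
rewrite -[RHS]subr0 -hx /dotp -sumrB; apply: eq_bigr => i _.
by rewrite !tnth_mktuple mulrBl.
Qed.

Variable w0 : R.
Let W phi t := wealth S0 w0 phi t.

Let mW phi t : strategies F T phi -> (t <= T)%N -> gmeas (F t) (W phi t).
Proof. by move=> sphi tT; exact: gmeas_wealth. Qed.

Let WS phi t x : W phi t.+1 x = W phi t x + \sum_i tnth (phi t.+1 x) i * X t.+1 i x.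
Proof. exact: wealthS. Qed.

(** The multiplier [de] is inserted by scaling wealth and positions alike, which keeps the positions
    reduced. It serves as an indicator in the backward estimate and as the accumulated weight in the
    forward one. *)
Lemma reduced_one_step t (ga : Omega -> R) : (t < T)%N ->
  measurable_fun setT ga -> (forall x, 0 < ga x <= 1) ->
  exists al : Omega -> R, [/\ gmeas (F t) al, forall x, 0 < al x <= 1 &
  forall phi (de : Omega -> R), reduced phi -> gmeas (F t) de -> (forall x, 0 <= de x) ->
    (Ex P (fun x => al x * (de x * (negp (W phi t x) + \sum_i `|tnth (phi t.+1 x) i|)))%R <=
     Ex P (fun x => ga x * (de x * negp (W phi t.+1 x)))%R +
     Ex P (fun x => de x * Num.max (W phi t x) 0)%R)%E].
Proof.
move=> tT mga ga01; have [mp hp1 hp2] := pP tT.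
have [al [mal al01 alP]] := one_step_bound (sF (ltnW tT)) (FM (ltnW tT))
  (fun i => mX i tT) mp hp2 (fun h => @NA_one_step t h tT) mga ga01.
exists al; split => // phi de [sphi rphi] mde de0.
have := alP (fun x => de x * W phi t x) (fun i x => de x * tnth (phi t.+1 x) i).
have h1 : gmeas (F t) (fun x => de x * W phi t x).
  by apply: measurable_funM => //; apply: mW => //; exact: ltnW.
have h2 i : gmeas (F t) (fun x => de x * tnth (phi t.+1 x) i).
  by apply: measurable_funM => //; exact: strategies_tnth.
have h3 : {ae P, forall x, forall k, \sum_i p t.+1 k i x * (de x * tnth (phi t.+1 x) i)
    = 0}.
  apply: filterS (rphi t tT) => x hx k.
  rewrite (eq_bigr (fun i => de x * (p t.+1 k i x * tnth (phi t.+1 x) i))).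
    by rewrite -mulr_sumr hx mulr0.
  by move=> i _; ring.
move=> /(_ h1 h2 h3); congr (_ <= _ + _)%E; apply: eq_Ex => x.
- congr (_ * _); rewrite negpM// mulrDr mulr_sumr; congr (_ + _); apply: eq_bigr => i _.
  by rewrite normrM ger0_norm.
- congr (_ * _); rewrite -negpM// WS; congr negp; rewrite [RHS]mulrDr mulr_sumr; congr
    (_ + _).
  by apply: eq_bigr => i _; rewrite mulrA.
- by rewrite maxr_pMr// mulr0.
Qed.

Lemma backward_weight t : (t <= T)%N ->
  exists ga : Omega -> R, [/\ gmeas (F t) ga, forall x, 0 < ga x <= 1 &
    forall phi, reduced phi ->
      (Ex P (fun x => ga x * negp (W phi t x))%R <= Ex P (fun x => negp (W phi T x)))%E].
Proof.
move=> tT; rewrite -(subKn tT); move: (T - t)%N (leq_subr t T) => k {t tT}.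
elim: k => [|k IH] kT.
  rewrite subn0; exists (fun=> 1); split => //.
    by move=> x; rewrite ltr01 lexx.
  by move=> phi _; under eq_Ex do rewrite mul1r.
have [ga [mga ga01 gaP]] := IH (ltnW kT).
set t := (T - k.+1)%N; have tS : (T - k)%N = t.+1 by rewrite /t subnSK.
rewrite tS in mga gaP.
have tT : (t < T)%N by rewrite -tS leq_subr.
have mga' := gW tT mga.
have [al [mal al01 alP]] := reduced_one_step tT mga' ga01.
exists al; split => // phi rphi; have [sphi _] := rphi.
(* This indicator kills the term max(W_t, 0) and leaves the negative part of W_t unchanged. *)
pose de x : R := if W phi t x < 0 then 1 else 0.
have mWt : gmeas (F t) (W phi t) by apply: mW => //; exact: ltnW.
have mde : gmeas (F t) de.
  by apply: measurable_fun_ifT => //; exact: measurable_fun_ltr.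
have de0 x : 0 <= de x by rewrite /de; case: ifP.
have mde' := gW (ltnW tT) mde; have mWt' := gW (ltnW tT) mWt.
have mal' := gW (ltnW tT) mal.
have mWS : measurable_fun setT (W phi t.+1) by apply: (gW tT); exact: mW.
have mphi i : measurable_fun setT (fun x => tnth (phi t.+1 x) i).
  by apply: (gW (ltnW tT)); exact: strategies_tnth.
have al0 x : 0 <= al x by case/andP: (al01 x) => /ltW.
have ga0 x : 0 <= ga x by case/andP: (ga01 x) => /ltW.
have mnW := measurable_negp mWt'; have mnWS := measurable_negp mWS.
apply: le_trans (gaP phi rphi).
apply: (@le_trans _ _ (Ex P (fun x => al x * (de x * (negp (W phi t x) + \sum_i `|tnth
    (phi t.+1 x) i|)))%R)).
  apply: le_Ex.
  - exact: measurable_funM.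
  - apply: measurable_funM => //; apply: measurable_funM => //; apply: measurable_funD
      => //.
    by apply: measurable_sum => i; exact: measurableT_comp.
  - by move=> x; rewrite mulr_ge0// negp_ge0.
  - move=> x; rewrite ler_wpM2l// /de; case: ltP => W0.
      by rewrite mul1r lerDl sumr_ge0.
    by rewrite negp_eq0// mul0r.
apply: (le_trans (alP phi de rphi mde de0)).
rewrite [X in (_ + X)%E](_ : _ = 0%E) ?adde0; last first.
  rewrite (@eq_Ex _ _ _ _ _ (fun=> 0)) ?Ex_cst// => x; rewrite /de; case: ltP => W0.
    by rewrite mulr0.
  by rewrite mul0r.
apply: le_Ex.
- by apply: measurable_funM => //; exact: measurable_funM.
- exact: measurable_funM.
- by move=> x; rewrite mulr_ge0// mulr_ge0// negp_ge0.
- move=> x; rewrite ler_wpM2l// /de; case: ifP => _; first by rewrite mul1r.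
  by rewrite mul0r negp_ge0.
Qed.

(** The weighted negative part at t+1 is controlled by the terminal one, and the positive part at t
    by the induction hypothesis; together they bound the next position and then the next wealth. *)
Lemma forward_weight (K : R) t : 0 <= K -> (t <= T)%N ->
  exists (de : Omega -> R) (C : R), [/\ gmeas (F t) de, forall x, 0 < de x <= 1, 0 <= C &
    forall phi, reduced phi -> (Ex P (fun x => negp (W phi T x)) <= K%:E)%E ->
      (Ex P (fun x => de x * `|W phi t x|)%R <= C%:E)%E /\
      forall s i, (s < t)%N -> (Ex P (fun x => de x * `|tnth (phi s.+1 x) i|)%R <= C%:E)%E].
Proof.
move=> K0; elim: t => [|t IH] tT.
  exists (fun=> 1), `|w0|; split => //.
    by move=> x; rewrite ltr01 lexx.
  move=> phi _ _; split => //.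
  rewrite (@eq_Ex _ _ _ _ _ (fun=> `|w0|)) ?Ex_cst// => x.
  by rewrite mul1r /W wealth0.
have [de [C [mde de01 C0 deP]]] := IH (ltnW tT).
have [ga [mga ga01 gaP]] := backward_weight tT.
have [al [mal al01 alP]] := reduced_one_step tT (gW tT mga) ga01.
have al0 x : 0 <= al x by case/andP: (al01 x) => /ltW.
have ga0 x : 0 <= ga x by case/andP: (ga01 x) => /ltW.
have de0 x : 0 <= de x by case/andP: (de01 x) => /ltW.
have al1 x : al x <= 1 by case/andP: (al01 x).
have de1 x : de x <= 1 by case/andP: (de01 x).
pose sX x := 1 + \sum_i `|X t.+1 i x|.
have sX1 x : 1 <= sX x by rewrite lerDl sumr_ge0.
have sX0 x : 0 < sX x by exact: lt_le_trans ltr01 (sX1 x).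
have sXV x : 0 <= (sX x)^-1 by rewrite invr_ge0 ltW.
have sXV1 x : (sX x)^-1 <= 1 by rewrite invf_le1.
have msX : gmeas (F t.+1) sX.
  apply: measurable_funD => //; apply: measurable_sum => i; apply: measurableT_comp => //.
  exact: adapted_DeltaS.
(* [de] serves the past, [al] the new position, and the last factor absorbs its product with the
   price increment. *)
pose de' x := de x * al x * (sX x)^-1.
have mde2 : gmeas (F t.+1) de by exact: gmeas_mono (leqnSn t) tT mde.
have mal2 : gmeas (F t.+1) al by exact: gmeas_mono (leqnSn t) tT mal.
have mde' : gmeas (F t.+1) de'.
  by apply: measurable_funM; [exact: measurable_funM|exact: measurable_funV].
have de'_le x : de' x <= de x * al x by rewrite /de' ler_piMr// mulr_ge0.
have de'_le2 x : de' x <= de x by apply: (le_trans (de'_le x)); rewrite ler_piMr.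
have de'0 x : 0 < de' x.
  have /andP[a0 _] := al01 x; have /andP[d0 _] := de01 x.
  by rewrite mulr_gt0 ?invr_gt0// mulr_gt0.
have m1 := gW tT mde'; have m2 := gW tT mde2; have m3 := gW tT mal2; have m4 := gW tT mga.
(* K + C bounds the weighted new position, K by the backward estimate and C because max(W_t, 0) <=
   |W_t|; the other C is for the old wealth. *)
exists de', (C + (K + C)); split => //.
- by move=> x; rewrite de'0/= (le_trans (de'_le2 x)).
- by rewrite !addr_ge0.
move=> phi rphi phiK; have [sphi _] := rphi.
have [WtC phC] := deP phi rphi phiK.
have mWt : measurable_fun setT (W phi t) by apply: (gW (ltnW tT)); apply: mW => //;
    exact: ltnW.
have mWS : measurable_fun setT (W phi t.+1) by apply: (gW tT); exact: mW.
have mphi s i : (s < T)%N -> measurable_fun setT (fun x => tnth (phi s.+1 x) i).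
  by move=> sT; apply: (gW (ltnW sT)); exact: strategies_tnth.
have maphi s i : (s < T)%N -> measurable_fun setT (fun x => `|tnth (phi s.+1 x) i|).
  by move=> sT; apply: measurableT_comp => //; exact: mphi.
have maWt : measurable_fun setT (fun x => `|W phi t x|) by exact: measurableT_comp.
have maWS : measurable_fun setT (fun x => `|W phi t.+1 x|) by exact: measurableT_comp.
pose Z x := al x * (de x * \sum_i `|tnth (phi t.+1 x) i|).
have mZ : measurable_fun setT Z.
  apply: measurable_funM => //; apply: measurable_funM => //.
  by apply: measurable_sum => i; exact: maphi.
have Z0 x : 0 <= Z x by rewrite !mulr_ge0// sumr_ge0.
have ZK : (Ex P Z <= (K + C)%:E)%E.
  apply: (@le_trans _ _ (Ex P (fun x => al x * (de x * (negp (W phi t x) + \sum_i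
      `|tnth (phi t.+1 x) i|)))%R)).
    apply: le_Ex => //.
    - apply: measurable_funM => //; apply: measurable_funM => //; apply: measurable_funD.
        exact: measurable_negp.
      by apply: measurable_sum => i; exact: maphi.
    - by move=> x; rewrite !ler_wpM2l// lerDr negp_ge0.
  apply: (le_trans (alP phi de rphi mde de0)); rewrite EFinD leeD//.
    apply: le_trans phiK; apply: le_trans (gaP phi rphi); apply: le_Ex.
    - by do 2!apply: measurable_funM => //; exact: measurable_negp.
    - by apply: measurable_funM => //; exact: measurable_negp.
    - by move=> x; rewrite mulr_ge0// mulr_ge0// negp_ge0.
    - by move=> x; rewrite ler_wpM2l// ler_piMl// negp_ge0.
  apply: le_trans WtC; apply: le_Ex.
  - by apply: measurable_funM => //; exact: measurable_maxr.
  - exact: measurable_funM.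
  - by move=> x; rewrite mulr_ge0// le_max lexx orbT.
  - by move=> x; rewrite ler_wpM2l// ge_max ler_norm normr_ge0.
have phiZ i x : de' x * `|tnth (phi t.+1 x) i| <= Z x.
  apply: (@le_trans _ _ (de x * al x * `|tnth (phi t.+1 x) i|)); first by rewrite ler_wpM2r.
  rewrite /Z mulrA [al x * _]mulrC ler_wpM2l ?mulr_ge0//.
  by rewrite (bigD1 i)//= lerDl sumr_ge0.
split.
  apply: (@le_trans _ _ (Ex P (fun x => de x * `|W phi t x| + Z x)%R)); last first.
    rewrite ExD//; [|exact: measurable_funM|by move=> x; rewrite mulr_ge0].
    by rewrite EFinD leeD.
  apply: le_Ex.
  - exact: measurable_funM.
  - by apply: measurable_funD => //; exact: measurable_funM.
  - by move=> x; rewrite mulr_ge0// ltW.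
  move=> x; rewrite WS; apply: (@le_trans _ _ (de' x * (`|W phi t x| + sX x * \sum_i
      `|tnth (phi t.+1 x) i|))).
    rewrite ler_wpM2l ?(ltW (de'0 x))//; apply: (le_trans (ler_normD _ _)).
    rewrite lerD2l; apply: (le_trans (ler_norm_sum _ _ _)); rewrite mulr_sumr.
    apply: ler_sum => i _; rewrite normrM mulrC ler_wpM2r//.
    by rewrite /sX (bigD1 i)//= addrCA lerDl addr_ge0// sumr_ge0.
  rewrite mulrDr lerD//; first by rewrite ler_wpM2r.
  have sne : sX x != 0 by rewrite gt_eqF.
  rewrite /de' /Z le_eqVlt; apply/orP; left; apply/eqP.
  by move: (sX x) (\sum_i _) sne => a c ane; field.
move=> s i; rewrite ltnS leq_eqVlt => /orP[/eqP ->|st].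
  apply: (@le_trans _ _ (K + C)%:E); last by rewrite lee_fin lerDr.
  apply: le_trans ZK; apply: le_Ex => //.
  - by apply: measurable_funM => //; exact: maphi.
  - by move=> x; rewrite mulr_ge0// ltW.
apply: (@le_trans _ _ C%:E); last by rewrite lee_fin lerDl addr_ge0.
have sT := ltn_trans st tT.
apply: le_trans (phC s i st); apply: le_Ex.
- by apply: measurable_funM => //; exact: maphi.
- by apply: measurable_funM => //; exact: maphi.
- by move=> x; rewrite mulr_ge0// ltW.
- by move=> x; rewrite ler_wpM2r.
Qed.

End market.

(** * The loss function and the theorem *)

Section loss.
Context {R : realType}.

Lemma utility_loss (U : R -> \bar R) : utility U -> (forall x, U x != -oo%E) ->
  (lim (U x @[x --> +oo%R]) < +oo)%E ->
  exists (B : R) (V : R -> R),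
  [/\ forall x, U x = (B - V x)%:E, forall x, 0 <= V x,
      {homo V : x y /~ x <= y},
      forall x y l, 0 <= l <= 1 -> V (l * x + (1 - l) * y) <= l * V x + (1 - l) * V y &
      forall x c, c < V x -> \forall y \near x, c <= V y].
Proof.
move=> [Ny nd cc usc] NNy limU.
have Ufin x : U x \is a fin_num by rewrite fin_numE Ny NNy.
have cvgU := nondecreasing_cvge nd.
have supE : lim (U x @[x --> +oo%R]) = ereal_sup (range U) by exact/cvg_lim.
rewrite supE in limU.
have Ule x : (U x <= ereal_sup (range U))%E by apply: ereal_sup_ubound; exists x.
have supfin : ereal_sup (range U) \is a fin_num.
  rewrite fin_numElt limU andbT (lt_le_trans _ (Ule 0))//.
  by rewrite ltNye; exact: NNy.
exists (fine (ereal_sup (range U))), (fun x => fine (ereal_sup (range U)) - fine (U x)).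
have UE x : U x = (fine (U x))%:E by rewrite fineK.
split.
- by move=> x; rewrite subKr -UE.
- by move=> x; rewrite subr_ge0 -lee_fin !fineK.
- by move=> x y xy; rewrite lerD2l lerN2 -lee_fin -!UE; exact: nd.
- move=> x y l l01; have := cc x y l l01; rewrite (UE x) (UE y) (UE (_ + _)).
  by rewrite -!EFinM -EFinD lee_fin; lra.
- move=> x c cV; have : (U x < (fine (ereal_sup (range U)) - c)%:E)%E.
    by rewrite (UE x) lte_fin; lra.
  move/usc; apply: filterS => y; rewrite (UE y) lte_fin; lra.
Qed.

(** If V strictly drops from a to b, convexity makes it grow at least linearly to the left of a: for
    x < a, the point a lies between x and b, which gives (a - x)(V a - V b) <= (b - a) V x. *)
Lemma loss_coercive (V : R -> R) : (forall x, 0 <= V x) -> {homo V : x y /~ x <= y} ->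
  (forall x y l, 0 <= l <= 1 -> V (l * x + (1 - l) * y) <= l * V x + (1 - l) * V y) ->
  (forall x y, V x = V y) \/
  exists a b, [/\ 0 <= a, 0 <= b & forall x, negp x <= a + b * V x].
Proof.
move=> V0 Vd Vc; have [cst|ncst] := pselect (forall x y, V x = V y); first by left.
right; have [a [b [ab Vab]]] : exists a b, a < b /\ V b < V a.
  apply: contrapT => h; apply: ncst => x y.
  wlog xy : x y / x <= y.
    by move=> w; have [xy|yx] := leP x y; [|symmetry]; apply: w => //; exact: ltW.
  apply/eqP; rewrite eq_le (Vd _ _ xy) andbT leNgt; apply/negP => lt.
  apply: h; exists x, y; split => //; rewrite lt_neqAle xy andbT.
  by apply: contraTneq lt => ->; rewrite ltxx.
pose c := (b - a) / (V a - V b).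
have c0 : 0 <= c by rewrite divr_ge0// subr_ge0 ltW.
exists `|a|, c; split => // x.
have nx : negp x <= `|a| + negp (x - a).
  have := negpB (x - a) (normr_ge0 a).
  have : x - a - `|a| <= x by have := lerNnormlW (lexx `|a|); lra.
  by move=> /le_negp; lra.
apply: (le_trans nx); rewrite lerD2l.
have [xa|ax] := leP a x.
  by rewrite negp_eq0 ?subr_ge0// mulr_ge0.
rewrite negp_leN ?subr_le0 ?(ltW ax)// opprB.
have bx : 0 < b - x by lra.
pose l := (b - a) / (b - x).
have l01 : 0 <= l <= 1.
  apply/andP; split; first by apply: divr_ge0; lra.
  by rewrite ler_pdivrMr// mul1r; lra.
have := Vc x b l l01.
have -> : l * x + (1 - l) * b = a by rewrite /l; field; rewrite gt_eqF.
have dV : 0 < V a - V b by rewrite subr_gt0.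
move=> h.
have h2 : (b - x) * V a <= (b - a) * V x + (a - x) * V b.
  have -> : (b - a) * V x + (a - x) * V b = (b - x) * (l * V x + (1 - l) * V b).
    by rewrite /l; field; rewrite gt_eqF.
  by rewrite ler_pM2l.
rewrite /c mulrAC ler_pdivlMr//.
by have := V0 b; nra.
Qed.

End loss.

Section expected_utility.
Context {R : realType} {dO : measure_display} {Omega : measurableType dO}.
Variable P : probability Omega R.

(** The upper bound makes the positive part integrable, so the exceptional convention is never
    triggered. *)
Lemma Econv_bounded (f : Omega -> R) (B : R) : measurable_fun setT f ->
  (forall x, f x <= B) ->
  Econv P (fun x => (f x)%:E) = (B%:E - Ex P (fun x => B - f x)%R)%E.
Proof.
move=> mf fB; rewrite /Econv.
set X := fun x => (f x)%:E.
have -> : (\int[P]_x X^\+ x = Ex P (fun x => Num.max (f x) 0%R))%E.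
  by apply: eq_integral => x _; rewrite funeposE EFin_max.
have -> : (\int[P]_x X^\- x = Ex P (fun x => Num.max (- f x) 0)%R)%E.
  by apply: eq_integral => x _; rewrite funenegE EFin_max.
set a := Ex P _; set b := Ex P _; set D := Ex P _.
have m1 : measurable_fun setT (fun x => Num.max (f x) 0) by exact: measurable_maxr.
have m2 : measurable_fun setT (fun x => Num.max (- f x) 0).
  by apply: measurable_maxr => //; exact: measurableT_comp.
have m3 : measurable_fun setT (fun x => B - f x) by exact: measurable_funB.
have max0 (r : R) : 0 <= Num.max r 0 by rewrite le_max lexx orbT.
have D0 x : 0 <= B - f x by rewrite subr_ge0.
have afin : a \is a fin_num.
  apply: (@Ex_fin_num _ _ _ _ _ (Num.max B 0)) => // x.
  by rewrite max0/= ge_max max0 andbT le_max fB.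
(* The identity (B - f) + f^+ + B^- = f^- + B^+ has only nonnegative terms, so it integrates even
   when D and b are infinite. *)
have id : (D + (a + (Num.max (- B) 0)%:E) = b + (Num.max B 0)%:E)%E.
  rewrite -(Ex_cst P (Num.max (- B) 0)) -(Ex_cst P (Num.max B 0)) -!ExD//.
  - apply: eq_Ex => x.
    have split_max (r : R) : Num.max r 0 - Num.max (- r) 0 = r.
      by have [r0|r0] := leP 0 r; [rewrite max_r ?oppr_le0// subr0|rewrite max_l
          ?oppr_ge0 ?sub0r ?opprK// ltW].
    by have := split_max B; have := split_max (f x); lra.
  - exact: measurable_funD.
  - by move=> x; rewrite addr_ge0.
have b0 : (0 <= b)%E by apply: Ex_ge0.
have D0' : (0 <= D)%E by apply: Ex_ge0.
have -> : (a == +oo%E) = false by apply/negP => /eqP h; rewrite h in afin.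
have Bm : Num.max B 0 - Num.max (- B) 0 = B.
  by have [r0|r0] := leP 0 B; [rewrite max_r ?oppr_le0// subr0|rewrite max_l ?oppr_ge0
      ?sub0r ?opprK// ltW].
rewrite /=; move: id; rewrite -(fineK afin) -EFinD.
case: b b0 => [b b0|_|//]; case: D D0' => [D _|_|//] //=.
- by rewrite -!EFinD => -[]; move=> h; congr (_%:E); lra.
Qed.

End expected_utility.

(** Affineness of wealth in the strategy, written with the coefficients l and 1 - l in which
    convexity of the loss is stated. *)
Lemma wealth_mid {R : realType} {dO : measure_display} {Omega : measurableType dO}
    (d : nat) (S phi psi : @process R _ Omega d) w t x :
  wealth S w (fun s o => [tuple (tnth (phi s o) i + tnth (psi s o) i) / 2 | i < d]) t x =
  2^-1 * wealth S w phi t x + (1 - 2^-1) * wealth S w psi t x.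
Proof.
rewrite /wealth (_ : \sum_(1 <= s < t.+1) dotp [tuple _ | i < d] _ =
    2^-1 * \sum_(1 <= s < t.+1) dotp (phi s x) (DeltaS S s x) +
    (1 - 2^-1) * \sum_(1 <= s < t.+1) dotp (psi s x) (DeltaS S s x)); first by field.
rewrite !mulr_sumr -big_split; apply: eq_bigr => s _ /=.
rewrite /dotp !mulr_sumr -big_split; apply: eq_bigr => i _ /=.
by rewrite tnth_mktuple; field.
Qed.

Theorem theorem3p4 (R : realType) (dO : measure_display)
  (Omega : measurableType dO) (P : probability Omega R) (d T : nat)
  (F : nat -> set (set Omega)) (Sfam : set (@process R _ Omega d))
  (U : R -> \bar R) (w0 : R) :
  filtration P F T ->
  Sfam !=set0 ->
  (forall S, Sfam S -> adapted F T S) ->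
  Sstar P F T Sfam !=set0 ->
  utility U ->
  (forall x, U x != -oo%E) ->
  (lim (U x @[x --> +oo%R]) < +oo)%E ->
  exists phi_hat, strategies F T phi_hat /\
    value P F T Sfam U w0 = robust_value P F T Sfam U phi_hat w0 /\
    (robust_value P F T Sfam U phi_hat w0 < +oo)%E.
Proof.
move=> filtF _ aS [S0 [SS0 naS0 inclS]] utU NNy limU.
have [sF FM _ _] := filtF.
have [B [V [UE V0 Vd Vc Vlsc]]] := utility_loss utU NNy limU.
pose L (S phi : @process R _ Omega d) := Ex P (fun x => V (wealth S w0 phi T x)).
have mV : measurable_fun setT V by apply: nonincreasing_measurable => // x y xy; exact: Vd.
have mW S phi : Sfam S -> strategies F T phi -> measurable_fun setT (wealth S w0 phi T).
  move=> SS sphi; apply: (gmeas_measurable (sF T (leqnn T)) (FM T (leqnn T))).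
  by apply: (gmeas_wealth filtF) => //; exact: aS.
have mVW S phi : Sfam S -> strategies F T phi ->
    measurable_fun setT (fun x => V (wealth S w0 phi T x)).
  by move=> SS sphi; apply: measurableT_comp => //; exact: mW.
have L0 S phi : (0 <= L S phi)%E by apply: Ex_ge0.
have EE S phi : Sfam S -> strategies F T phi ->
    Econv P (fun x => U (wealth S w0 phi T x)) = (B%:E - L S phi)%E.
  move=> SS sphi.
  rewrite (_ : (fun x => _) = (fun x => (B - V (wealth S w0 phi T x))%:E)); last first.
    by apply/funext => x; rewrite UE.
  rewrite (@Econv_bounded _ _ _ P _ B).
  - by congr (_ - _)%E; apply: eq_Ex => x; rewrite subKr.
  - by apply: measurable_funB => //; exact: mVW.
  - by move=> x; rewrite gerBl.
have leE c S phi : (c%:E <= B%:E - L S phi)%E = (L S phi <= (B - c)%:E)%E.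
  have := L0 S phi; case: (L S phi) => [r _| |] //=.
  by rewrite -EFinB !lee_fin lerBrDl lerBrDr addrC.
have robust_ge c phi : strategies F T phi ->
    (forall S, Sfam S -> (L S phi <= (B - c)%:E)%E) ->
    (c%:E <= robust_value P F T Sfam U phi w0)%E.
  move=> sphi h; apply: le_ereal_inf_tmp => _ [S SS <-].
  by rewrite EE// leE; exact: h.
have ge_robust phi S : strategies F T phi -> Sfam S ->
    (robust_value P F T Sfam U phi w0 <= B%:E - L S phi)%E.
  by move=> sphi SS; rewrite -EE//; apply: ereal_inf_lbound; exists S.
pose v := value P F T Sfam U w0.
have le_v phi : strategies F T phi -> (robust_value P F T Sfam U phi w0 <= v)%E.
  by move=> sphi; apply: ereal_sup_ubound; exists phi.
(* Not trading yields the finite utility of [w0] under every price process, so the value is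
   finite. *)
pose phi0 : @process R _ Omega d := fun _ _ => [tuple 0 | i < d].
have sphi0 : strategies F T phi0.
  by apply: (strategies_tuple filtF (f := fun _ _ _ => 0)).
have W0 S x : wealth S w0 phi0 T x = w0.
  rewrite /wealth big1 ?addr0// => s _; apply: big1 => i _.
  by rewrite tnth_mktuple mul0r.
have Lphi0 S : L S phi0 = (V w0)%:E.
  by rewrite /L (@eq_Ex _ _ _ _ _ (fun=> V w0)) ?Ex_cst// => x; rewrite W0.
have vB : (v <= B%:E)%E.
  apply: ge_ereal_sup => _ [phi sphi <-]; apply: (le_trans (ge_robust _ _ sphi SS0)).
  by rewrite -[leRHS]adde0 leeD2l// oppe_le0.
have vge : ((B - V w0)%:E <= v)%E.
  apply: le_trans (le_v _ sphi0); apply: robust_ge => // S SS.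
  by rewrite Lphi0 subKr.
have vfin : v \is a fin_num.
  by rewrite fin_numElt (lt_le_trans _ vge) ?ltNyr// (le_lt_trans vB) ?ltry.
have vB' : fine v <= B by rewrite -lee_fin fineK.
(* [B - fine v] is the infimum over strategies of the worst expected loss. *)
suff [phi [sphi phiP]] : exists phi, strategies F T phi /\
    forall S, Sfam S -> (L S phi <= (B - fine v)%:E)%E.
  have h : value P F T Sfam U w0 = robust_value P F T Sfam U phi w0.
    apply/eqP; rewrite eq_le le_v// andbT -/v -(fineK vfin).
    exact: robust_ge.
  by exists phi; split => //; split => //; rewrite -h -/v -(fineK vfin) ltry.
have [Vcst|[a [b [a0 b0 Vab]]]] := loss_coercive V0 Vd Vc.
  exists phi0; split => // S SS; rewrite Lphi0 lee_fin lerBrDl -lerBrDr.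
  rewrite -lee_fin fineK//; apply: ge_ereal_sup => _ [phi sphi <-].
  apply: (le_trans (ge_robust _ _ sphi SS0)).
  by rewrite /L (@eq_Ex _ _ _ _ _ (fun=> V w0)) ?Ex_cst// => x; exact: Vcst.
pose l := B - fine v.
have l0 : 0 <= l by rewrite subr_ge0.
have [p pP] := projections filtF S0.
(* Strategies in [CC 0] have expected loss at most l + 1 under [S0], hence an expected terminal
   negative part of at most K. *)
pose K := a + b * (l + 1).
have K0 : 0 <= K by rewrite addr_ge0// mulr_ge0// addr_ge0.
have [de [C [mde de01 C0 deP]]] :=
  forward_weight filtF (aS _ SS0) naS0 pP w0 K0 (leqnn T).
(* Index [k.1] stands for trading period [k.1 + 1], whose position is measurable for [F k.1]. *)
pose toY (phi : @process R _ Omega d) (k : 'I_T * 'I_d) x := tnth (phi k.1.+1 x) k.2.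
pose CC n : set ('I_T * 'I_d -> Omega -> R) := [set y | exists phi,
  [/\ reduced P T F p phi, y = toY phi &
      forall S, Sfam S -> (L S phi <= (l + n.+1%:R^-1)%:E)%E]].
have sred phi : reduced P T F p phi -> strategies F T phi by case.
have [||||||| y [CCy cy]] := @midpoint_convex_ae_cvg _ _ _ P ('I_T * 'I_d)%type CC de C.
- move=> n y [phi [rphi yE Lphi]]; exists phi; split => // S SS.
  apply: (le_trans (Lphi S SS)); rewrite lee_fin lerD2l lef_pV2 ?posrE//.
  by rewrite ler_nat.
- move=> n; have e0 : 0 < n.+1%:R^-1 :> R by rewrite invr_gt0.
  have [_ [phi sphi <-] hphi] := ub_ereal_sup_adherent e0 vfin.
  have [psi rpsi psiE] := reduce filtF (aS _ SS0) pP sphi.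
  exists (toY psi), psi; split => // S SS.
  have -> : L S psi = L S phi.
    apply: ae_eq_Ex => //; [by apply: mVW => //; exact: sred|exact: mVW|].
    by apply: filterS (psiE S w0 (aS _ SS) (inclS _ SS)) => x ->.
  have := ltW (lt_le_trans hphi (ge_robust _ _ sphi SS)).
  rewrite -[X in (X - _)%E](fineK vfin) -EFinB leE => /le_trans; apply.
  by rewrite lee_fin /l opprB addrA addrAC.
- move=> n _ _ [phi [rphi -> Lphi]] [psi [rpsi -> Lpsi]].
  pose chi : @process R _ Omega d :=
    fun s o => [tuple (tnth (phi s o) i + tnth (psi s o) i) / 2 | i < d].
  have rchi : reduced P T F p chi.
    split.
      apply: (strategies_tuple filtF (f := fun s i o => (tnth (phi s o) i + tnth (psi s
          o) i) / 2)).
      move=> t i tT; apply: measurable_funM => //; apply: measurable_funD.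
        by apply: (strategies_tnth filtF) => //; exact: sred.
      by apply: (strategies_tnth filtF) => //; exact: sred.
    move=> t tT; apply: filterS2 (rphi.2 t tT) (rpsi.2 t tT) => x h1 h2 k.
    transitivity (2^-1 * (\sum_i p t.+1 k i x * tnth (phi t.+1 x) i +
                          \sum_i p t.+1 k i x * tnth (psi t.+1 x) i)).
      rewrite -big_split mulr_sumr; apply: eq_bigr => i _ /=.
      by rewrite tnth_mktuple; field.
    by rewrite h1 h2 addr0 mulr0.
  exists chi; split => //.
    by apply/funext => k; apply/funext => x; rewrite /toY tnth_mktuple.
  move=> S SS.
  have m1 := mVW _ _ SS (sred _ rphi); have m2 := mVW _ _ SS (sred _ rpsi).
  apply: (@le_trans _ _ (Ex P (fun x => 2^-1 * V (wealth S w0 phi T x) + 2^-1 * V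
      (wealth S w0 psi T x))%R)).
    apply: le_Ex => //.
    - by apply: mVW => //; exact: sred.
    - by apply: measurable_funD; exact: measurable_funM.
    - move=> x; rewrite wealth_mid; have := Vc (wealth S w0 phi T x) (wealth S w0 psi T
        x) 2^-1.
      have -> : (1 - 2^-1 : R) = 2^-1 by field.
      by apply; lra.
  have h0 (W : Omega -> R) x : 0 <= 2^-1 * V (W x) by rewrite mulr_ge0// invr_ge0.
  rewrite ExD//; [|exact: measurable_funM..].
  rewrite !ExZ ?invr_ge0//.
  move: (Lphi S SS) (Lpsi S SS); rewrite /L; set e := l + _ => h1 h2.
  apply: (@le_trans _ _ (2^-1%:E * e%:E + 2^-1%:E * e%:E)%E).
    by apply: leeD; apply: lee_wpmul2l => //; rewrite lee_fin invr_ge0.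
  by rewrite -!EFinM -EFinD lee_fin; lra.
- move=> n _ [phi [rphi -> _]] [t i]; rewrite /toY/=.
  have tT := ltn_ord t.
  apply: (gmeas_measurable (sF t (ltnW tT)) (FM t (ltnW tT))).
  by apply: (strategies_tnth filtF) => //; exact: sred.
- exact: (gmeas_measurable (sF T (leqnn T)) (FM T (leqnn T))).
- by move=> x; case/andP: (de01 x).
- move=> _ [phi [rphi -> Lphi]] [t i]; rewrite /toY/=.
  have [|_ h] := deP phi rphi; last exact: h.
  have mS0 := mVW _ _ SS0 (sred _ rphi).
  apply: (@le_trans _ _ (Ex P (fun x => a + b * V (wealth S0 w0 phi T x))%R)).
    apply: le_Ex => //.
    - by apply: measurable_negp; apply: mW => //; exact: sred.
    - by apply: measurable_funD => //; exact: measurable_funM.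
    - by move=> x; exact: negp_ge0.
  rewrite ExD//; [|exact: measurable_funM|by move=> x; rewrite mulr_ge0].
  rewrite Ex_cst ExZ// EFinD leeD2l// EFinM lee_wpmul2l//.
  by apply: (le_trans (Lphi _ SS0)); rewrite invr1.
have /choice[phi phiP] := CCy.
have /choice[z zP] (k : 'I_T * 'I_d) : exists z : Omega -> R, gmeas (F k.1) z /\
    forall x, cvgn (fun n => y n k x) -> y n k x @[n --> \oo] --> z x.
  apply: gmeas_lim => n; have [rphi -> _] := phiP n.
  by apply: (strategies_tnth filtF) => //; exact: sred.
(* Undoes the shift of [toY]; beyond period T, [insub] fails and the position is set to 0. *)
pose zt t i x : R := if insub t.-1 is Some s then z (s, i) x else 0.
have ztE (t : 'I_T) i x : zt t.+1 i x = z (t, i) x by rewrite /zt/= valK.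
pose hat : @process R _ Omega d := fun t x => [tuple zt t i x | i < d].
have shat : strategies F T hat.
  apply: (strategies_tuple filtF (f := zt)) => t i tT.
  rewrite (_ : zt t.+1 i = z (Ordinal tT, i)); first by have [] := zP (Ordinal tT, i).
  by apply/funext => x; rewrite -ztE.
exists hat; split => // S SS.
(* Positions converge off one null set independent of S, so the same limit strategy works for each S
   in turn. *)
apply: (@Ex_fatou _ _ _ _ (fun n x => V (wealth S w0 (phi n) T x))) => //.
- by move=> n; apply: mVW => //; have [/sred] := phiP n.
- exact: mVW.
- apply: filterS cy => x cx c cV.
  have Wcvg : wealth S w0 (phi n) T x @[n --> \oo] --> wealth S w0 hat T x.
    apply: cvgD; first exact: cvg_cst.
    rewrite big_add1/= big_mkord.
    under eq_fun do rewrite big_add1/= big_mkord.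
    apply: cvg_sum => t; apply: cvg_sum => i; apply: cvgM; last exact: cvg_cst.
    rewrite tnth_mktuple ztE.
    have := (zP (t, i)).2 x (cx (t, i)).
    rewrite (_ : (fun n => y n (t, i) x) = (fun n => tnth (phi n t.+1 x) i))//.
    by apply/funext => n; have [_ ->] := phiP n.
  exact: Wcvg _ (Vlsc _ _ cV).
- by move=> n; have [_ _ h] := phiP n; exact: h.
Qed.
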